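(* Let $\gamma>0$, $\beta>0$ and $k_{\max}>1$. The infimum in the variational formula $$\inf_{\Psi\ \text{admissible trajectory setting}}\big(\mathrm I(\Psi)+\gamma\,\mathrm S(\Psi)+\beta\,\mathrm M(\Psi)\big)$$ is attained, and every minimizer $\Psi=((\nu_k)_{k=1}^{k_{\max}},(\mu_m)_{m=0}^\infty)$ has the following form: $$\nu_k(dx_0,\dots,dx_{k-1})=\mu(dx_0)\,A(x_0)\prod_{l=1}^{k-1}\big(C(x_l)\,M(dx_l)\big)\,\mathrm e^{-\gamma\widetilde f_k(x_0,\dots,x_{k-1})},\qquad k\in[k_{\max}],$$ $$\mu_m(dx)=\mu(dx)\,B(x)\,\frac{(C(x)\mu(W))^{-m}}{m!}\,\mathrm e^{-\beta\eta(m)},\qquad m\in\mathbb N_0,$$ where $A,B,C:W\to[0,\infty)$ are functions such that the conditions (i), (ii), (iii) in the definition of an admissible trajectory setting are satisfied, and $M=\sum_{m=0}^\infty m\mu_m$.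
   Context: **General notation.** $\mathbb N=\{1,2,\dots\}$, $\mathbb N_0=\mathbb N\cup\{0\}$, $[k]=\{1,\dots,k\}$. For a topological space $V$, $\mathcal M(V)$ is the set of finite nonnegative Borel measures on $V$ with the weak topology. Elements of $W^k$ are written $(x_0,\dots,x_{k-1})$; $\pi_l\nu\in\mathcal M(W)$ denotes the $l$-th marginal ($l=0,\dots,k-1$) of $\nu\in\mathcal M(W^k)$. **Setting.** Let $d\in\mathbb N$, let $W\subset\mathbb R^d$ be compact and contain the origin, let $\mu\in\mathcal M(W)$ be absolutely continuous (with respect to Lebesgue measure) with $\mu(W)>0$, and fix $k_{\max}\in\mathbb N$. For each $k\in[k_{\max}]$ let $f_k:\mathcal M(W)\times W^k\to\mathbb R$ be continuous and bounded from below, and let $\eta:\mathbb N_0\to\mathbb R$ be bounded from below with $\lim_{m\to\infty}\eta(m)/m=\infty$. **Admissible trajectory settings.** An admissible trajectory setting is a collection $\Psi=((\nu_k)_{k=1}^{k_{\max}},(\mu_m)_{m=0}^\infty)$ with $\nu_k\in\mathcal M(W^k)$, $\mu_m\in\mathcal M(W)$ and $$\text{(i) }\sum_{k=1}^{k_{\max}}\pi_0\nu_k=\mu,\qquad\text{(ii) }\sum_{m=0}^\infty\mu_m=\mu,\qquad\text{(iii) }M:=\sum_{m=0}^\infty m\mu_m=\sum_{k=1}^{k_{\max}}\sum_{l=1}^{k-1}\pi_l\nu_k.$$ **Functionals.** For finite Borel measures $\nu,\widetilde\nu$ on a measurable $V\subset\mathbb R^n$, $\mathcal H_V(\nu\mid\widetilde\nu)=\int_V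 d\nu\,\log\frac{d\nu}{d\widetilde\nu}-\nu(V)+\widetilde\nu(V)$ if the density exists, and $+\infty$ otherwise. With $c_m=\exp(-1/(\mathrm e\,\mu(W)))\,(\mathrm e\,\mu(W))^{-m}/m!$ and $M(W)^0=1$, $$\mathrm S(\Psi)=\sum_{k=1}^{k_{\max}}\int_{W^k}d\nu_k\,\widetilde f_k,\quad \widetilde f_k(x_0,\dots,x_{k-1})=f_k(\mu,x_0,\dots,x_{k-1}),\qquad \mathrm M(\Psi)=\sum_{m=0}^\infty\eta(m)\mu_m(W),$$ $$\mathrm I(\Psi)=\sum_{k=1}^{k_{\max}}\mathcal H_{W^k}\big(\nu_k\mid\mu\otimes M^{\otimes(k-1)}\big)+\sum_{m=0}^\infty\mathcal H_W(\mu_m\mid\mu c_m)+\mu(W)\Big(1-\sum_{k=1}^{k_{\max}}M(W)^{k-1}\Big)-\frac1{\mathrm e}.$$ *)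

(* Defs.v *)
From HB Require Import structures.
From mathcomp Require Import all_boot all_order all_algebra.
From mathcomp Require Import all_classical all_reals all_analysis.

Set Implicit Arguments.
Unset Strict Implicit.
Unset Printing Implicit Defensive.

Import Order.TTheory GRing.Theory Num.Theory.
Import numFieldNormedType.Exports.

Local Open Scope classical_set_scope.
Local Open Scope ring_scope.
Local Open Scope ereal_scope.

Definition borel (V : ptopologicalType) := g_sigma_algebraType (@open V).

HB.instance Definition _ (V : ptopologicalType) := Measurable.on (borel V).

(* A point of [fmeasure] is a function on all subsets of [V]; measures that
   agree on Borel sets are distinct terms but topologically indistinguishable,
   so that a continuous real function cannot separate them. *)
Definition fmeasure (R : realType) (V : ptopologicalType) : Type :=
  {finite_measure set (borel V) -> \bar R}.

Section weak_topology.
Context (R : realType) (V : ptopologicalType).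

HB.instance Definition _ := gen_eqMixin (fmeasure R V).
HB.instance Definition _ := gen_choiceMixin (fmeasure R V).

Definition test_function : Type :=
  {g : V -> R | continuous g /\ [bounded g x | x in [set: V]]}.

Definition fmeasure_eval (nu : fmeasure R V) : {ptws test_function -> R} :=
  fun g => (\int[nu]_(x in [set: borel V]) (sval g x : R))%R.

HB.instance Definition _ :=
  Topological.copy (fmeasure R V) (initial_topology fmeasure_eval).

End weak_topology.

Definition subspace0 (R : realType) (d : nat) (W : set 'rV[R]_d) (W0 : W 0%R)
  : Type := set_type W.

Section subspace0_instances.
Context (R : realType) (d : nat) (W : set 'rV[R]_d) (W0 : W 0%R).

HB.instance Definition _ := Topological.copy (subspace0 W0) (set_type W).
HB.instance Definition _ := isPointed.Build (subspace0 W0)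
  (exist _ 0%R (mem_set W0) : set_type W).

End subspace0_instances.

Section cons_measure.
Context disp (T : measurableType disp) (R : realType) (n : nat).
Variables (m : {sigma_finite_measure set T -> \bar R})
  (P : {sigma_finite_measure set (n.-tuple T) -> \bar R}).

Let tcons (p : T * n.-tuple T) : n.+1.-tuple T := [tuple of p.1 :: p.2].

Definition cons_measure : set (n.+1.-tuple T) -> \bar R :=
  pushforward (m \x P) tcons.

Let measurable_tcons : measurable_fun [set: T * n.-tuple T] tcons.
Proof. exact: measurable_cons. Qed.

Let cons0 : cons_measure set0 = 0.
Proof. by rewrite /cons_measure /pushforward preimage_set0 measure0. Qed.

Let cons_ge0 A : 0 <= cons_measure A.
Proof. exact: measure_ge0. Qed.

Let cons_sigma_additive : semi_sigma_additive cons_measure.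
Proof.
move=> F mF tF mUF; rewrite /cons_measure /pushforward preimage_bigcup.
apply: measure_semi_sigma_additive.
- by move=> i; rewrite -[X in measurable X]setTI; exact: measurable_tcons.
- apply/trivIsetP => /= i j _ _ ij; rewrite -preimage_setI.
  by move/trivIsetP : tF => /(_ _ _ _ _ ij) ->//; rewrite preimage_set0.
- rewrite -preimage_bigcup -[X in measurable X]setTI.
  exact: measurable_tcons.
Qed.

HB.instance Definition _ := isMeasure.Build _ _ _
  cons_measure cons0 cons_ge0 cons_sigma_additive.

Let cons_sigma_finite : sigma_finite setT cons_measure.
Proof.
have /sigma_finiteP[F [FT ndF mF]] := sigma_finiteT m.
have /sigma_finiteP[G [GT ndG mG]] := sigma_finiteT P.
pose uncons (t : n.+1.-tuple T) : T * n.-tuple T :=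
  (tnth t ord0, [tuple of behead t]).
have muncons : measurable_fun [set: n.+1.-tuple T] uncons.
  by apply/measurable_fun_pair;
    [exact: measurable_tnth|exact: measurable_behead].
have unconsK : cancel tcons uncons.
  by move=> [x t]; congr pair; apply/val_inj.
have FGT : [set: T * n.-tuple T] = \bigcup_i (F i `*` G i).
  rewrite -setXTT FT GT predeqE => -[x y]; split.
    move=> [/= [i _ Fix] [k _ Gky]]; exists (maxn i k) => //; split.
    - by move: x Fix; exact/subsetPset/ndF/leq_maxl.
    - by move: y Gky; exact/subsetPset/ndG/leq_maxr.
  by move=> [i _ []/= ? ?]; split; exists i.
exists (fun i => uncons @^-1` (F i `*` G i)).
  by rewrite -preimage_bigcup -FGT preimage_setT.
move=> i; have [? ?] := mF i; have [? ?] := mG i; split.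
  by rewrite -[X in measurable X]setTI; apply: muncons => //; exact: measurableX.
rewrite /cons_measure /pushforward -comp_preimage.
rewrite (_ : uncons \o tcons = id); last by apply/funext => p; exact: unconsK.
by rewrite preimage_id product_measure1E// lte_mul_pinfty// ge0_fin_numE.
Qed.

HB.instance Definition _ := Measure_isSigmaFinite.Build _ _ _
  cons_measure cons_sigma_finite.

End cons_measure.

Section power_measure.
Context disp (T : measurableType disp) (R : realType).
Variable m : {sigma_finite_measure set T -> \bar R}.

Fixpoint power_measure (n : nat) :
    {sigma_finite_measure set (n.-tuple T) -> \bar R} :=
  if n is n'.+1 then cons_measure m (power_measure n')
  else \d_([tuple] : 0.-tuple T).

End power_measure.

Section lebesgue_ac.
Context (R : realType) (d : nat) (W : set 'rV[R]_d) (W0 : W 0%R).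

Definition coordinates (x : borel (subspace0 W0)) :
  d.-tuple (measurableTypeR R) := [tuple set_val (x : set_type W) ord0 i | i < d].

Definition lebesgue_ac (mu : set (borel (subspace0 W0)) -> \bar R) : Prop :=
  pushforward mu coordinates `<< power_measure lebesgue_measure d.

End lebesgue_ac.

(* A density exists iff [nu] is dominated by [nu'] (Radon-Nikodym). The value of
   [lne] at a vanishing density is irrelevant, since that set is [nu]-null. *)
Definition entropy disp (T : measurableType disp) (R : realType)
    (nu : {finite_measure set T -> \bar R})
    (nu' : {sigma_finite_measure set T -> \bar R}) : \bar R :=
  if pselect (nu `<< nu') then
    \int[nu]_x lne (Radon_Nikodym (charge_of_finite_measure nu) nu' x)
      - nu setT + nu' setT
  else +oo.

Section trajectory_settings.
Context disp (T : measurableType disp) (R : realType) (kmax : nat).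

Definition marginal (n : nat) (l : 'I_n) (nu : set (n.-tuple T) -> \bar R) :
  set T -> \bar R := pushforward nu (fun x => tnth x l).

Definition first_moment (mu_ : nat -> {finite_measure set T -> \bar R}) :
  set T -> \bar R := mseries (fun m => mscale (NngNum (ler0n R m)) (mu_ m)) 0.

(* The index k : 'I_kmax stands for trajectories with k + 1 points x_0, .., x_k,
   i.e. it is shifted by one with respect to k = 1, .., kmax. The sigma-algebra
   on tuples is the product one; for T the Borel space of a second countable
   space it is the Borel sigma-algebra of the product topology. *)
Record trajectory_setting (mu : set T -> \bar R) := TrajectorySetting {
  ts_nu : forall k : 'I_kmax, {finite_measure set (k.+1.-tuple T) -> \bar R} ;
  ts_mu : nat -> {finite_measure set T -> \bar R} ;
  ts_sources : forall A, measurable A ->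
    \sum_(k < kmax) marginal ord0 (ts_nu k) A = mu A ;
  ts_receivers : forall A, measurable A ->
    \sum_(0 <= m <oo) ts_mu m A = mu A ;
  ts_relays : forall A, measurable A ->
    first_moment ts_mu A =
    \sum_(k < kmax) \sum_(l < k.+1 | (0 < l)%N) marginal l (ts_nu k) A
}.

Section relay_measure.
Variables (mu : set T -> \bar R) (Psi : trajectory_setting mu).

Definition relay_measure : set T -> \bar R := first_moment (ts_mu Psi).

HB.instance Definition _ := Measure.on relay_measure.

Let relay_fin_num : fin_num_fun relay_measure.
Proof.
move=> A mA; rewrite /relay_measure ts_relays//.
elim/big_ind: _ => // [x y|k _]; first by move=> ? ?; rewrite fin_numD; apply/andP.
elim/big_ind: _ => // [x y|l _]; first by move=> ? ?; rewrite fin_numD; apply/andP.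
apply: fin_num_measure; rewrite -[X in measurable X]setTI.
exact: measurable_tnth.
Qed.

HB.instance Definition _ := Measure_isFinite.Build _ _ _
  relay_measure relay_fin_num.

End relay_measure.

End trajectory_settings.

Section functionals.
Context disp (T : measurableType disp) (R : realType) (kmax : nat).
Variables (mu : {finite_measure set T -> \bar R}).
(* [ft k] is the function f_{k+1} with its first argument frozen at mu *)
Variables (ft : forall k : 'I_kmax, k.+1.-tuple T -> R) (eta : nat -> R).
Implicit Type Psi : trajectory_setting kmax mu.

Let muW : R := fine (mu setT).

(* the product of mu (for x_0) and k copies of M (for x_1, .., x_k) *)
Definition reference_measure Psi (k : nat) :
    {sigma_finite_measure set (k.+1.-tuple T) -> \bar R} :=
  cons_measure mu (power_measure (relay_measure Psi) k).

Definition receiver_weight (m : nat) : R :=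
  expR (- (expR 1 * muW)^-1) * (expR 1 * muW) ^- m / m`!%:R.

Lemma receiver_weight_ge0 m : (0 <= receiver_weight m)%R.
Proof.
by rewrite /receiver_weight !mulr_ge0 ?expR_ge0// invr_ge0 ?exprn_ge0//
  mulr_ge0 ?expR_ge0// fine_ge0.
Qed.

Definition functional_S Psi : \bar R :=
  \sum_(k < kmax) \int[ts_nu Psi k]_x (ft x)%:E.

Definition functional_M Psi : \bar R :=
  \sum_(0 <= m <oo) (eta m)%:E * ts_mu Psi m setT.

Definition functional_I Psi : \bar R :=
  \sum_(k < kmax) entropy (ts_nu Psi k) (reference_measure Psi k)
  + \sum_(0 <= m <oo)
      entropy (ts_mu Psi m) (mscale (NngNum (receiver_weight_ge0 m)) mu)
  + (muW * (1 - \sum_(k < kmax) fine (relay_measure Psi setT) ^+ k)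
     - (expR 1)^-1)%:E.

Definition objective (gamma beta : R) Psi : \bar R :=
  functional_I Psi + gamma%:E * functional_S Psi + beta%:E * functional_M Psi.

Definition is_minimizer (gamma beta : R) Psi : Prop :=
  objective gamma beta Psi = ereal_inf (range (objective gamma beta)).

(* The density of mu_m is extended-real valued: (C x * mu(W))^{-m} is +oo when
   C x = 0 and m > 0, and 0 * +oo = 0. *)
Definition gibbs_form (gamma beta : R) (A B C : T -> R) Psi : Prop :=
  (forall (k : 'I_kmax) D, measurable D ->
    ts_nu Psi k D = \int[reference_measure Psi k]_(x in D)
      (A (tnth x ord0) * \prod_(l < k.+1 | (0 < l)%N) C (tnth x l)
       * expR (- gamma * ft x))%:E) /\
  (forall (m : nat) D, measurable D ->
    ts_mu Psi m D = \int[mu]_(x in D)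
      ((B x)%:E * (((C x * muW)%:E ^+ m)^-1 * (m`!%:R^-1)%:E)
       * (expR (- beta * eta m))%:E)).

End functionals.

(* Main.v *)
Require Import Defs.
From HB Require Import structures.
From mathcomp Require Import all_boot all_order all_algebra.
From mathcomp Require Import all_classical all_reals all_analysis.
From mathcomp Require Import measurable_realfun ring lra zify.

Set Implicit Arguments.
Unset Strict Implicit.
Unset Printing Implicit Defensive.

Import Order.TTheory GRing.Theory Num.Theory.
Import numFieldNormedType.Exports.

Local Open Scope classical_set_scope.
Local Open Scope ring_scope.


Section relative_entropy_function.
Variable R : realType.
Implicit Types t u h e th : R.

Definition ent t : R := t * ln t.
Definition kl t : R := t * ln t - t + 1.

Lemma ent0 : ent 0 = 0. Proof. by rewrite /ent mul0r. Qed.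

Lemma kl_young t th : 0 <= t -> t * th - (expR th - 1) <= kl t.
Proof.
rewrite le_eqVlt => /predU1P[<-|t0]; rewrite /kl.
  by rewrite !mul0r; have := expR_ge0 th; lra.
have := @expR_ge1Dx _ (th - ln t); rewrite expRB lnK//.
rewrite -(ler_pM2l t0) mulrCA divff ?gt_eqF// mulr1; nra.
Qed.

Lemma kl_ge0 t : 0 <= t -> 0 <= kl t.
Proof. by move=> /(kl_young 0); rewrite mulr0 expR0 subrr subr0. Qed.

Lemma kl_le_sqr t : 0 <= t -> kl t <= (t - 1) ^+ 2.
Proof.
rewrite le_eqVlt => /predU1P[<-|t0]; rewrite /kl.
  by rewrite !mul0r expr2; lra.
have : ln t <= t - 1 by rewrite -ler_expR lnK//; have := expR_ge1Dx (t - 1); lra.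
rewrite expr2; nra.
Qed.

Lemma ent_ge t : 0 <= t -> -1 <= ent t.
Proof.
by move=> t0; have := kl_young (-1) t0; have := kl_ge0 t0; rewrite /ent /kl;
  have := expR_ge0 (-1 : R); lra.
Qed.

Lemma ent_bregman u h : 0 < u -> 0 <= u + h ->
  `|ent (u + h) - ent u - h * (ln u + 1)| <= h ^+ 2 / u.
Proof.
move=> u0 uh0.
suff -> : ent (u + h) - ent u - h * (ln u + 1) = u * kl ((u + h) / u).
  have uhu : 0 <= (u + h) / u by rewrite divr_ge0// ltW.
  rewrite ger0_norm ?mulr_ge0 ?kl_ge0 ?(ltW u0)//.
  apply: (le_trans (ler_wpM2l (ltW u0) (kl_le_sqr uhu))).
  rewrite le_eqVlt; apply/orP; left; apply/eqP; field.
  by rewrite gt_eqF.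
rewrite /kl /ent; have [uh|uh] := eqVneq (u + h) 0.
  by have -> : h = - u; [lra|rewrite subrr !mul0r; ring].
rewrite lnM ?posrE ?invr_gt0// ?lt0r ?uh// lnV ?posrE//; field.
by rewrite gt_eqF.
Qed.

Lemma ent_scale e h : 0 < e -> 0 <= h -> ent (e * h) = e * ln e * h + e * ent h.
Proof.
move=> e0; rewrite le_eqVlt => /predU1P[<-|h0]; first by rewrite mulr0 ent0; ring.
by rewrite /ent lnM ?posrE//; ring.
Qed.

Definition ent_sing u h : R := if u == 0 then h else 0.
Definition ent_reg u h : R := if u == 0 then ent h else h * (ln u + 1).

Lemma ent_expansion d u h e : 0 < d -> 0 <= u -> 0 < e -> e * `|h| <= d ->
  h = 0 \/ d <= u \/ (u = 0 /\ 0 <= h) ->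
  0 <= u + e * h /\
  `|ent (u + e * h) - ent u - (e * ln e * ent_sing u h + e * ent_reg u h)|
    <= e ^+ 2 * (h ^+ 2 / d).
Proof.
move=> d0 u0 e0 ehd H.
have rhs0 : 0 <= e ^+ 2 * (h ^+ 2 / d) by rewrite mulr_ge0 ?divr_ge0 ?sqr_ge0 ?(ltW d0).
have [u00|un0] := eqVneq u 0.
  rewrite /ent_sing /ent_reg u00 eqxx add0r ent0 subr0.
  have h0 : 0 <= h by case: H => [->//|[|[]//]]; rewrite u00 leNgt d0.
  split; first by rewrite mulr_ge0// ltW.
  by rewrite ent_scale// subrr normr0.
have up : 0 < u by rewrite lt0r un0.
rewrite /ent_sing /ent_reg (negbTE un0).
case: H => [->|[du|[/eqP]]]; last by rewrite (negbTE un0).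
  rewrite mulr0 addr0; split => //.
  by rewrite mul0r !mulr0 subrr addr0 subr0 normr0 expr0n/= mul0r mulr0.
have uh0 : 0 <= u + e * h.
  have : - (e * h) <= e * `|h|.
    by rewrite -mulrN ler_wpM2l ?(ltW e0)// -normrN ler_norm.
  lra.
split => //; rewrite mulr0 add0r mulrA.
apply: (le_trans (ent_bregman up uh0)).
rewrite exprMn -mulrA ler_wpM2l ?sqr_ge0// ler_wpM2l ?sqr_ge0//.
by rewrite lef_pV2 ?posrE.
Qed.

Lemma small_parameter (b a K e0 : R) : 0 < e0 ->
  (forall e, 0 < e -> e <= e0 -> 0 <= e * ln e * b + e * a + K * e ^+ 2) ->
  b <= 0 /\ (b = 0 -> 0 <= a).
Proof.
move=> e00 H.
have H' e : 0 < e -> e <= e0 -> 0 <= ln e * b + a + K * e.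
  move=> ep ee; rewrite -(pmulr_rge0 _ ep); have := H e ep ee.
  by rewrite le_eqVlt => /predU1P[->|/ltW]; rewrite !mulrDr expr2 !mulrA (mulrC K).
split.
  rewrite leNgt; apply/negP => b0.
  pose e := Num.min e0 (Num.min 1 (expR (- ((`|a| + `|K| + 1) / b)))).
  have ep : 0 < e by rewrite !lt_min e00 ltr01 expR_gt0.
  have ee0 : e <= e0 by rewrite ge_min lexx.
  have e1 : e <= 1 by rewrite !ge_min lexx orbT.
  have lne : ln e * b <= - (`|a| + `|K| + 1).
    rewrite -ler_pdivlMr// mulNr -ler_expR lnK//.
    by rewrite !ge_min lexx !orbT.
  have KK : K * e <= `|K|.
    by rewrite (le_trans (ler_norm _))// normrM (gtr0_norm ep) ler_piMr.
  by have := H' e ep ee0; have := ler_norm a; lra.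
move=> b0; rewrite leNgt; apply/negP => a0.
pose e := Num.min e0 (- a / (2 * (`|K| + 1))).
have K1 : 0 < 2 * (`|K| + 1) by have := normr_ge0 K; lra.
have ep : 0 < e by rewrite lt_min e00 divr_gt0// oppr_gt0.
have ee0 : e <= e0 by rewrite ge_min lexx.
have := H' e ep ee0; rewrite b0 mulr0 add0r => H''.
have ea : e * (2 * (`|K| + 1)) <= - a by rewrite -ler_pdivlMr// ge_min lexx orbT.
have := ler_norm K; nra.
Qed.

Lemma clamp_ln_ge0 (r c : R) : 0 < c -> (1 <= c <= r) || (r <= c <= 1) ->
  0 <= r * ln c - (c - 1).
Proof.
move=> c0 H; have := kl_ge0 (ltW c0); rewrite /kl => klc.
have [/andP[c1 cr]|/andP[rc c1]] := orP H.
  by have := ln_ge0 c1; nra.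
by have := ln_le0 c1; nra.
Qed.

End relative_entropy_function.


Section density_measure.
Context d (T : measurableType d) (R : realType).
Variables (mu : {measure set T -> \bar R}) (f : T -> R).
Hypothesis mf : measurable_fun setT f.
Hypothesis f0 : forall x, 0 <= f x.
Hypothesis intf : mu.-integrable setT (EFin \o f).
Local Open Scope ereal_scope.

Definition density_measure of measurable_fun setT f & (forall x, (0 <= f x)%R)
  & mu.-integrable setT (EFin \o f) :=
  fun A : set T => \int[mu]_(x in A) (f x)%:E.

Local Notation nu := (density_measure mf f0 intf).

Let nu0 : nu set0 = 0. Proof. exact: integral_set0. Qed.

Let nu_ge0 A : 0 <= nu A.
Proof. by apply: integral_ge0 => x _; rewrite lee_fin. Qed.

Let nu_additive : semi_sigma_additive nu.
Proof.
apply: semi_sigma_additive_nng_induced => [|x]; last by rewrite lee_fin.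
exact/measurable_EFinP.
Qed.

HB.instance Definition _ := isMeasure.Build _ _ _ nu nu0 nu_ge0 nu_additive.

Let nu_fin : fin_num_fun nu.
Proof. by move=> A mA; apply: integrable_fin_num => //; exact: integrableS intf. Qed.

HB.instance Definition _ := Measure_isFinite.Build _ _ _ nu nu_fin.

Definition density_finite_measure : {finite_measure set T -> \bar R} := nu.

End density_measure.

Lemma measurable_bool_set d (T : measurableType d) (P : T -> bool) :
  measurable_fun setT P -> measurable [set x | P x].
Proof.
move=> mP; rewrite (_ : [set x | P x] = setT `&` P @^-1` [set true]).
  exact: mP.
by rewrite setTI; apply/seteqP; split => x /=; case: (P x).
Qed.

Section is_density.
Context d (T : measurableType d) (R : realType).
Local Open Scope ereal_scope.

Definition is_density (mu : {measure set T -> \bar R}) (nu : set T -> \bar R)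
    (f : T -> R) : Prop :=
  [/\ measurable_fun setT f, forall x, (0 <= f x)%R &
      forall A, measurable A -> nu A = \int[mu]_(x in A) (f x)%:E].

Lemma density_measureP (mu : {measure set T -> \bar R}) f mf f0 intf :
  is_density mu (@density_finite_measure _ _ _ mu f mf f0 intf) f.
Proof. by []. Qed.

Lemma is_density_dominates (mu : {measure set T -> \bar R})
    (nu : {measure set T -> \bar R}) f : is_density mu nu f -> nu `<< mu.
Proof.
move=> [mf f0 nuE]; apply/null_content_dominatesP => A mA muA.
rewrite nuE// null_set_integral//.
by apply/measurable_EFinP; exact: measurable_funS mf.
Qed.

Lemma is_density_integrable (mu : {measure set T -> \bar R})
    (nu : {finite_measure set T -> \bar R}) f : is_density mu nu f ->
  mu.-integrable setT (EFin \o f).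
Proof.
move=> [mf f0 nuE]; apply/integrableP; split; first exact/measurable_EFinP.
under eq_integral do rewrite gee0_abs ?lee_fin//.
by rewrite -nuE// -ge0_fin_numE// fin_num_measure.
Qed.

Lemma ae_density_eq (mu : {measure set T -> \bar R})
    (nu : {finite_measure set T -> \bar R}) f g :
  is_density mu nu f -> is_density mu nu g -> {ae mu, forall x, f x = g x}.
Proof.
move=> df dg.
have : ae_eq mu setT (EFin \o f) (EFin \o g).
  apply: integral_ae_eq => //; first exact: is_density_integrable df.
    by apply/measurable_EFinP; case: dg.
  by move=> E _ mE; case: df => _ _ <-//; case: dg => _ _ <-.
by apply: filterS => x /(_ I) [].
Qed.

Lemma is_density_ae (mu : {measure set T -> \bar R}) (nu : set T -> \bar R) (f g : T -> R) :
  is_density mu nu f -> measurable_fun setT g -> (forall x, 0 <= g x)%R ->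
  {ae mu, forall x, f x = g x} -> is_density mu nu g.
Proof.
move=> [mf f0 nuE] mg g0 fg; split => // A mA; rewrite nuE//.
apply: ae_eq_integral => //.
- by apply/measurable_EFinP; exact: measurable_funS mf.
- by apply/measurable_EFinP; exact: measurable_funS mg.
- by apply: filterS fg => x -> _.
Qed.

Lemma is_density_exists (mu : {sigma_finite_measure set T -> \bar R})
    (nu : {finite_measure set T -> \bar R}) : nu `<< mu ->
  exists f, is_density mu nu f.
Proof.
move=> numu; exists (fine \o Radon_Nikodym_SigmaFinite.f nu mu); split.
- apply/measurable_EFinP.
  rewrite (_ : EFin \o _ = Radon_Nikodym_SigmaFinite.f nu mu).
    exact: measurable_int (Radon_Nikodym_SigmaFinite.f_integrable _).
  by apply/funext => x /=; rewrite fineK// Radon_Nikodym_SigmaFinite.f_fin_num.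
- by move=> x; rewrite fine_ge0// Radon_Nikodym_SigmaFinite.f_ge0.
- move=> A mA; rewrite (Radon_Nikodym_SigmaFinite.f_integral numu)//.
  by apply: eq_integral => x _; rewrite /= fineK// Radon_Nikodym_SigmaFinite.f_fin_num.
Qed.

Lemma is_density_integral (mu : {sigma_finite_measure set T -> \bar R})
    (nu : {finite_measure set T -> \bar R}) f (h : T -> \bar R) A :
  is_density mu nu f -> measurable A -> measurable_fun setT h ->
  (forall x, 0 <= h x) ->
  \int[nu]_(x in A) h x = \int[mu]_(x in A) (h x * (f x)%:E).
Proof.
move=> df mA mh h0; have numu := is_density_dominates df.
rewrite -(Radon_Nikodym_SigmaFinite.change_of_variables numu)//; last first.
  exact: measurable_funTS.
set g := Radon_Nikodym_SigmaFinite.f nu mu.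
have mg : measurable_fun setT g.
  exact: measurable_int (Radon_Nikodym_SigmaFinite.f_integrable numu).
have [mf f0 nuE] := df.
have fg : ae_eq mu setT (EFin \o f) g.
  apply: integral_ae_eq => //; first exact: is_density_integrable df.
  by move=> E _ mE; rewrite -nuE// -Radon_Nikodym_SigmaFinite.f_integral.
apply: ae_eq_integral => //.
- by apply/measurable_funTS; exact: emeasurable_funM.
- by apply/measurable_funTS/emeasurable_funM => //; exact/measurable_EFinP.
- by apply: filterS fg => x /(_ I) /= <-.
Qed.

Lemma is_density_integrable_fun (mu : {sigma_finite_measure set T -> \bar R})
    (nu : {finite_measure set T -> \bar R}) f (h : T -> R) :
  is_density mu nu f -> measurable_fun setT h ->
  nu.-integrable setT (EFin \o h) <->
  mu.-integrable setT (fun x => (h x * f x)%:E).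
Proof.
move=> df mh; have [mf f0 _] := df.
have mhf : measurable_fun setT (fun x => h x * f x)%R by exact: measurable_funM.
have E : \int[nu]_x `|(EFin \o h) x| = \int[mu]_x `|(h x * f x)%:E|.
  rewrite (is_density_integral df)//; last by apply: measurableT_comp => //; exact/measurable_EFinP.
  by apply: eq_integral => x _; rewrite EFinM abseM [`|(f x)%:E|]gee0_abs ?lee_fin.
split => /integrableP[_ hfin]; apply/integrableP; split.
- exact/measurable_EFinP.
- by rewrite -E.
- exact/measurable_EFinP.
- by rewrite E.
Qed.

Lemma is_density_Rintegral (mu : {sigma_finite_measure set T -> \bar R})
    (nu : {finite_measure set T -> \bar R}) f (h : T -> R) :
  is_density mu nu f -> measurable_fun setT h ->
  nu.-integrable setT (EFin \o h) ->
  (\int[nu]_x h x = \int[mu]_x (h x * f x))%R.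
Proof.
move=> df mh ih; have [mf f0 _] := df; congr fine.
have mpos : measurable_fun setT (fun x => (h^\+ x)%:E).
  by apply/measurable_EFinP; exact: measurable_funrpos.
have mneg : measurable_fun setT (fun x => (h^\- x)%:E).
  by apply/measurable_EFinP; exact: measurable_funrneg.
rewrite integralE [RHS]integralE; congr (_ - _).
  transitivity (\int[nu]_x (h^\+ x)%:E).
    by apply: eq_integral => x _; rewrite -[LHS]/((EFin \o h)^\+ x) funerpos.
  rewrite (is_density_integral df)//; last by move=> x; rewrite lee_fin.
  apply: eq_integral => x _; rewrite -EFinM.
  rewrite -[RHS]/((EFin \o (fun x => h x * f x)%R)^\+ x) funerpos/=.
  by congr EFin; rewrite /funrpos maxr_pMl// mul0r.
transitivity (\int[nu]_x (h^\- x)%:E).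
  by apply: eq_integral => x _; rewrite -[LHS]/((EFin \o h)^\- x) funerneg.
rewrite (is_density_integral df)//; last by move=> x; rewrite lee_fin.
apply: eq_integral => x _; rewrite -EFinM.
  rewrite -[RHS]/((EFin \o (fun x => h x * f x)%R)^\- x) funerneg/=.
by congr EFin; rewrite /funrneg maxr_pMl// mul0r mulNr.
Qed.

Lemma is_density_bounded (mu : {finite_measure set T -> \bar R})
    (nu : {finite_measure set T -> \bar R}) (K : R) : (0 <= K)%R ->
  (forall A, measurable A -> nu A <= K%:E * mu A) ->
  exists f, is_density mu nu f /\ forall x, (f x <= K)%R.
Proof.
move=> K0 numuK.
have numu : nu `<< mu.
  apply/null_content_dominatesP => A mA muA.
  by apply/eqP; rewrite eq_le measure_ge0 andbT -(mule0 K%:E) -muA numuK.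
have [f df] := is_density_exists numu; have [mf f0 nuE] := df.
pose g x := Num.min (f x) K.
exists g; split; last by move=> x; rewrite /g ge_min lexx orbT.
apply: (is_density_ae df).
- by apply: measurable_minr => //; exact: measurable_cst.
- by move=> x; rewrite le_min f0.
have mN : measurable [set x | (K < f x)%R].
  apply: measurable_bool_set.
  by apply: measurable_fun_ltr => //; exact: measurable_cst.
exists [set x | (K < f x)%R]; split => //; last first.
  move=> x/=; apply: contra_notP => /negP; rewrite -leNgt => fK.
  by rewrite /g; apply/esym/min_idPl.
have nuN : nu [set x | (K < f x)%R] = K%:E * mu [set x | (K < f x)%R].
  apply/eqP; rewrite eq_le numuK//= nuE// -integral_cst//.
  apply: ge0_le_integral => //.
  - by apply/measurable_EFinP; exact: measurable_funTS.
  - by move=> x /= /ltW; rewrite lee_fin.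
set N := [set x | (K < f x)%R] in mN nuN *.
have int0 : \int[mu]_(x in N) (f x - K)%:E = 0.
  rewrite integralB_EFin//=; last 2 first.
  - by apply: integrableS (is_density_integrable df).
  - exact: finite_measure_integrable_cst.
  rewrite -nuE// nuN integral_cst// subee// fin_numM//.
  by rewrite fin_num_measure.
have mfK : measurable_fun N (fun x => (f x - K)%:E).
  apply/measurable_EFinP/measurable_funTS.
  by apply: measurable_funB => //; exact: measurable_cst.
have [+ _] := @ae_eq_integral_abs _ _ _ mu N mN _ mfK.
move=> /(_ _)[]; first by rewrite -[RHS]int0; apply: eq_integral => x; rewrite inE /N/= => Kf;
  rewrite ger0_norm// subr_ge0 ltW.
move=> S [mS muS NS]; apply/eqP; rewrite -measure_le0 -muS le_measure ?inE//.
move=> x Nx; apply: NS => /= /(_ Nx) [] /eqP; rewrite subr_eq0 => /eqP fK.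
by move: Nx; rewrite /N/= fK ltxx.
Qed.

End is_density.


Lemma measurable_ent d (T : measurableType d) (R : realType) (f : T -> R) :
  measurable_fun setT f -> measurable_fun setT (fun x => ent (f x)).
Proof. by move=> mf; apply: measurable_funM => //; exact: measurableT_comp. Qed.

Lemma measurable_kl d (T : measurableType d) (R : realType) (f : T -> R) :
  measurable_fun setT f -> measurable_fun setT (fun x => kl (f x)).
Proof.
move=> mf; apply: measurable_funD; last exact: measurable_cst.
by apply: measurable_funB => //; exact: measurable_ent.
Qed.

Lemma le_integral_ge0 d (T : measurableType d) (R : realType)
    (mu : {measure set T -> \bar R}) (f g : T -> \bar R) :
  mu.-integrable setT f -> measurable_fun setT g -> (forall x, 0 <= g x)%E ->
  (forall x, f x <= g x)%E -> (\int[mu]_x f x <= \int[mu]_x g x)%E.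
Proof.
move=> fi mg g0 fg; have mf := measurable_int _ fi.
have [goo|] := eqVneq (\int[mu]_x g x)%E +oo%E; first by rewrite goo leey.
rewrite -ltey => goo; apply: le_integral => //.
by apply/integrableP; split => //; under eq_integral do rewrite gee0_abs//.
Qed.

Lemma ge0_integralD_EFin d (T : measurableType d) (R : realType)
    (mu : {measure set T -> \bar R}) (f g : T -> R) :
  measurable_fun setT f -> measurable_fun setT g ->
  (forall x, 0 <= f x) -> (forall x, 0 <= g x) ->
  (\int[mu]_x (f x + g x)%:E = \int[mu]_x (f x)%:E + \int[mu]_x (g x)%:E)%E.
Proof.
move=> mf mg f0 g0; under eq_integral do rewrite EFinD.
by rewrite ge0_integralD//; (try exact/measurable_EFinP) => x _; rewrite lee_fin.
Qed.

Section entropy_density.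
Context d (T : measurableType d) (R : realType).
Variables (nu : {finite_measure set T -> \bar R})
  (rho : {sigma_finite_measure set T -> \bar R}).
Local Open Scope ereal_scope.

Lemma entropy_lty_dominates : entropy nu rho < +oo -> nu `<< rho.
Proof. by rewrite /entropy; case: pselect => //; rewrite ltxx. Qed.

Lemma entropy_density f : is_density rho nu f -> rho setT < +oo ->
  entropy nu rho = \int[rho]_x (kl (f x))%:E.
Proof.
move=> df rhooo; have [mf f0 nuE] := df.
have nurho := is_density_dominates df.
rewrite /entropy; case: pselect => [/= _|//].
set RN := Radon_Nikodym _ _.
have mRN : measurable_fun setT RN.
  by apply: (@measurable_int _ _ _ rho); exact: Radon_Nikodym_integrable.
pose r x := fine (RN x).
have RNr x : RN x = (r x)%:E by rewrite /r fineK// Radon_Nikodym_fin_num.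
have mr : measurable_fun setT r.
  by apply/measurable_EFinP; rewrite (_ : _ \o _ = RN)//; apply/funext => x /=.
have fr : {ae rho, forall x, f x = r x}.
  have : ae_eq rho setT (EFin \o f) RN.
    apply: integral_ae_eq => //; first exact: is_density_integrable df.
    by move=> E _ mE; rewrite -nuE// -Radon_Nikodym_integral.
  by apply: filterS => x /(_ I); rewrite RNr => -[].
have nu0 : {ae nu, forall x, (0 < f x)%R}.
  have m0 : measurable [set x | (f x <= 0)%R].
    by apply: measurable_bool_set; apply: measurable_fun_ler => //; exact: measurable_cst.
  exists [set x | (f x <= 0)%R]; split => //; last by move=> x /= /negP; rewrite -leNgt.
  rewrite nuE//; apply: integral0_eq => x /= fx0; congr EFin.
  by apply/eqP; rewrite eq_le fx0 f0.
have frnu : {ae nu, forall x, f x = r x}.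
  have [N [mN N0 Nfr]] := fr; exists N; split => //.
  by move/null_content_dominatesP : nurho; exact.
have mln : measurable_fun setT (fun x => ln (f x)) by exact: measurableT_comp.
have -> : \int[nu]_x lne (RN x) = \int[nu]_x (ln (f x))%:E.
  apply: ae_eq_integral => //.
  - under eq_fun do rewrite RNr/=.
    apply: measurable_fun_ifT; first by apply: measurable_fun_ler => //; exact: measurable_cst.
      exact: measurable_cst.
    by apply/measurable_EFinP; exact: measurableT_comp.
  - exact/measurable_EFinP.
  - apply: filterS2 nu0 frnu => x fx0 fxr _.
    by rewrite RNr -fxr lne_EFin.
rewrite integralE.
have mpos : measurable_fun setT (fun x => ((fun x => ln (f x))^\+%R x)%:E).
  by apply/measurable_EFinP; exact: measurable_funrpos.
have mneg : measurable_fun setT (fun x => ((fun x => ln (f x))^\-%R x)%:E).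
  by apply/measurable_EFinP; exact: measurable_funrneg.
set g := (fun x => ln (f x)) in mpos mneg *.
have -> : \int[nu]_x ((fun x => (ln (f x))%:E)^\+ x) = \int[rho]_x (g^\+%R x * f x)%:E.
  transitivity (\int[nu]_x (g^\+%R x)%:E).
    by apply: eq_integral => x _; rewrite -[LHS]/((EFin \o g)^\+ x) funerpos.
  by rewrite (is_density_integral df)// => x; rewrite lee_fin.
have -> : \int[nu]_x ((fun x => (ln (f x))%:E)^\- x) = \int[rho]_x (g^\-%R x * f x)%:E.
  transitivity (\int[nu]_x (g^\-%R x)%:E).
    by apply: eq_integral => x _; rewrite -[LHS]/((EFin \o g)^\- x) funerneg.
  by rewrite (is_density_integral df)// => x; rewrite lee_fin.
have mkl := measurable_kl mf.
have mg : measurable_fun setT g by [].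
have mpf : measurable_fun setT (fun x => (g^\+%R x * f x)%:E).
  by apply/measurable_EFinP/measurable_funM => //; exact/measurable_EFinP.
have mnf : measurable_fun setT (fun x => (g^\-%R x * f x)%:E).
  by apply/measurable_EFinP/measurable_funM => //; exact/measurable_EFinP.
set P := \int[rho]_x (g^\+%R x * f x)%:E; set N := \int[rho]_x (g^\-%R x * f x)%:E.
have Nfin : N \is a fin_num.
  rewrite ge0_fin_numE; last by apply: integral_ge0 => x _; rewrite lee_fin mulr_ge0.
  apply: (le_lt_trans _ rhooo); rewrite -[leRHS]mul1e -integral_cst//.
  apply: ge0_le_integral => //.
  - by move=> x _; rewrite lee_fin mulr_ge0.
  - move=> x _; rewrite lee_fin /funrneg maxr_pMl// mul0r ge_max ler01 andbT.
    by have := ent_ge (f0 x); rewrite /ent /g; lra.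
have nufin : nu setT \is a fin_num by exact: fin_num_measure.
have rhofin : rho setT \is a fin_num by rewrite ge0_fin_numE.
have Efn : nu setT = \int[rho]_x (f x)%:E by exact: nuE.
have key : P + rho setT = \int[rho]_x (kl (f x))%:E + N + nu setT.
  have m1 : measurable_fun [set: T] (cst 1%R : T -> R) by exact: measurable_cst.
  have mp' : measurable_fun setT (fun x => g^\+%R x * f x)%R by exact/measurable_EFinP.
  have mn' : measurable_fun setT (fun x => g^\-%R x * f x)%R by exact/measurable_EFinP.
  rewrite Efn -[rho setT]mul1e -integral_cst//.
  rewrite -[X in _ + X]/(\int[rho]_x (cst 1%R x)%:E).
  rewrite -ge0_integralD_EFin//; last by move=> x; rewrite mulr_ge0.
  rewrite -ge0_integralD_EFin//; last 2 first.
  - by move=> x; rewrite kl_ge0.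
  - by move=> x; rewrite mulr_ge0.
  rewrite -ge0_integralD_EFin//; last 2 first.
  - exact: measurable_funD.
  - by move=> x; rewrite addr_ge0 ?kl_ge0 ?mulr_ge0.
  apply: eq_integral => x _; congr EFin.
  rewrite /kl -/(g x); have -> : g x = (g^\+%R x - g^\-%R x)%R.
    exact: (esym (congr1 (@^~ x) (funrposBneg g))).
  by rewrite /=; ring.
have K0 : 0 <= \int[rho]_x (kl (f x))%:E.
  by apply: integral_ge0 => x _; rewrite lee_fin kl_ge0.
transitivity (P + rho setT - nu setT - N).
  by rewrite -!addeA (addeC (rho setT)) (addeC (- nu setT) (- N)) -!addeA.
by rewrite key addeK// addeK.
Qed.

Lemma entropy_ge0 : rho setT < +oo -> 0 <= entropy nu rho.
Proof.
move=> rhooo; have [nurho|nurho] := pselect (nu `<< rho); last first.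
  by rewrite /entropy; case: pselect => //= _; rewrite leey.
have [f df] := is_density_exists nurho.
rewrite (entropy_density df)//; apply: integral_ge0 => x _.
by rewrite lee_fin kl_ge0//; case: df.
Qed.

End entropy_density.

Section entropy_variational.
Context d (T : measurableType d) (R : realType).
Variables (nu : {finite_measure set T -> \bar R})
  (rho : {sigma_finite_measure set T -> \bar R}).
Hypothesis rhooo : (rho setT < +oo)%E.

Lemma bounded_integrable (m : {measure set T -> \bar R}) (h : T -> R) (B : R) :
  (m setT < +oo)%E -> measurable_fun setT h -> (forall x, `|h x| <= B) ->
  m.-integrable setT (EFin \o h).
Proof.
move=> moo mh hB; apply: measurable_bounded_integrable => //.
exists B; split; first exact: num_real.
by move=> x Bx y _ /=; rewrite (le_trans (hB y))// ltW.
Qed.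

Lemma entropy_ge_variational (h : T -> R) (B : R) : measurable_fun setT h ->
  (forall x, `|h x| <= B) ->
  ((\int[nu]_x h x - \int[rho]_x (expR (h x) - 1))%:E <= entropy nu rho)%E.
Proof.
move=> mh hB; have [nurho|nurho] := pselect (nu `<< rho); last first.
  by rewrite /entropy; case: pselect => //= _; rewrite leey.
have [f df] := is_density_exists nurho; have [mf f0 nuE] := df.
have nuoo : (nu setT < +oo)%E by rewrite -ge0_fin_numE// fin_num_measure.
have ih := bounded_integrable nuoo mh hB.
have ie : rho.-integrable setT (EFin \o (fun x => expR (h x) - 1)).
  apply: (@bounded_integrable _ _ (expR B + 1)) => //.
    by apply: measurable_funB; [exact: measurableT_comp|exact: measurable_cst].
  move=> x; rewrite (le_trans (ler_normB _ _))// normr1 lerD2r ger0_norm ?expR_ge0//.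
  by rewrite ler_expR (le_trans (ler_norm _)).
have ihf : rho.-integrable setT (EFin \o (fun x => h x * f x)).
  by apply/(is_density_integrable_fun df).
rewrite (entropy_density df)// (is_density_Rintegral df)// -RintegralB//.
rewrite /Rintegral fineK; last first.
  by apply: integrable_fin_num => //; exact: (integrableB _ ihf ie).
have mi := measurable_int _ (integrableB measurableT ihf ie).
apply: (le_integral_ge0 (integrableB measurableT ihf ie)).
- exact/measurable_EFinP/measurable_kl.
- by move=> x; rewrite lee_fin kl_ge0.
- by move=> x; rewrite /= -EFinB lee_fin mulrC kl_young.
Qed.

Lemma entropy_le_variational (c : R) :
  (forall (h : T -> R) (B : R), measurable_fun setT h -> (forall x, `|h x| <= B) ->
    \int[nu]_x h x - \int[rho]_x (expR (h x) - 1) <= c) ->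
  (entropy nu rho <= c%:E)%E.
Proof.
move=> H; have nuoo : (nu setT < +oo)%E by rewrite -ge0_fin_numE// fin_num_measure.
have nurho : nu `<< rho.
  apply/null_content_dominatesP => A mA rhoA; apply/eqP.
  apply/negPn/negP => nuA; have nuAfin : nu A \is a fin_num by exact: fin_num_measure.
  have nuA0 : 0 < fine (nu A).
    by rewrite fine_gt0// lt0e nuA measure_ge0/= -ge0_fin_numE.
  pose th := (`|c| + 1) / fine (nu A).
  have th0 : 0 <= th by rewrite divr_ge0 ?addr_ge0 ?(ltW nuA0).
  have mI : measurable_fun setT (fun x => th * \1_A x : R).
    by apply: measurable_funM => //; exact: measurable_cst.
  have hB x : `|th * \1_A x| <= th.
    by rewrite indicE; case: (_ \in _); rewrite ?mulr1 ?mulr0 ?normr0// ger0_norm.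
  have := H _ th mI hB.
  have -> : \int[rho]_x (expR (th * \1_A x) - 1) = 0.
    rewrite /Rintegral (ae_eq_integral (cst 0%E))//; first by rewrite integral0.
      apply/measurable_EFinP/measurable_funB; last exact: measurable_cst.
      exact: measurableT_comp.
    exists A; split => // x /= Hx; apply: contrapT => xA; apply: Hx => _.
    by rewrite indicE memNset// mulr0 expR0 subrr.
  rewrite RintegralZl//; last exact: integrable_indic.
  rewrite /Rintegral integral_indic// setIT subr0 divfK ?gt_eqF//.
  by have := ler_norm c; lra.
have [f df] := is_density_exists nurho; have [mf f0 nuE] := df.
rewrite (entropy_density df)//.
pose cl (n : nat) x : R := Num.max n.+1%:R^-1 (Num.min (f x) n.+1%:R).
have cl_gt0 n x : 0 < cl n x by rewrite lt_max invr_gt0 ltr0n.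
have cl_le n x : cl n x <= n.+1%:R.
  have n1 : n.+1%:R^-1 <= 1 :> R by rewrite invf_le1 ?ltr0n// ler1n.
  by rewrite ge_max ge_min lexx orbT andbT (le_trans n1)// ler1n.
have mcl n : measurable_fun setT (cl n).
  by apply: measurable_maxr; [exact: measurable_cst|
    apply: measurable_minr => //; exact: measurable_cst].
have mln n : measurable_fun setT (fun x => ln (cl n x)) by exact: measurableT_comp.
have lnB n x : `|ln (cl n x)| <= ln n.+1%:R.
  rewrite ler_norml -lnV ?posrE// !ler_ln ?posrE ?invr_gt0 ?ltr0n//.
  by rewrite cl_le le_max lexx.
pose g n x := f x * ln (cl n x) - (cl n x - 1).
have g0 n x : 0 <= g n x.
  apply: clamp_ln_ge0 => //; rewrite /cl.
  have n1 : n.+1%:R^-1 <= 1 :> R by rewrite invf_le1 ?ltr0n// ler1n.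
  have n2 : 1 <= n.+1%:R :> R by rewrite ler1n.
  have [f1|f1] := leP 1 (f x).
    rewrite le_max le_min f1 n2 orbT/= ge_max ge_min lexx/= andbT.
    by rewrite (le_trans n1).
  apply/orP; right; rewrite le_max le_min lexx (le_trans (ltW f1) n2) orbT/=.
  by rewrite ge_max n1 ge_min (ltW f1).
have mg n : measurable_fun setT (g n).
  by apply: measurable_funB; [exact: measurable_funM|
    apply: measurable_funB => //; exact: measurable_cst].
have gc n : (\int[rho]_x (g n x)%:E <= c%:E)%E.
  have := H _ _ (mln n) (lnB n).
  have ih := bounded_integrable nuoo (mln n) (lnB n).
  have ie : rho.-integrable setT (EFin \o (fun x => expR (ln (cl n x)) - 1)).
    apply: (@bounded_integrable _ _ (n.+1%:R + 1)) => //.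
      by apply: measurable_funB; [exact: measurableT_comp|exact: measurable_cst].
    move=> x; rewrite lnK ?posrE// (le_trans (ler_normB _ _))// normr1 lerD2r.
    by rewrite gtr0_norm.
  have ihf : rho.-integrable setT (EFin \o (fun x => ln (cl n x) * f x)).
    by apply/(is_density_integrable_fun df).
  rewrite (is_density_Rintegral df)// -RintegralB//.
  rewrite -lee_fin /Rintegral fineK; last first.
    by apply: integrable_fin_num => //; exact: (integrableB _ ihf ie).
  apply: le_trans; rewrite le_eqVlt; apply/orP; left; apply/eqP.
  by apply: eq_integral => x _; rewrite /g lnK ?posrE// mulrC.
apply: (@le_trans _ _ (limn_einf (fun n => \int[rho]_x (g n x)%:E))%E); last first.
  rewrite limn_einf_lim; apply: lime_le.
    exact: is_cvg_einfs.
  apply: nearW => n; apply: (le_trans _ (gc n)); apply: ereal_inf_lbound.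
  by exists n => /=.
have mge n : measurable_fun setT (fun x => (g n x)%:E) by exact/measurable_EFinP.
apply: le_trans (fatou rho measurableT mge _); last first.
  by move=> n x _; rewrite lee_fin.
rewrite le_eqVlt; apply/orP; left; apply/eqP; apply: eq_integral => x _.
suff /cvg_limn_einf_sup[-> _] : (g n x)%:E @[n --> \oo] --> (kl (f x))%:E by [].
apply/fine_cvgP; split; first exact: nearW.
rewrite (_ : fine \o _ = fun n => g n x)//.
have [fx0|fx0] := eqVneq (f x) 0.
  rewrite /g /cl fx0 /kl; under eq_fun do rewrite mul0r sub0r opprB.
  rewrite mul0r subr0 add0r (_ : (fun _ => _) = fun n => 1 - @harmonic R n).
    suff : (fun n => 1 - @harmonic R n) @ \oo --> (1 - 0 : R) by rewrite subr0.
    by apply: cvgB; [exact: cvg_cst|exact: cvg_harmonic].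
  by apply/funext => n; rewrite min_l ?ler0n// max_l// invr_ge0.
have {fx0} fx0 : 0 < f x by rewrite lt0r fx0 f0.
apply: cvg_near_cst; near=> n; rewrite /g /cl /kl.
have n1 : f x <= n.+1%:R.
  by rewrite (@le_trans _ _ n%:R)// ?ler_nat//; near: n; exact: nbhs_infty_ger.
have n2 : n.+1%:R^-1 <= f x.
  rewrite -[leRHS]invrK lef_pV2 ?posrE ?invr_gt0 ?ltr0n//.
  by rewrite (@le_trans _ _ n%:R)// ?ler_nat//; near: n; exact: nbhs_infty_ger.
by rewrite (min_l n1) (max_r n2); ring.
Unshelve. all: by end_near. Qed.

End entropy_variational.


Section cons_power.
Context d (T : measurableType d) (R : realType).
Implicit Types (m : {sigma_finite_measure set T -> \bar R}).
Local Open Scope ereal_scope.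

Definition tcons n (x : T) (t : n.-tuple T) : n.+1.-tuple T := [tuple of x :: t].

Lemma measurable_tcons n : measurable_fun [set: T * n.-tuple T] (fun p => tcons p.1 p.2).
Proof. exact: measurable_cons. Qed.

Lemma measurable_tcons_r n x : measurable_fun [set: n.-tuple T] (tcons x).
Proof. by apply: measurable_cons. Qed.

Lemma integral_cons_measure n m (P : {sigma_finite_measure set (n.-tuple T) -> \bar R})
    (h : n.+1.-tuple T -> \bar R) : measurable_fun setT h -> (forall t, 0 <= h t) ->
  \int[cons_measure m P]_t h t = \int[m]_x \int[P]_t h (tcons x t).
Proof.
move=> mh h0; have mt := @measurable_tcons n.
rewrite (eq_measure_integral (pushforward (m \x P) (fun p => tcons p.1 p.2)))//.
rewrite ge0_integral_pushforward// preimage_setT fubini_tonelli1//.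
  exact: measurableT_comp.
by move=> x; exact: h0.
Qed.

Lemma measurable_integral_cons n (P : {sigma_finite_measure set (n.-tuple T) -> \bar R})
    (h : n.+1.-tuple T -> \bar R) : measurable_fun setT h -> (forall t, 0 <= h t) ->
  measurable_fun setT (fun x => \int[P]_t h (tcons x t)).
Proof.
move=> mh h0.
apply: (@measurable_fun_fubini_tonelli_F _ _ T (n.-tuple T) R P
  (fun p => h (tcons p.1 p.2))) => //.
by apply: measurableT_comp => //; exact: measurable_tcons.
Qed.

Lemma cons_measureX n m (P : {sigma_finite_measure set (n.-tuple T) -> \bar R}) A B C :
  measurable A -> measurable B -> (forall x t, C (tcons x t) <-> A x /\ B t) ->
  cons_measure m P C = m A * P B.
Proof.
move=> mA mB CAB; rewrite /cons_measure /pushforward -product_measure1E//.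
by congr (_ _); apply/seteqP; split=> -[x t] /=; apply CAB.
Qed.

Lemma cons_measureT n m (P : {sigma_finite_measure set (n.-tuple T) -> \bar R}) :
  cons_measure m P setT = m setT * P setT.
Proof. exact: cons_measureX. Qed.

Lemma power_measureT m n : power_measure m n setT = m setT ^+ n.
Proof.
elim: n => [|n IHn]; first by rewrite /= diracT.
by rewrite [LHS](cons_measureT m (power_measure m n)) IHn expeS.
Qed.

Lemma tnth_tcons_lift n (x : T) (t : n.-tuple T) (i : 'I_n) :
  tnth (tcons x t) (lift ord0 i) = tnth t i.
Proof. exact: tnthS. Qed.

Lemma power_measure_cylinder m n (l : 'I_n) (A : set T) : measurable A ->
  power_measure m n ((fun t => tnth t l) @^-1` A) = m A * m setT ^+ n.-1.
Proof.
elim: n l => [[]//|n IHn] l mA.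
case: (unliftP ord0 l) => [i ->|->].
  rewrite [LHS](@cons_measureX _ m (power_measure m n) setT ((fun t => tnth t i) @^-1` A))//.
  - rewrite IHn// muleCA; case: n i {IHn l} => [[]//|n i]; rewrite -expeS//.
  - by rewrite -[X in measurable X]setTI; exact: measurable_tnth.
  - by move=> x t /=; rewrite tnth_tcons_lift; tauto.
rewrite [LHS](@cons_measureX _ m (power_measure m n) A setT)//; first by rewrite power_measureT.
by move=> x t /=; rewrite tnth0; tauto.
Qed.

End cons_power.

Section finite_power.
Context d (T : measurableType d) (R : realType).
Implicit Types (mu M : {finite_measure set T -> \bar R}).
Local Open Scope ereal_scope.

Lemma finite_measure_fineK mu A : measurable A -> (fine (mu A))%:E = mu A.
Proof. by move=> mA; rewrite fineK// fin_num_measure. Qed.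

Lemma power_measureTE mu n : power_measure mu n setT = (fine (mu setT) ^+ n)%:E.
Proof. by rewrite power_measureT EFin_expe fineK// fin_num_measure. Qed.

Lemma power_measureT_lty mu n : power_measure mu n setT < +oo.
Proof. by rewrite power_measureTE ltry. Qed.

Lemma measurable_prod_tnth n (P : pred 'I_n) (m : T -> R) : measurable_fun setT m ->
  measurable_fun setT (fun t : n.-tuple T => \prod_(i < n | P i) m (tnth t i))%R.
Proof.
move=> mm; under eq_fun do rewrite big_mkcond/=.
apply: (measurable_prod (h := fun i t => if P i then m (tnth t i) else 1%R)) => i _.
case: (P i); last exact: measurable_cst.
by apply: measurableT_comp => //; exact: measurable_tnth.
Qed.

Lemma integral_power_density mu M (m : T -> R) n (h : n.-tuple T -> \bar R) :
  is_density mu M m -> measurable_fun setT h -> (forall t, 0 <= h t) ->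
  \int[power_measure M n]_t h t =
  \int[power_measure mu n]_t (h t * (\prod_(i < n) m (tnth t i))%:E).
Proof.
move=> dm; have [mm m0 _] := dm.
elim: n h => [|n IHn] h mh h0.
  by apply: eq_integral => t _; rewrite big_ord0 mule1.
have mp := @measurable_prod_tnth n.+1 predT m mm.
have p0 k (t : k.-tuple T) : (0 <= \prod_(i < k) m (tnth t i))%R by exact: prodr_ge0.
rewrite [power_measure M _]/= [power_measure mu _]/=.
rewrite !integral_cons_measure//; last 2 first.
- by apply: emeasurable_funM => //; exact/measurable_EFinP.
- by move=> t; rewrite mule_ge0 ?lee_fin.
have mhx x : measurable_fun setT (fun t => h (tcons x t)).
  by apply: measurableT_comp => //; exact: measurable_tcons_r.
under eq_integral => x _ do rewrite IHn//.
rewrite (is_density_integral dm)//; last 2 first.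
- pose g (t : n.+1.-tuple T) := h t * (\prod_(i < n) m (tnth t (lift ord0 i)))%:E.
  rewrite (_ : (fun _ => _) = fun x => \int[power_measure mu n]_t g (tcons x t)).
    apply: measurable_integral_cons.
      apply: emeasurable_funM => //; apply/measurable_EFinP.
      apply: (measurable_prod (h := fun i (t : n.+1.-tuple T) => m (tnth t (lift ord0 i)))) => i _.
      by apply: measurableT_comp => //; exact: measurable_tnth.
    by move=> t; rewrite mule_ge0// lee_fin prodr_ge0.
  apply/funext => x; apply: eq_integral => t _; rewrite /g.
  by under [in RHS]eq_bigr do rewrite tnth_tcons_lift.
- by move=> x; apply: integral_ge0 => t _; rewrite mule_ge0 ?lee_fin.
apply: eq_integral => x _; rewrite -ge0_integralZr ?lee_fin//; last 2 first.
- by apply: emeasurable_funM => //; apply/measurable_EFinP; exact: measurable_prod_tnth.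
- by move=> t _; rewrite mule_ge0 ?lee_fin.
apply: eq_integral => t _; rewrite big_ord_recl tnth0 -muleA; congr (_ * _).
rewrite -EFinM mulrC; congr (_ * _)%:E.
by apply: eq_bigr => i _; rewrite tnth_tcons_lift.
Qed.

Lemma prod_lift n (F : 'I_n.+1 -> R) :
  (\prod_(l < n.+1 | (0 < l)%N) F l = \prod_(i < n) F (lift ord0 i))%R.
Proof. by rewrite big_mkcond big_ord_recl/= mul1r. Qed.

Lemma integral_reference_density mu M (m : T -> R) n (h : n.+1.-tuple T -> \bar R) :
  is_density mu M m -> measurable_fun setT h -> (forall t, 0 <= h t) ->
  \int[cons_measure mu (power_measure M n)]_t h t =
  \int[power_measure mu n.+1]_t
    (h t * (\prod_(l < n.+1 | (0 < l)%N) m (tnth t l))%:E).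
Proof.
move=> dm mh h0; have [mm m0 _] := dm.
have mp := @measurable_prod_tnth n.+1 (fun l => 0 < l)%N m mm.
rewrite (integral_cons_measure mu (power_measure M n))//.
rewrite [RHS](integral_cons_measure mu (power_measure mu n)); last 2 first.
- by apply: emeasurable_funM => //; exact/measurable_EFinP.
- by move=> t; rewrite mule_ge0 ?lee_fin ?prodr_ge0.
apply: eq_integral => x _; rewrite (integral_power_density dm)//.
  by apply: eq_integral => t _; rewrite prod_lift;
    under [in RHS]eq_bigr do rewrite tnth_tcons_lift.
by apply: measurableT_comp => //; exact: measurable_tcons_r.
Qed.

Lemma is_density_reference mu M (m : T -> R) n : is_density mu M m ->
  is_density (power_measure mu n.+1) (cons_measure mu (power_measure M n))
    (fun t => \prod_(l < n.+1 | (0 < l)%N) m (tnth t l))%R.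
Proof.
move=> dm; have [mm m0 _] := dm.
have mp := @measurable_prod_tnth n.+1 (fun l => 0 < l)%N m mm.
split => // [t|A mA]; first by rewrite prodr_ge0.
have -> : cons_measure mu (power_measure M n) A =
    \int[cons_measure mu (power_measure M n)]_t (\1_A t)%:E.
  by rewrite integral_indic// setIT.
rewrite (integral_reference_density dm)//; last exact/measurable_EFinP.
rewrite [RHS]integral_mkcond; apply: eq_integral => t _.
by rewrite patchE indicE; case: (t \in A); rewrite ?mul1e ?mul0e.
Qed.

Lemma power_measure_finite mu n : fin_num_fun (power_measure mu n).
Proof. by apply: lty_fin_num_fun; exact: power_measureT_lty. Qed.

End finite_power.

Section push_finite.
Context d1 d2 (X : measurableType d1) (Y : measurableType d2) (R : realType).
Variables (lam : {measure set X -> \bar R}) (D : set X) (phi : X -> Y).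
Local Open Scope ereal_scope.

(* the image under phi of the restriction of lam to D *)
Definition push_restr of measurable D & measurable_fun setT phi & lam setT < +oo :=
  fun A : set Y => lam (phi @^-1` A `&` D).

Variables (mD : measurable D) (mphi : measurable_fun setT phi) (lamoo : lam setT < +oo).
Local Notation nu := (push_restr mD mphi lamoo).

Let nu0 : nu set0 = 0.
Proof. by rewrite /push_restr preimage_set0 set0I measure0. Qed.

Let nu_ge0 A : 0 <= nu A. Proof. exact: measure_ge0. Qed.

Let nu_additive : semi_sigma_additive nu.
Proof.
move=> F mF tF mUF; rewrite /push_restr preimage_bigcup setI_bigcupl.
have mphiF n : measurable (phi @^-1` F n).
  by rewrite -[X in measurable X]setTI; exact: mphi.
apply: measure_semi_sigma_additive.
- by move=> n; exact: measurableI.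
- apply: trivIset_setIr; apply/trivIsetP => /= i j _ _ ij; rewrite -preimage_setI.
  by move/trivIsetP : tF => /(_ _ _ _ _ ij) ->//; rewrite preimage_set0.
- by apply: bigcup_measurable => n _; exact: measurableI.
Qed.

HB.instance Definition _ := isMeasure.Build _ _ _ nu nu0 nu_ge0 nu_additive.

Let nu_fin : fin_num_fun nu.
Proof.
apply: lty_fin_num_fun; apply: le_lt_trans lamoo; apply: le_measure; rewrite ?inE//.
by rewrite preimage_setT setTI.
Qed.

HB.instance Definition _ := Measure_isFinite.Build _ _ _ nu nu_fin.

Definition push_finite_measure : {finite_measure set Y -> \bar R} := nu.

End push_finite.


Section marginal_density.
Context d (T : measurableType d) (R : realType) (mu : {finite_measure set T -> \bar R}).

Local Notation lam n := (power_measure mu n).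

Lemma measurable_preimage_tnth n (l : 'I_n) (A : set T) : measurable A ->
  measurable ((fun t : n.-tuple T => tnth t l) @^-1` A).
Proof. by move=> mA; rewrite -[X in measurable X]setTI; exact: measurable_tnth. Qed.

Lemma marginal_density n (l : 'I_n) (D : set (n.-tuple T)) (G : set T) :
  measurable D -> measurable G -> (forall t, D t -> G (tnth t l)) ->
  exists p : T -> R, [/\ measurable_fun setT p,
    forall x, 0 <= p x <= fine (mu setT) ^+ n.-1,
    forall x, ~ G x -> p x = 0,
    forall A, measurable A ->
      lam n ((fun t => tnth t l) @^-1` A `&` D) = (\int[mu]_(x in A) (p x)%:E)%E &
    forall (h : T -> R) (B : R), measurable_fun setT h ->
      (forall x, G x -> `|h x| <= B) ->
      [/\ (lam n).-integrable setT (EFin \o (fun t => \1_D t * h (tnth t l))),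
          mu.-integrable setT (EFin \o (fun x => p x * h x)) &
          \int[lam n]_t (\1_D t * h (tnth t l)) = \int[mu]_x (p x * h x)]].
Proof.
move=> mD mG DG; have mt := @measurable_tnth _ T n l.
pose nu := push_finite_measure mD mt (power_measureT_lty mu n).
have mT0 : 0 <= fine (mu setT) ^+ n.-1 by rewrite exprn_ge0// fine_ge0.
have [p0 [dp0 p0K]] : exists p, is_density mu nu p /\
    forall x, p x <= fine (mu setT) ^+ n.-1.
  apply: is_density_bounded => // A mA.
  apply: (@le_trans _ _ (lam n ((fun t => tnth t l) @^-1` A))).
    rewrite -[leLHS]/(lam n (_ `&` D)).
    apply: le_measure; rewrite ?inE; last exact: subIsetl.
      by apply: measurableI => //; exact: measurable_preimage_tnth.
    exact: measurable_preimage_tnth.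
  by rewrite power_measure_cylinder// EFin_expe fineK ?fin_num_measure// muleC.
have [mp0 p00 p0E] := dp0.
pose p x := p0 x * \1_G x.
have mp : measurable_fun setT p by exact: measurable_funM.
have p_ge0 x : 0 <= p x by rewrite mulr_ge0.
have dp : is_density mu nu p.
  apply: (is_density_ae dp0) => //.
  have nuG : nu (~` G) = 0%E.
    rewrite /nu /= /push_restr (_ : _ `&` _ = set0) ?measure0//.
    by rewrite -subset0 => t [/= Gt Dt]; apply: Gt; exact: DG.
  have : ae_eq mu (~` G) (EFin \o p0) (cst 0%E).
    apply/ae_eq_integral_abs; [exact: measurableC| |].
      by apply/measurable_EFinP; exact: measurable_funTS.
    rewrite -[RHS]nuG p0E; last exact: measurableC.
    by apply: eq_integral => x _; rewrite gee0_abs// lee_fin.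
  apply: filterS => x /= H; rewrite /p indicE.
  have [xG|/negP xG] := boolP (x \in G); first by rewrite mulr1.
  by rewrite mulr0; apply: EFin_inj; apply: H => Gx; apply: xG; rewrite inE.
exists p; split => //.
- move=> x; rewrite p_ge0/= (le_trans _ (p0K x))// /p indicE.
  by case: (_ \in _); rewrite ?mulr1// mulr0.
- by move=> x Gx; rewrite /p indicE memNset// mulr0.
- by case: dp.
move=> h B mh hB.
pose h' x := h x * \1_G x.
have mh' : measurable_fun setT h' by exact: measurable_funM.
have h'B x : `|h' x| <= `|B|.
  rewrite /h' indicE; have [xG|xG] := boolP (x \in G); last by rewrite mulr0 normr0.
  by rewrite mulr1 (le_trans (hB x _) (ler_norm _))//; rewrite inE in xG.
have Eh' t : \1_D t * h (tnth t l) = \1_D t * h' (tnth t l).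
  rewrite /h' !indicE; have [tD|tD] := boolP (t \in D); last by rewrite !mul0r.
  by rewrite mem_set ?mulr1//; apply: DG; rewrite inE in tD.
have Ep x : p x * h x = h' x * p x.
  by rewrite /p /h' indicE; case: (_ \in _) => /=; ring.
have nuoo : (nu setT < +oo)%E by rewrite -ge0_fin_numE// fin_num_measure.
have lamoo : (lam n setT < +oo)%E by exact: power_measureT_lty.
have inu := bounded_integrable nuoo mh' h'B.
have mht : measurable_fun setT (fun t : n.-tuple T => \1_D t * h' (tnth t l)).
  by apply: measurable_funM => //; exact: measurableT_comp.
have ilam : (lam n).-integrable setT (EFin \o (fun t => \1_D t * h' (tnth t l))).
  apply: (bounded_integrable lamoo mht) => t.
  by rewrite indicE; case: (_ \in _); rewrite ?mul1r// mul0r normr0.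
have -> : (fun t => \1_D t * h (tnth t l)) = (fun t => \1_D t * h' (tnth t l)).
  by apply/funext => t; rewrite Eh'.
have -> : (fun x => p x * h x) = (fun x => h' x * p x) by apply/funext.
split => //; first by apply/(is_density_integrable_fun dp).
rewrite -(is_density_Rintegral dp)//.
have iD : (lam n).-integrable setT (EFin \o (\1_D : n.-tuple T -> R)).
  apply: (bounded_integrable lamoo (B := 1)) => // t.
  by rewrite indicE; case: (_ \in _); rewrite ?normr1 ?normr0.
have D0 (t : n.-tuple T) : 0 <= \1_D t :> R by [].
have mI : measurable_fun setT (\1_D : n.-tuple T -> R) by [].
pose lamD := density_finite_measure mI D0 iD.
have dD : is_density (lam n) lamD (\1_D) by exact: density_measureP.
have lamDoo : (lamD setT < +oo)%E by rewrite -ge0_fin_numE// fin_num_measure.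
have ih't : lamD.-integrable setT (EFin \o (fun t => h' (tnth t l))).
  by apply: (bounded_integrable lamDoo) => //; exact: measurableT_comp.
transitivity (\int[lamD]_t h' (tnth t l)).
  rewrite (is_density_Rintegral dD)//; last exact: measurableT_comp.
  by apply: eq_Rintegral => t _; rewrite mulrC.
rewrite /Rintegral; congr fine; apply/esym.
rewrite (eq_measure_integral (pushforward lamD (fun t => tnth t l))).
  by rewrite integral_pushforward//; exact/measurable_EFinP.
move=> A mA _; rewrite /pushforward; case: dD => _ _ H.
rewrite [RHS]H; last exact: measurable_preimage_tnth.
by rewrite /nu /= /push_restr setIC integral_indic//; exact: measurable_preimage_tnth.
Qed.

End marginal_density.


Section mk_finite_measure.
Context d (T : measurableType d) (R : realType) (nu : set T -> \bar R).
Local Open Scope ereal_scope.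

Definition copy_measure of nu set0 = 0 & (forall A, 0 <= nu A)
  & semi_sigma_additive nu & fin_num_fun nu := nu.

Variables (nu0 : nu set0 = 0) (nu_ge0 : forall A, 0 <= nu A)
  (nu_additive : semi_sigma_additive nu) (nu_fin : fin_num_fun nu).

Local Notation m := (copy_measure nu0 nu_ge0 nu_additive nu_fin).

HB.instance Definition _ := isMeasure.Build _ _ _ m nu0 nu_ge0 nu_additive.
HB.instance Definition _ := Measure_isFinite.Build _ _ _ m nu_fin.

Lemma mk_finite_measure : exists m' : {finite_measure set T -> \bar R},
  forall A, m' A = nu A.
Proof. by exists m. Qed.

End mk_finite_measure.

Section ultrafilter_limits.
Variables (R : realType) (U : set_system nat).
Context {UU : UltraFilter U}.

Lemma ultra_cvg (a : nat -> R) (K : R) : (forall n, `|a n| <= K) ->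
  exists l : R, a n @[n --> U] --> l.
Proof.
move=> aK.
have aU : (a @ U) `[- K, K]%classic.
  suff : U (fun n => `[- K, K]%classic (a n)) by [].
  by apply: filterE => n; rewrite /= in_itv/= -ler_norml.
have [l [_ cl]] := @segment_compact R (- K) K (a @ U) _ aU.
exists l => N Nl.
have [//|UN] := in_ultra_setVsetC (a @^-1` N) UU.
by have [y []] : (~` N `&` N) !=set0 by exact: cl.
Qed.

Lemma ultra_cvg_unique (a : nat -> R) (l l' : R) :
  a n @[n --> U] --> l -> a n @[n --> U] --> l' -> l = l'.
Proof. by move=> al al'; apply: (cvg_unique _ al al'). Qed.

Lemma ultra_cvg_le (a b : nat -> R) (l l' : R) : (forall n, a n <= b n) ->
  a n @[n --> U] --> l -> b n @[n --> U] --> l' -> l <= l'.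
Proof.
move=> ab al bl'; apply: (ler_cvg_to al bl'); exact: filterE.
Qed.

Lemma ultra_cvg_sum (I : Type) (r : seq I) (P : pred I) (a : I -> nat -> R) (l : I -> R) :
  (forall i, P i -> a i n @[n --> U] --> l i) ->
  \sum_(i <- r | P i) a i n @[n --> U] --> \sum_(i <- r | P i) l i.
Proof.
move=> al; apply: (cvg_big (op := +%R)) => //.
exact: add_continuous.
Qed.

End ultrafilter_limits.

Section uniform_absolute_continuity.
Context d (T : measurableType d) (R : realType).
Local Open Scope ereal_scope.

Definition unif_ac (I : Type) (lam : set T -> \bar R) (nu : I -> set T -> \bar R) :=
  forall e : R, (0 < e)%R -> exists2 dl : R, (0 < dl)%R &
    forall i D, measurable D -> lam D < dl%:E -> nu i D <= e%:E.

Definition setwise_cvg (U : set_system nat) (nu : nat -> set T -> \bar R)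
    (l : set T -> \bar R) :=
  forall D, measurable D -> (fine (nu n D) @[n --> U] --> fine (l D))%R.

End uniform_absolute_continuity.

Section setwise_limit.
Context d (T : measurableType d) (R : realType).
Variables (U : set_system nat) (UU : UltraFilter U).
Variables (lam : {measure set T -> \bar R}) (nu : nat -> {finite_measure set T -> \bar R}).
Hypothesis lamoo : (lam setT < +oo)%E.
Variable K : R.
Hypothesis nuK : forall n, (nu n setT <= K%:E)%E.
Hypothesis ac : unif_ac lam nu.

Let fin n D : measurable D -> nu n D \is a fin_num.
Proof. by move=> mD; exact: fin_num_measure. Qed.

Let lamfin D : measurable D -> lam D \is a fin_num.
Proof. by move: D; exact: lty_fin_num_fun. Qed.

Let le_nu n A B : measurable A -> measurable B -> A `<=` B -> fine (nu n A) <= fine (nu n B).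
Proof. by move=> mA mB AB; rewrite fine_le ?fin// le_measure ?inE. Qed.

Lemma setwise_limit_exists :
  exists l : {finite_measure set T -> \bar R}, setwise_cvg U nu l.
Proof.
have lP D : exists l : R, measurable D -> fine (nu n D) @[n --> U] --> l.
  have [mD|nD] := pselect (measurable D); last by exists 0.
  have [|l Hl] := @ultra_cvg R U UU (fun n => fine (nu n D)) K; last by exists l.
  move=> n; rewrite ger0_norm ?fine_ge0// -lee_fin fineK ?fin//.
  by apply: le_trans (nuK n); rewrite le_measure ?inE.
have [N HN] := choice lP.
pose L D := if pselect (measurable D) then (N D)%:E else 0%E.
have N0 D : measurable D -> 0 <= N D.
  move=> mD; apply: (ultra_cvg_le _ (cvg_cst 0) (HN D mD)) => n.
  by rewrite fine_ge0.
have LE D : measurable D -> L D = (N D)%:E.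
  by move=> mD; rewrite /L; case: pselect.
have NU A B : measurable A -> measurable B -> A `&` B = set0 -> N (A `|` B) = N A + N B.
  move=> mA mB AB; apply: (ultra_cvg_unique (HN _ (measurableU _ _ mA mB))).
  rewrite (_ : (fun n => fine _) = fun n => fine (nu n A) + fine (nu n B)).
    by apply: cvgD; exact: HN.
  by apply/funext => n; rewrite measureU// fineD ?fin.
have Nac (e : R) : 0 < e -> exists2 dl : R, 0 < dl &
    forall D, measurable D -> (lam D < dl%:E)%E -> N D <= e.
  move=> e0; have [dl dl0 H] := ac e0; exists dl => // D mD lD.
  apply: (ultra_cvg_le _ (HN D mD) (cvg_cst e)) => n.
  by rewrite -lee_fin fineK ?fin// H.
have Nset0 : N set0 = 0.
  apply: (ultra_cvg_unique (HN _ measurable0)).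
  by under eq_fun do rewrite measure0; exact: cvg_cst.
have L0 : L set0 = 0%E by rewrite LE// Nset0.
have L_ge0 A : (0 <= L A)%E.
  by rewrite /L; case: pselect => // mA; rewrite lee_fin N0.
have L_fin : fin_num_fun L by move=> A mA; rewrite LE.
have L_add : semi_sigma_additive L.
  move=> F mF tF mUF.
  have mFn n : measurable (\big[setU/set0]_(i < n) F i) by exact: bigsetU_measurable.
  have sumN n : (\sum_(0 <= i < n) L (F i) = (N (\big[setU/set0]_(i < n) F i))%:E)%E.
    rewrite big_mkord; elim: n => [|n IHn]; first by rewrite !big_ord0 Nset0.
    rewrite !big_ord_recr/= IHn LE// -EFinD NU//; last first.
    rewrite -subset0 => x []; rewrite -bigcup_mkord => -[i /= lin Fix] Fnx.
    by have := tF i n I I (ex_intro _ x (conj Fix Fnx)) => iN; rewrite iN ltnn in lin.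
    exact: mFn.
  rewrite LE//; under eq_fun do rewrite sumN.
  apply: cvg_EFin; first exact: nearW.
  rewrite (_ : fine \o _ = fun n => N (\big[setU/set0]_(i < n) F i))//.
  pose G n := \bigcup_i F i `\` \big[setU/set0]_(i < n) F i.
  have mG n : measurable (G n) by exact: measurableD.
  have splitN n : N (\bigcup_i F i) = N (\big[setU/set0]_(i < n) F i) + N (G n).
    rewrite -NU; [|exact: mFn|exact: mG|by apply/seteqP; split => // x [? []]].
    congr (N _); apply/seteqP; split => x.
      by move=> Fx; have [?|?] := pselect ((\big[setU/set0]_(i < n) F i) x); [left|right].
    by case; [exact: bigsetU_bigcup|case].
  have lamG : lam \o G @ \oo --> 0%E.
    have G0 : \bigcap_n G n = set0.
      rewrite -subset0 => x Gx; have [[i _ Fix] _] := Gx 0%N I.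
      have [_] := Gx i.+1 I; apply; rewrite big_ord_recr/=; by right.
    rewrite -(measure0 lam) -G0; apply: nonincreasing_cvg_mu => //.
    - by apply: le_lt_trans lamoo; rewrite le_measure ?inE.
    - by rewrite G0.
    - by move=> m n mn; apply/subsetPset; apply: setDS; exact: subset_bigsetU.
  apply/cvgrPdist_le => e e0; have [dl dl0 H] := Nac e e0.
  have : \forall n \near \oo, (lam (G n) < dl%:E)%E.
    have /fine_cvgP[_ /cvgrPdist_lt/(_ dl dl0)] := lamG.
    apply: filterS => n /=; rewrite sub0r normrN ger0_norm ?fine_ge0//.
    by rewrite -lte_fin fineK// lamfin.
  apply: filterS => n /(H _ (mG n)); rewrite (splitN n) addrAC subrr add0r.
  by rewrite ger0_norm// N0.
have [l lE] := mk_finite_measure L0 L_ge0 L_add L_fin.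
by exists l => D mD; rewrite lE LE//; exact: HN.
Qed.

End setwise_limit.


Section setwise_convergence.
Context d (T : measurableType d) (R : realType).
Variables (U : set_system nat) (UU : UltraFilter U).
Variables (nu : nat -> {measure set T -> \bar R}) (l : {measure set T -> \bar R}).
Variable K : R.
Hypothesis nuK : forall n, (nu n setT <= K%:E)%E.
Hypothesis lK : (l setT <= K%:E)%E.

Let nuoo n : (nu n setT < +oo)%E. Proof. exact: le_lt_trans (nuK n) (ltry _). Qed.
Let loo : (l setT < +oo)%E. Proof. exact: le_lt_trans lK (ltry _). Qed.

Let K0 : 0 <= K. Proof. by rewrite -lee_fin (le_trans _ lK). Qed.

Let nufin n D : measurable D -> nu n D \is a fin_num.
Proof. by move: D; exact: lty_fin_num_fun. Qed.

Let lfin D : measurable D -> l D \is a fin_num.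
Proof. by move: D; exact: lty_fin_num_fun. Qed.

Lemma setwise_cvg_pi_system (lam : {measure set T -> \bar R}) (G : set (set T)) :
  (lam setT < +oo)%E -> unif_ac lam nu -> @measurable _ T = <<s G >> ->
  setI_closed G -> G setT ->
  (forall D, G D -> fine (nu n D) @[n --> U] --> fine (l D)) ->
  setwise_cvg U nu l.
Proof.
move=> lamoo ac GE GI GT Gcvg.
pose P : set_system T := fun D => fine (nu n D) @[n --> U] --> fine (l D).
suff : forall S, <<s G >> S -> P S by move=> H D; rewrite GE; exact: H.
have lamfin D : measurable D -> lam D \is a fin_num.
  by move: D; exact: lty_fin_num_fun.
apply: dynkin_induction => //; first exact: Gcvg.
- move=> S mS PS; rewrite /P.
  have C (m : {measure set T -> \bar R}) : (m setT < +oo)%E ->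
      fine (m (~` S)) = fine (m setT) - fine (m S).
    move=> moo; rewrite -setTD measureD// setTI fineB//.
      exact: lty_fin_num_fun moo _ _.
    exact: lty_fin_num_fun moo _ _.
  rewrite C//; under eq_fun do rewrite C//.
  by apply: cvgB => //; exact: Gcvg.
- move=> F mF tF PF; rewrite /P.
  pose S n := \big[setU/set0]_(i < n) F i.
  pose H n := \bigcup_i F i `\` S n.
  have mU : measurable (\bigcup_i F i) by exact: bigcup_measurable.
  have mS n : measurable (S n) by exact: bigsetU_measurable.
  have mH n : measurable (H n) by exact: measurableD.
  have SH n : S n `&` H n = set0 by apply/seteqP; split => // x [? []].
  have SUH n : \bigcup_i F i = S n `|` H n.
    apply/seteqP; split => x.
      by move=> Fx; have [?|?] := pselect ((\big[setU/set0]_(i < n) F i) x); [left|right].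
    by case; [exact: bigsetU_bigcup|case].
  have H0 (m : {measure set T -> \bar R}) (dl : R) : (m setT < +oo)%E -> 0 < dl ->
      \forall n \near \oo, (m (H n) < dl%:E)%E.
    move=> moo dl0.
    have : m \o H @ \oo --> 0%E.
      have GH : \bigcap_n H n = set0.
        rewrite -subset0 => x Gx; have [[i _ Fix] _] := Gx 0%N I.
        have [_] := Gx i.+1 I; apply; rewrite /S big_ord_recr/=; by right.
      rewrite -(measure0 m) -GH; apply: nonincreasing_cvg_mu => //.
      - by apply: le_lt_trans moo; rewrite le_measure ?inE.
      - by rewrite GH.
      - by move=> a b ab; apply/subsetPset; apply: setDS; exact: subset_bigsetU.
    move=> /fine_cvgP[_ /cvgrPdist_lt/(_ dl dl0)].
    apply: filterS => n /=; rewrite sub0r normrN ger0_norm ?fine_ge0//.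
    by rewrite -lte_fin fineK//; exact: lty_fin_num_fun moo _ _.
  have sumF (m : {measure set T -> \bar R}) n : (m setT < +oo)%E ->
      fine (m (S n)) = \sum_(i < n) fine (m (F i)).
    move=> moo; rewrite /S; elim: n => [|n IHn]; first by rewrite !big_ord0 measure0.
    rewrite !big_ord_recr/= measureU//; last 2 first.
    - exact: mS.
    - rewrite -subset0 => x []; rewrite -bigcup_mkord => -[i /= lin Fix] Fnx.
      by have := tF i n I I (ex_intro _ x (conj Fix Fnx)) => iN; rewrite iN ltnn in lin.
    by rewrite fineD ?IHn//; apply: lty_fin_num_fun moo _ _ => //; exact: mS.
  have PS n : fine (nu k (S n)) @[k --> U] --> fine (l (S n)).
    rewrite sumF//; under eq_fun do rewrite sumF//.
    by apply: ultra_cvg_sum => i _; exact: PF.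
  apply/cvgrPdist_le => e e0.
  have e3 : 0 < e / 3 by rewrite divr_gt0.
  have [dl dl0 Hdl] := ac _ e3.
  have [n [lH lamH]] : exists n, (l (H n) < (e / 3)%:E)%E /\ (lam (H n) < dl%:E)%E.
    have [n _ Hn] := filterI (H0 l _ loo e3) (H0 lam _ lamoo dl0).
    by exists n; apply: Hn => /=.
  have /cvgrPdist_le/(_ _ e3) := PS n.
  apply: filterS => k Hk.
  have split3 (m : {measure set T -> \bar R}) : (m setT < +oo)%E ->
      fine (m (\bigcup_i F i)) = fine (m (S n)) + fine (m (H n)).
    move=> moo; rewrite (SUH n) measureU// fineD//; exact: lty_fin_num_fun moo _ _.
  rewrite !split3//.
  have h1 : 0 <= fine (l (H n)) <= e / 3.
    by rewrite fine_ge0//= -lee_fin fineK ?lfin// ltW.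
  have h2 : 0 <= fine (nu k (H n)) <= e / 3.
    by rewrite fine_ge0//= -lee_fin fineK ?nufin// Hdl.
  move: Hk; rewrite !ler_norml => Hk; apply/andP; split; lra.
Qed.

Hypothesis nul : setwise_cvg U nu l.

Let good (h : T -> R) := \int[nu n]_x h x @[n --> U] --> \int[l]_x h x.

Let good_indic A : measurable A -> good (\1_A).
Proof.
move=> mA; rewrite /good.
have E (m : {measure set T -> \bar R}) : \int[m]_x \1_A x = fine (m A).
  by rewrite /Rintegral integral_indic// setIT.
by rewrite E; under eq_fun do rewrite E; exact: nul.
Qed.

Lemma count_multiples (dl y : R) n : 0 < dl -> 0 <= y <= dl * n%:R ->
  `|y - dl * \sum_(i < n) (dl * i.+1%:R <= y)%R%:R| <= dl.
Proof.
move=> dl0; elim: n => [|n IHn].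
  by rewrite mulr0 -eq_le => /eqP <-; rewrite big_ord0 mulr0 subr0 normr0 ltW.
rewrite big_ord_recr/= => /andP[y0 yn].
have [yn'|yn'] := leP y (dl * n%:R).
  rewrite (_ : (dl * n.+1%:R <= y) = false) ?addr0; first by apply: IHn; rewrite y0.
  apply/negbTE; rewrite -ltNge (le_lt_trans yn')// ltr_pM2l// ltr_nat//.
have -> : \sum_(i < n) (dl * i.+1%:R <= y)%R%:R = n%:R :> R.
  rewrite (eq_bigr (fun _ => 1)) ?sumr_const ?card_ord// => i _.
  by rewrite (le_trans _ (ltW yn'))// ler_pM2l// ler_nat.
move: yn; rewrite -natr1 mulrDr mulr1 => yn.
by have [Hy|Hy] := leP (dl * n%:R + dl) y;
  rewrite /= ?addr0 ?mulrDr ?mulr1 ler_norml; apply/andP; split; lra.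
Qed.

Let good_cst c : good (cst c).
Proof.
rewrite /good Rintegral_cst//; under eq_fun do rewrite Rintegral_cst//.
by apply: cvgM; [exact: cvg_cst|exact: nul].
Qed.

Let bint (m : {measure set T -> \bar R}) (h : T -> R) B : (m setT < +oo)%E ->
  measurable_fun setT h -> (forall x, `|h x| <= B) -> m.-integrable setT (EFin \o h).
Proof. exact: bounded_integrable. Qed.

Lemma setwise_cvg_integral (h : T -> R) (B : R) : measurable_fun setT h ->
  (forall x, `|h x| <= B) -> good h.
Proof.
move=> mh hB.
have nonneg (g : T -> R) : measurable_fun setT g -> (forall x, 0 <= g x <= 2 * `|B|) ->
    good g.
  move=> mg gB; apply/cvgrPdist_le => e e0.
  pose dl := e / (3 * (K + 1)).
  have K1 : 0 < K + 1 by rewrite ltr_pwDr.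
  have dl0 : 0 < dl by rewrite divr_gt0// mulr_gt0.
  have [n Hn] : exists n : nat, 2 * `|B| <= dl * n%:R.
    exists (Num.truncn (2 * `|B| / dl)).+1.
    by rewrite -ler_pdivrMl// mulrC ltW// truncnS_gt.
  pose A i := [set x | dl * i.+1%:R <= g x].
  have mA i : measurable (A i).
    apply: measurable_bool_set; apply: measurable_fun_ler => //; exact: measurable_cst.
  pose s j x := dl * \sum_(i < j) \1_(A i) x.
  have ms j : measurable_fun setT (s j).
    apply: measurable_funM; first exact: measurable_cst.
    by apply: measurable_sum => i; exact: measurable_indic.
  have sB j x : `|s j x| <= dl * j%:R.
    have c0 : 0 <= \sum_(i < j) \1_(A i) x :> R by exact: sumr_ge0.
    rewrite /s ger0_norm; last by rewrite mulr_ge0// ltW.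
    apply: ler_wpM2l; first exact: ltW.
    rewrite -[j in leRHS]card_ord -sumr_const.
    by apply: ler_sum => i _; rewrite indicE; case: (_ \in _).
  have gs x : `|g x - s n x| <= dl.
    rewrite /s (eq_bigr (fun i : 'I_n => (dl * i.+1%:R <= g x)%R%:R)); last first.
      move=> i _; rewrite indicE (_ : (x \in A i) = (dl * i.+1%:R <= g x))//.
      by apply/idP/idP; rewrite inE.
    by apply: count_multiples => //; have /andP[-> /le_trans->] := gB x.
  have goods j : good (s j).
    rewrite /good; elim: j => [|j IHj].
      rewrite (_ : s 0%N = cst 0); first exact: good_cst.
      by apply/funext => x; rewrite /s big_ord0 mulr0.
    have E (m : {measure set T -> \bar R}) : (m setT < +oo)%E ->
        \int[m]_x s j.+1 x = \int[m]_x s j x + dl * \int[m]_x \1_(A j) x.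
      move=> moo; have i1 : m.-integrable setT (EFin \o \1_(A j)).
        apply: (bint (B := 1)) => // x.
        by rewrite indicE; case: (_ \in _); rewrite ?normr1 ?normr0.
      rewrite -RintegralZl// -RintegralD//.
      - by apply: eq_Rintegral => x _; rewrite /s big_ord_recr/= mulrDr.
      - exact: (bint moo (ms j) (sB j)).
      - by have := integrableZl measurableT dl i1; apply: eq_integrable.
    rewrite E//; under eq_fun do rewrite E//.
    by apply: cvgD => //; apply: cvgM; [exact: cvg_cst|exact: good_indic].
  have gB' x : `|g x| <= 2 * `|B| by have /andP[g0 gb] := gB x; rewrite ger0_norm.
  have close (m : {measure set T -> \bar R}) : (m setT <= K%:E)%E ->
      `|\int[m]_x g x - \int[m]_x s n x| <= e / 3.
    move=> mK; have moo : (m setT < +oo)%E by exact: le_lt_trans mK (ltry _).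
    have ig := bint moo mg gB'; have is_ := bint moo (ms n) (sB n).
    rewrite -RintegralB//.
    have igs := integrableB measurableT ig is_.
    apply: (le_trans (le_normr_Rintegral measurableT igs)).
    apply: (@le_trans _ _ (\int[m]_x cst dl x)).
      apply: le_Rintegral => //; first exact: (integrable_norm igs).
      by apply: (@bint m (cst dl) `|dl|) => //=.
    rewrite Rintegral_cst// /dl.
    have mK' : fine (m setT) <= K.
      by rewrite -lee_fin fineK// ge0_fin_numE.
    have m0 : 0 <= fine (m setT) by exact: fine_ge0.
    apply: (@le_trans _ _ (e / (3 * (K + 1)) * (K + 1))).
      by apply: ler_wpM2l; [exact: ltW|lra].
    rewrite le_eqVlt; apply/orP; left; apply/eqP; field.
    by rewrite gt_eqF.
  have e3 : 0 < e / 3 by rewrite divr_gt0.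
  have /cvgrPdist_le/(_ _ e3) := goods n.
  apply: filterS => k Hk.
  have := close _ (nuK k); have := close _ lK; move: Hk.
  rewrite !ler_norml => /andP[a1 a2] /andP[a3 a4] /andP[a5 a6].
  by apply/andP; split; lra.
have mhB : measurable_fun setT (fun x => h x + `|B|).
  by apply: measurable_funD => //; exact: measurable_cst.
have hB' x : - `|B| <= h x <= `|B|.
  by rewrite -ler_norml (le_trans (hB x))// ler_norm.
have g1 : good (fun x => h x + `|B|).
  by apply: nonneg => // x; have /andP[] := hB' x; lra.
have E (m : {measure set T -> \bar R}) : (m setT < +oo)%E ->
    \int[m]_x h x = \int[m]_x (h x + `|B|) - \int[m]_x cst `|B| x.
  move=> moo; rewrite -RintegralB//; last 2 first.
  - apply: (@bint m (fun x => h x + `|B|) (2 * `|B|)) => // x.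
    by have /andP[] := hB' x; rewrite ler_norml => *; apply/andP; split; lra.
  - by apply: (@bint m (cst `|B|) `|B|) => //= x; rewrite normr_id.
  by apply: eq_Rintegral => x _; rewrite addrK.
rewrite /good E//; under eq_fun do rewrite E//.
by apply: cvgB => //; exact: good_cst.
Qed.

End setwise_convergence.


Section unif_ac_product.
Context d1 d2 (T1 : measurableType d1) (T2 : measurableType d2) (R : realType).
Local Open Scope ereal_scope.

Lemma product_measureT_le (K L : R) (m : {finite_measure set T1 -> \bar R})
    (p : {sigma_finite_measure set T2 -> \bar R}) : (0 <= K)%R ->
  m setT <= K%:E -> p setT <= L%:E -> (m \x p) setT <= (K * L)%:E.
Proof.
move=> K0 mK pL; rewrite -setXTT product_measure1E// EFinM.
by apply: lee_pmul.
Qed.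

Lemma unif_ac_product (I : Type) (lam1 : {finite_measure set T1 -> \bar R})
    (lam2 : {sigma_finite_measure set T2 -> \bar R})
    (m : I -> {finite_measure set T1 -> \bar R})
    (p : I -> {sigma_finite_measure set T2 -> \bar R}) (K L : R) :
  (forall i, m i setT <= K%:E) -> (forall i, p i setT <= L%:E) ->
  unif_ac lam1 m -> unif_ac lam2 p ->
  unif_ac (lam1 \x lam2) (fun i => m i \x p i).
Proof.
move=> mK pL ac1 ac2 e e0.
pose e' := (e / (`|K| + `|L| + 1))%R.
have KL0 : (0 < `|K| + `|L| + 1)%R by rewrite ltr_pwDr// addr_ge0.
have e'0 : (0 < e')%R by rewrite divr_gt0.
have [dl1 dl10 H1] := ac1 _ e'0; have [dl2 dl20 H2] := ac2 _ e'0.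
exists (dl1 * dl2)%R; first exact: mulr_gt0.
move=> i D mD lD.
pose S := [set x | dl2%:E <= lam2 (xsection D x)].
have ml := measurable_fun_xsection lam2 mD.
have mS : measurable S.
  rewrite -[S]setTI; apply: measurable_lee => //; exact: measurable_cst.
have lS : lam1 S < dl1%:E.
  rewrite ltNge; apply/negP => lS; move: lD; apply/negP; rewrite -leNgt.
  apply: (@le_trans _ _ (\int[lam1]_(x in S) lam2 (xsection D x))); last first.
    rewrite /product_measure1; apply: ge0_subset_integral => //.
  apply: (@le_trans _ _ (\int[lam1]_(x in S) (cst dl2%:E) x)).
    rewrite integral_cst// muleC EFinM; apply: lee_pmul => //; rewrite lee_fin; exact: ltW.
  apply: ge0_le_integral => //.
  - by move=> x _; rewrite lee_fin ltW.
  - exact: measurable_funTS.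
have mp := measurable_fun_xsection (p i) mD.
have pD x : p i (xsection D x) <= L%:E.
  apply: le_trans (pL i); apply: le_measure; rewrite ?inE//; exact: measurable_xsection.
have L0 : (0 <= L)%R by rewrite -lee_fin (le_trans _ (pL i)).
have K0 : (0 <= K)%R by rewrite -lee_fin (le_trans _ (mK i)).
rewrite /product_measure1.
apply: (@le_trans _ _ (\int[m i]_x (L%:E * (\1_S x)%:E + e'%:E))).
  apply: ge0_le_integral => //.
  - apply: emeasurable_funD; last exact: measurable_cst.
    by apply: emeasurable_funM; [exact: measurable_cst|exact/measurable_EFinP].
  move=> x _ /=; rewrite indicE; have [xS|xS] := boolP (x \in S).
    by rewrite mule1 (le_trans (pD x))// leeDl// lee_fin ltW.
  rewrite mule0 add0e; apply: H2; first exact: measurable_xsection.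
  by rewrite ltNge; apply: contra xS => xS; rewrite inE.
rewrite ge0_integralD//; last 3 first.
- by move=> x _; rewrite mule_ge0 ?lee_fin.
- by apply: emeasurable_funM; [exact: measurable_cst|exact/measurable_EFinP].
- by move=> x _; rewrite lee_fin ltW.
rewrite ge0_integralZl ?lee_fin//; last by apply/measurable_EFinP.
rewrite integral_indic// setIT [X in _ + X]integral_cst//.
apply: (@le_trans _ _ (L%:E * e'%:E + e'%:E * K%:E)).
  apply: leeD; first by apply: lee_pmul => //; exact: H1.
  by apply: lee_pmul => //; rewrite ?lee_fin ?(ltW e'0)//; exact: mK.
rewrite -!EFinM -EFinD lee_fin mulrC -mulrDr /e' mulrAC ler_pdivrMr//.
by rewrite ler_wpM2l ?(ltW e0)// (ger0_norm K0) (ger0_norm L0); lra.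
Qed.

Variables (U : set_system nat) (UU : UltraFilter U).

Lemma setwise_cvg_product (lam1 : {finite_measure set T1 -> \bar R})
    (lam2 : {sigma_finite_measure set T2 -> \bar R})
    (m : nat -> {finite_measure set T1 -> \bar R}) (m' : {finite_measure set T1 -> \bar R})
    (p : nat -> {sigma_finite_measure set T2 -> \bar R})
    (p' : {sigma_finite_measure set T2 -> \bar R}) (K L : R) :
  (0 <= K)%R -> lam2 setT < +oo ->
  (forall i, m i setT <= K%:E) -> (forall i, p i setT <= L%:E) ->
  m' setT <= K%:E -> p' setT <= L%:E ->
  unif_ac lam1 m -> unif_ac lam2 p -> setwise_cvg U m m' -> setwise_cvg U p p' ->
  setwise_cvg U (fun i => m i \x p i) (m' \x p').
Proof.
move=> K0 lam2oo mK pL m'K p'L ac1 ac2 c1 c2.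
apply: (@setwise_cvg_pi_system _ _ _ U UU (fun i => [the measure _ _ of m i \x p i])
  (m' \x p') (K * L)%R _ _ (lam1 \x lam2)
  [set A `*` B | A in measurable & B in measurable]).
- by move=> n; exact: product_measureT_le.
- exact: product_measureT_le.
- apply: le_lt_trans (ltry (fine (lam1 setT) * fine (lam2 setT))).
  apply: product_measureT_le; first by rewrite fine_ge0.
    by rewrite fineK// fin_num_measure.
  by rewrite fineK// ge0_fin_numE.
- exact: unif_ac_product mK pL ac1 ac2.
- exact: measurable_prod_measurableType.
- move=> _ _ [A mA [B mB <-]] [A' mA' [B' mB' <-]]; rewrite -setXI.
  by exists (A `&` A'); [exact: measurableI|exists (B `&` B') => //; exact: measurableI].
- by exists setT => //; exists setT => //; rewrite setXTT.
- move=> _ [A mA [B mB <-]].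
  have E (x : {finite_measure set T1 -> \bar R}) (y : {sigma_finite_measure set T2 -> \bar R}) :
      y setT <= L%:E -> fine ((x \x y) (A `*` B)) = (fine (x A) * fine (y B))%R.
    move=> yL; rewrite product_measure1E// fineM//; first exact: fin_num_measure.
    by apply: lty_fin_num_fun => //; exact: le_lt_trans yL (ltry _).
  rewrite E//; under eq_fun do rewrite E//.
  by apply: cvgM; [exact: c1|exact: c2].
Qed.

End unif_ac_product.

Section power_limits.
Context d (T : measurableType d) (R : realType).
Variables (U : set_system nat) (UU : UltraFilter U).
Variables (lam mu : {finite_measure set T -> \bar R}).
Variables (m : nat -> {finite_measure set T -> \bar R}) (m' : {finite_measure set T -> \bar R}).
Variable K : R.
Local Open Scope ereal_scope.
Hypotheses (K0 : (0 <= K)%R) (mK : forall i, m i setT <= K%:E) (m'K : m' setT <= K%:E).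
Hypotheses (ac : unif_ac lam m) (c : setwise_cvg U m m').

Let tc n := @tcons _ T n.

Let mpre n (D : set (n.+1.-tuple T)) : measurable D ->
  measurable ((fun p : T * n.-tuple T => tcons p.1 p.2) @^-1` D).
Proof. by move=> mD; rewrite -[X in measurable X]setTI; exact: measurable_tcons. Qed.

Lemma power_measureT_le (x : {finite_measure set T -> \bar R}) n :
  x setT <= K%:E -> power_measure x n setT <= (K ^+ n)%:E.
Proof.
move=> xK; rewrite power_measureTE lee_fin; apply: lerXn2r; rewrite ?nnegrE ?fine_ge0//.
by rewrite -lee_fin fineK// fin_num_measure.
Qed.

Lemma unif_ac_power n : unif_ac (power_measure lam n) (fun i => power_measure (m i) n).
Proof.
elim: n => [|n IHn].
  move=> e e0; exists 1%R => // i D mD.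
  change (@dirac _ _ ([tuple] : 0.-tuple T) R D < 1%:E ->
    @dirac _ _ ([tuple] : 0.-tuple T) R D <= e%:E).
  by rewrite diracE; case: (_ \in D); rewrite ?ltxx// lee_fin ltW.
move=> e e0.
have [dl dl0 H] := unif_ac_product mK (fun i => @power_measureT_le (m i) n (mK i)) ac IHn e0.
by exists dl => // i D mD; apply: (H i _ (mpre mD)).
Qed.

Lemma setwise_cvg_power n :
  setwise_cvg U (fun i => power_measure (m i) n) (power_measure m' n).
Proof.
elim: n => [|n IHn]; first by move=> D mD; exact: cvg_cst.
move=> D mD.
exact: (setwise_cvg_product UU K0 (power_measureT_lty lam n) mK
  (fun i => @power_measureT_le (m i) n (mK i)) m'K (power_measureT_le n m'K)
  ac (@unif_ac_power n) c IHn (mpre mD)).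
Qed.

Lemma unif_ac_self : unif_ac lam (fun _ : nat => lam).
Proof. by move=> e e0; exists e => // _ D mD /ltW. Qed.

Lemma unif_ac_reference n :
  unif_ac (power_measure lam n.+1) (fun i => cons_measure lam (power_measure (m i) n)).
Proof.
move=> e e0.
have lK (i : nat) : lam setT <= (fine (lam setT))%:E by rewrite fineK// fin_num_measure.
have [dl dl0 H] := unif_ac_product lK (fun i => @power_measureT_le (m i) n (mK i))
  unif_ac_self (@unif_ac_power n) e0.
by exists dl => // i D mD; apply: (H i _ (mpre mD)).
Qed.

Lemma setwise_cvg_reference n :
  setwise_cvg U (fun i => cons_measure lam (power_measure (m i) n))
    (cons_measure lam (power_measure m' n)).
Proof.
have lK (i : nat) : lam setT <= (fine (lam setT))%:E by rewrite fineK// fin_num_measure.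
move=> D mD.
refine (setwise_cvg_product UU _ (power_measureT_lty lam n) lK
  (fun i => @power_measureT_le (m i) n (mK i)) (lK 0%N) (power_measureT_le n m'K)
  unif_ac_self (@unif_ac_power n) _ (@setwise_cvg_power n) (mpre mD)).
  by rewrite fine_ge0.
by move=> A mA; exact: cvg_cst.
Qed.

End power_limits.


Section setting_basics.
Context d (T : measurableType d) (R : realType) (kmax : nat).
Variable (mu : {finite_measure set T -> \bar R}).
Implicit Type Psi : trajectory_setting kmax mu.
Local Open Scope ereal_scope.

Lemma marginalT n (l : 'I_n) (nu : set (n.-tuple T) -> \bar R) :
  marginal l nu setT = nu setT.
Proof. by []. Qed.

Lemma first_momentE (mu_ : nat -> {finite_measure set T -> \bar R}) A :
  first_moment mu_ A = \sum_(0 <= j <oo) j%:R%:E * mu_ j A.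
Proof. by []. Qed.

Lemma sum_nuT Psi : (\sum_(k < kmax) fine (ts_nu Psi k setT) = fine (mu setT))%R.
Proof.
apply: EFin_inj; rewrite fineK ?fin_num_measure//.
rewrite -(ts_sources Psi measurableT) -sumEFin; apply: eq_bigr => k _.
by rewrite fineK// fin_num_measure.
Qed.

Lemma nuT_le Psi k : ts_nu Psi k setT <= mu setT.
Proof.
rewrite -(ts_sources Psi measurableT) (bigD1 k)//= marginalT leeDl// sume_ge0// => i _.
exact: (measure_ge0 (ts_nu Psi i)).
Qed.

Lemma relayE Psi A : relay_measure Psi A = \sum_(0 <= j <oo) j%:R%:E * ts_mu Psi j A.
Proof. by []. Qed.

Lemma relayT_le Psi : relay_measure Psi setT <= (kmax%:R * fine (mu setT))%:E.
Proof.
rewrite /relay_measure ts_relays//.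
apply: (@le_trans _ _ (\sum_(k < kmax) kmax%:R%:E * ts_nu Psi k setT)).
  apply: lee_sum => k _; apply: (@le_trans _ _ (\sum_(l < k.+1) ts_nu Psi k setT)).
    rewrite big_mkcond; apply: lee_sum => l _ /=.
    by case: ifP => // _; exact: measure_ge0.
  have fin : ts_nu Psi k setT \is a fin_num by exact: fin_num_measure.
  rewrite -(fineK fin) sumEFin sumr_const card_ord -EFinM lee_fin -[leLHS]mulr_natl.
  by rewrite ler_wpM2r ?fine_ge0// ler_nat.
rewrite -ge0_sume_distrr; last by move=> k _; exact: measure_ge0.
rewrite EFinM lee_wpmul2l ?lee_fin// -(sum_nuT Psi) -sumEFin lee_sum// => k _.
by rewrite fineK// fin_num_measure.
Qed.

Lemma mu_le Psi j A : measurable A -> ts_mu Psi j A <= mu A.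
Proof.
move=> mA; rewrite -(ts_receivers Psi mA) (nneseriesD1 (n := j))//.
by apply: leeDl; apply: nneseries_ge0 => i _ _; exact: measure_ge0.
Qed.

End setting_basics.

Section objective_formula.
Context d (T : measurableType d) (R : realType) (kmax : nat).
Variable (mu : {finite_measure set T -> \bar R}).
Variables (ft : forall k : 'I_kmax, k.+1.-tuple T -> R) (eta : nat -> R).
Variables (gamma beta c0 : R).
Hypothesis beta_ge0 : 0 <= beta.
Hypothesis c0_eta : forall j, c0 <= eta j.
Implicit Type Psi : trajectory_setting kmax mu.

Definition nu_entropy Psi k := entropy (ts_nu Psi k) (reference_measure Psi k).

Definition mu_entropy Psi j :=
  entropy (ts_mu Psi j) (mscale (NngNum (receiver_weight_ge0 mu j)) mu).

Definition mu_cost Psi j : \bar R :=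
  (mu_entropy Psi j + (beta * (eta j - c0))%:E * ts_mu Psi j setT)%E.

Definition objective_real Psi : R :=
  fine (mu setT) * (1 - \sum_(k < kmax) fine (relay_measure Psi setT) ^+ k)
  - (expR 1)^-1 + gamma * \sum_(k < kmax) \int[ts_nu Psi k]_x ft x
  + beta * (c0 * fine (mu setT)).

Lemma reference_measureT_lty Psi n : (reference_measure Psi n setT < +oo)%E.
Proof.
rewrite [X in (X < _)%E](cons_measureT mu (power_measure (relay_measure Psi) n)).
by rewrite lte_mul_pinfty ?fin_num_measure// power_measureT_lty.
Qed.

Lemma mscaleT_lty (r : {nonneg R}) : (mscale r mu setT < +oo)%E.
Proof. by rewrite /mscale lte_mul_pinfty// -ge0_fin_numE// fin_num_measure. Qed.

Lemma nu_entropy_ge0 Psi k : (0 <= nu_entropy Psi k)%E.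
Proof. exact/entropy_ge0/reference_measureT_lty. Qed.

Lemma mu_entropy_ge0 Psi j : (0 <= mu_entropy Psi j)%E.
Proof. exact/entropy_ge0/mscaleT_lty. Qed.

Lemma mu_cost_ge0 Psi j : (0 <= mu_cost Psi j)%E.
Proof.
rewrite adde_ge0 ?mu_entropy_ge0// mule_ge0 ?measure_ge0// lee_fin.
by rewrite mulr_ge0// subr_ge0.
Qed.

Lemma functional_ME Psi : functional_M eta Psi =
  (\sum_(0 <= j <oo) (eta j - c0)%:E * ts_mu Psi j setT + (c0 * fine (mu setT))%:E)%E.
Proof.
have fin j : ts_mu Psi j setT \is a fin_num by exact: fin_num_measure.
have c1 : (\sum_(0 <= j < n) (eta j - c0)%:E * ts_mu Psi j setT @[n --> \oo] -->
    \sum_(0 <= j <oo) (eta j - c0)%:E * ts_mu Psi j setT)%E.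
  by apply: is_cvg_nneseries => j _ _; rewrite mule_ge0// lee_fin subr_ge0.
have c2 : (\sum_(0 <= j < n) c0%:E * ts_mu Psi j setT @[n --> \oo] -->
    (c0 * fine (mu setT))%:E)%E.
  under eq_fun do rewrite -ge0_sume_distrr//.
  rewrite EFinM fineK ?fin_num_measure//.
  apply: cvgeZl => //; rewrite -(ts_receivers Psi measurableT).
  by apply: is_cvg_nneseries.
apply/cvg_lim => //.
rewrite (_ : (fun n => _) = (fun n => \sum_(0 <= j < n) (eta j - c0)%:E * ts_mu Psi j setT
  + \sum_(0 <= j < n) c0%:E * ts_mu Psi j setT)%E).
  by apply: cvgeD => //; rewrite fin_num_adde_defl.
apply/funext => n; rewrite -big_split/=; apply: eq_bigr => j _.
by rewrite -(fineK (fin j)) -!EFinM -EFinD; congr EFin; ring.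
Qed.

Hypothesis mft : forall k, measurable_fun setT (@ft k).
Variable Bf : R.
Hypothesis ftB : forall k x, `|@ft k x| <= Bf.

Lemma ft_integrable Psi k : (ts_nu Psi k).-integrable setT (EFin \o @ft k).
Proof.
apply: (bounded_integrable _ (@mft k) (@ftB k)).
by rewrite -ge0_fin_numE// fin_num_measure.
Qed.

Lemma functional_SE Psi :
  functional_S ft Psi = (\sum_(k < kmax) \int[ts_nu Psi k]_x ft x)%:E.
Proof.
rewrite /functional_S -sumEFin; apply: eq_bigr => k _.
rewrite /Rintegral fineK//; apply: integrable_fin_num => //; exact: ft_integrable.
Qed.

Lemma objectiveE Psi : objective ft eta gamma beta Psi =
  (\sum_(k < kmax) nu_entropy Psi k + \sum_(0 <= j <oo) mu_cost Psi j
   + (objective_real Psi)%:E)%E.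
Proof.
rewrite /objective /functional_I functional_SE functional_ME.
have H0 j : (0 <= (eta j - c0)%:E * ts_mu Psi j setT)%E.
  by rewrite mule_ge0// lee_fin subr_ge0.
have -> : (\sum_(0 <= j <oo) mu_cost Psi j = \sum_(0 <= j <oo) mu_entropy Psi j +
    beta%:E * \sum_(0 <= j <oo) (eta j - c0)%:E * ts_mu Psi j setT)%E.
  rewrite -nneseriesZl// -nneseriesD//.
  - by apply: eq_eseriesr => j _; rewrite muleA -EFinM.
  - by move=> j _ _; exact: mu_entropy_ge0.
  - by move=> j _ _; rewrite mule_ge0.
set X := (\sum_(k < kmax) _)%E; set Y := (\sum_(0 <= j <oo) mu_entropy _ _)%E.
set Z := (\sum_(0 <= j <oo) _)%E.
rewrite muleDr ?fin_num_adde_defl// /objective_real -!EFinM.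
set a := (_ - _)%R; set s := (gamma * _)%R; set b := (beta * _)%R.
by rewrite !EFinD -!addeA (addeCA s%:E) (addeCA (- _)%:E) (addeCA (fine _ * _)%:E).
Qed.

End objective_formula.


Lemma integral_EFin_cst d (T : measurableType d) (R : realType)
    (m : {measure set T -> \bar R}) A : measurable A ->
  forall r : R, (\int[m]_(x in A) r%:E = r%:E * m A)%E.
Proof. by move=> mA r; exact: integral_cst. Qed.

Section setting_of_densities.
Context d (T : measurableType d) (R : realType) (kmax : nat).
Variable (mu : {finite_measure set T -> \bar R}).
Local Open Scope ereal_scope.

Definition setting_density (Psi : trajectory_setting kmax mu)
    (n : forall k : 'I_kmax, k.+1.-tuple T -> R) (g : nat -> T -> R) : Prop :=
  (forall k : 'I_kmax, is_density (power_measure mu k.+1) (ts_nu Psi k) (@n k)) /\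
  (forall j, is_density mu (ts_mu Psi j) (g j)).

Lemma setting_of_densities (n : forall k : 'I_kmax, k.+1.-tuple T -> R) (g : nat -> T -> R) :
  (forall k : 'I_kmax, measurable_fun setT (@n k)) -> (forall (k : 'I_kmax) t, (0 <= @n k t)%R) ->
  (forall k : 'I_kmax, (power_measure mu k.+1).-integrable setT (EFin \o @n k)) ->
  (forall j, measurable_fun setT (g j)) -> (forall j x, (0 <= g j x)%R) ->
  (forall j, mu.-integrable setT (EFin \o g j)) ->
  (forall A, measurable A -> \sum_(k < kmax)
     \int[power_measure mu k.+1]_(t in (fun t => tnth t ord0) @^-1` A) (n k t)%:E = mu A) ->
  (forall A, measurable A -> \sum_(0 <= j <oo) \int[mu]_(x in A) (g j x)%:E = mu A) ->
  (forall A, measurable A ->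
    \sum_(0 <= j <oo) j%:R%:E * \int[mu]_(x in A) (g j x)%:E =
    \sum_(k < kmax) \sum_(l < k.+1 | (0 < l)%N)
     \int[power_measure mu k.+1]_(t in (fun t => tnth t l) @^-1` A) (n k t)%:E) ->
  exists Psi : trajectory_setting kmax mu, setting_density Psi n g.
Proof.
move=> mn n0 inn mg g0 ig H1 H2 H3.
pose nu k := density_finite_measure (mn k) (n0 k) (inn k).
pose mu_ j := density_finite_measure (mg j) (g0 j) (ig j).
have src A : measurable A -> \sum_(k < kmax) marginal ord0 (nu k) A = mu A.
  by move=> mA; exact: H1.
have rec A : measurable A -> \sum_(0 <= m <oo) mu_ m A = mu A.
  by move=> mA; exact: H2.
have rel A : measurable A -> first_moment mu_ A =
    \sum_(k < kmax) \sum_(l < k.+1 | (0 < l)%N) marginal l (nu k) A.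
  by move=> mA; exact: H3.
exists (TrajectorySetting src rec rel).
by split => [k|j]; exact: density_measureP.
Qed.

End setting_of_densities.

Section finite_objective.
Context d (T : measurableType d) (R : realType) (kmax : nat).
Variable (mu : {finite_measure set T -> \bar R}).
Variables (ft : forall k : 'I_kmax, k.+1.-tuple T -> R) (eta : nat -> R).
Variables (gamma beta c0 Bf : R).
Hypothesis kmax_gt0 : (0 < kmax)%N.
Hypothesis beta_ge0 : 0 <= beta.
Hypothesis c0_eta : forall j, c0 <= eta j.
Hypothesis mft : forall k, measurable_fun setT (@ft k).
Hypothesis ftB : forall k x, `|@ft k x| <= Bf.
Hypothesis mu_gt0 : (0 < mu setT)%E.

Lemma nneseries_exp (x : R) : 0 <= x ->
  (\sum_(0 <= j <oo) (x ^+ j / j`!%:R)%:E = (expR x)%:E)%E.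
Proof.
move=> x0; rewrite /expR; apply/cvg_lim => //.
rewrite (_ : (fun n => _) = EFin \o series (exp_coeff x)).
  apply: cvg_EFin; first exact: nearW.
  by have := is_cvg_series_exp_coeff x.
by apply/funext => n /=; rewrite sumEFin; congr EFin.
Qed.

Lemma muW_gt0 : 0 < fine (mu setT).
Proof. by rewrite fine_gt0// mu_gt0/= -ge0_fin_numE// fin_num_measure. Qed.

Lemma receiver_weight_gt0 j : 0 < receiver_weight mu j.
Proof.
by rewrite /receiver_weight !mulr_gt0 ?expR_gt0 ?invr_gt0 ?exprn_gt0 ?ltr0n ?fact_gt0//
  mulr_gt0 ?expR_gt0 ?muW_gt0.
Qed.

Lemma sum_receiver_weight : (\sum_(0 <= j <oo) (receiver_weight mu j)%:E = 1)%E.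
Proof.
set a := (expR 1 * fine (mu setT)).
have a0 : 0 < a by rewrite mulr_gt0 ?expR_gt0 ?muW_gt0.
transitivity ((expR (- a^-1))%:E * \sum_(0 <= j <oo) (a^-1 ^+ j / j`!%:R)%:E)%E.
  rewrite -nneseriesZl; last first.
    by move=> j _; rewrite lee_fin divr_ge0 ?exprn_ge0 ?invr_ge0 ?(ltW a0).
  by apply: eq_eseriesr => j _; rewrite -EFinM /receiver_weight exprVn mulrA.
by rewrite nneseries_exp ?invr_ge0 ?(ltW a0)// -EFinM -expRD addNr expR0.
Qed.

Lemma is_density_mscale (c : {nonneg R}) (nu : set T -> \bar R) f : 0 < c%:num ->
  is_density mu nu f -> is_density (mscale c mu) nu (fun x => f x / c%:num).
Proof.
move=> c_gt0 [mf f0 nuE].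
have mfc : measurable_fun setT (fun x => f x / c%:num).
  by apply: measurable_funM => //; exact: measurable_cst.
have n0 x : (0 <= (f x / c%:num)%:E)%E by rewrite lee_fin divr_ge0.
have mE A : measurable_fun A (fun x => (f x / c%:num)%:E).
  by apply/measurable_EFinP; exact: measurable_funTS.
split => // A mA.
rewrite ge0_integral_mscale// nuE// -ge0_integralZl//.
by apply: eq_integral => x _; rewrite -EFinM mulrC divfK// gt_eqF.
Qed.

Lemma mu_entropyE (Psi : trajectory_setting kmax mu) j g :
  is_density mu (ts_mu Psi j) g -> mu_entropy Psi j =
  (\int[mu]_x (receiver_weight mu j * kl (g x / receiver_weight mu j))%:E)%E.
Proof.
move=> dg; have c_gt0 := receiver_weight_gt0 j.
have [mg g0 _] := dg.
rewrite /mu_entropy (entropy_density (is_density_mscale _ dg))//; last exact: mscaleT_lty.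
have mk : measurable_fun setT (fun x => (kl (g x / receiver_weight mu j))%:E).
  apply/measurable_EFinP/measurable_kl/measurable_funM => //; exact: measurable_cst.
have k0 x : (0 <= (kl (g x / receiver_weight mu j))%:E)%E.
  by rewrite lee_fin kl_ge0// divr_ge0// ltW.
by rewrite ge0_integral_mscale// -ge0_integralZl// lee_fin ltW.
Qed.

Lemma objective_finite_exists :
  exists Psi : trajectory_setting kmax mu, (objective ft eta gamma beta Psi < +oo)%E.
Proof.
have iB (n : nat) : (power_measure mu n).-integrable setT
    (EFin \o (fun _ : n.-tuple T => 1)).
  by apply: (bounded_integrable (power_measureT_lty mu n)) => // x; rewrite normr1.
pose n (k : 'I_kmax) (t : k.+1.-tuple T) : R := (val k == 0)%N%:R.
pose g (j : nat) (x : T) : R := (j == 0)%N%:R.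
have [||||||||| Psi [dn dg]] := @setting_of_densities _ T R kmax mu n g.
- by move=> k; exact: measurable_cst.
- by move=> k t; rewrite ler0n.
- move=> k; apply: (bounded_integrable (B := 1) (power_measureT_lty mu k.+1)).
    exact: measurable_cst.
  by move=> t; rewrite /n; case: eqP; rewrite ?normr1 ?normr0.
- by move=> j; exact: measurable_cst.
- by move=> j x; rewrite ler0n.
- by move=> j; exact: finite_measure_integrable_cst.
- move=> A mA; rewrite (bigD1 (Ordinal kmax_gt0))//= big1 ?adde0; last first.
    move=> k k0; rewrite integral0_eq// => t _; rewrite /n.
    by rewrite (negbTE (_ : val k != 0%N)).
  rewrite /n/= integral_cst; last exact: measurable_preimage_tnth.
  by rewrite mul1e [LHS](@power_measure_cylinder _ _ _ mu 1 ord0 A mA) mule1.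
- move=> A mA; rewrite (nneseriesD1 (n := 0%N))//; last first.
    by move=> j _; apply: integral_ge0 => x _; rewrite lee_fin.
  rewrite eseries0 ?adde0; last first.
    by move=> j _ /=; rewrite /g => /negbTE ->; exact: integral0.
  by rewrite /g/= integral_cst// mul1e.
- move=> A mA; rewrite eseries0; last first.
    move=> [|j] _ _; first by rewrite mul0e.
    by rewrite /g/= integral0 mule0.
  rewrite big1// => k _; rewrite big1// => l l0.
  rewrite integral0_eq// => t _; rewrite /n; case: eqP => // k0.
  by move: l l0 t; rewrite k0 => -[[]].
exists Psi.
have dm : is_density mu (relay_measure Psi) (cst 0).
  split => // A mA; rewrite relayE eseries0 ?integral0// => -[|j] _ _.
    by rewrite mul0e.
  by case: (dg j.+1) => _ _ ->//; rewrite /g integral0 mule0.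
have refE (k : 'I_kmax) : val k = 0%N ->
    forall A, reference_measure Psi k A = power_measure mu k.+1 A.
  by case: k => -[].
have El k : (nu_entropy Psi k < +oo)%E.
  have dk : is_density (reference_measure Psi k) (ts_nu Psi k) (cst (val k == 0%N)%:R).
    split; [exact: measurable_cst|by move=> t; rewrite ler0n|move=> A mA].
    case: (dn k) => _ _ H; rewrite (H _ mA) {H}.
    rewrite /n; case: (altP (val k =P 0%N)) => k0; last by rewrite !integral0.
    rewrite [LHS](integral_cst (power_measure mu k.+1) mA).
    rewrite [RHS](integral_EFin_cst (reference_measure Psi k) mA true%:R).
    by apply: f_equal; exact: (esym (refE k k0 A)).
  rewrite /nu_entropy (entropy_density dk) ?reference_measureT_lty//.
  rewrite (integral_EFin_cst (reference_measure Psi k) measurableT (kl (val k == 0%N)%:R)).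
  by rewrite lte_mul_pinfty ?reference_measureT_lty// lee_fin kl_ge0.
have costE j : mu_cost eta beta c0 Psi j = ((receiver_weight mu j *
    kl ((j == 0)%N%:R / receiver_weight mu j)) * fine (mu setT)
    + beta * (eta j - c0) * ((j == 0)%N%:R * fine (mu setT)))%:E.
  have mufin : mu setT \is a fin_num by exact: fin_num_measure.
  rewrite /mu_cost (mu_entropyE (dg j)) /g integral_EFin_cst//.
  case: (dg j) => _ _ ->//; rewrite /g integral_EFin_cst//.
  by rewrite EFinD !EFinM fineK.
rewrite (objectiveE gamma beta_ge0 c0_eta mft ftB).
rewrite lte_add_pinfty ?ltry// lte_add_pinfty//.
  by apply: lte_sum_pinfty => k _; exact: El.
rewrite (nneseriesD1 (n := 0%N))//; last by move=> j _; exact: mu_cost_ge0.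
rewrite lte_add_pinfty//; first by rewrite costE ltry.
apply: (@le_lt_trans _ _ (\sum_(0 <= j <oo) (fine (mu setT))%:E * (receiver_weight mu j)%:E)%E).
  rewrite eseries_mkcond/=; apply: lee_nneseries => [j _ _|j _].
    by case: ifP => // _; exact: mu_cost_ge0.
  case: ifP => j0; last by rewrite -EFinM lee_fin mulr_ge0 ?(ltW muW_gt0) ?(ltW (receiver_weight_gt0 _)).
  rewrite costE (negbTE j0) mul0r mul0r mulr0 addr0 /kl mul0r subr0 add0r mulr1 mulrC.
  by rewrite -EFinM.
rewrite nneseriesZl; last by move=> j _; rewrite lee_fin ltW// receiver_weight_gt0.
by rewrite sum_receiver_weight mule1 ltry.
Qed.

End finite_objective.


Section unif_ac_entropy.
Context d (T : measurableType d) (R : realType).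
Local Open Scope ereal_scope.

Lemma unif_ac_entropy (I : Type) (lam : set T -> \bar R)
    (nu : I -> {finite_measure set T -> \bar R})
    (rho : I -> {sigma_finite_measure set T -> \bar R}) (C : R) :
  (forall i, rho i setT < +oo) -> (forall i, entropy (nu i) (rho i) <= C%:E) ->
  unif_ac lam rho -> unif_ac lam nu.
Proof.
move=> rhooo HC ac e e0.
pose th := (2 * (`|C| + 1) / e)%R.
have C1 : (0 < `|C| + 1)%R by rewrite ltr_pwDr.
have th0 : (0 < th)%R by rewrite divr_gt0// mulr_gt0.
have dl'0 : (0 < (`|C| + 1) / (expR th))%R by rewrite divr_gt0// expR_gt0.
have [dl dl0 H] := ac _ dl'0; exists dl => // i D mD lD.
have rD := H i D mD lD.
have rDfin : rho i D \is a fin_num by exact: lty_fin_num_fun (rhooo i) _ mD.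
have nuDfin : nu i D \is a fin_num by exact: fin_num_measure.
have mI : measurable_fun setT (fun x => th * \1_D x)%R.
  by apply: measurable_funM => //; exact: measurable_cst.
have hB x : (`|th * \1_D x| <= th)%R.
  by rewrite indicE; case: (_ \in _); rewrite ?mulr1 ?mulr0 ?normr0 ?ger0_norm// ltW.
have := le_trans (entropy_ge_variational (nu i) (rhooo i) mI hB) (HC i).
have -> : (\int[nu i]_x (th * \1_D x) = th * fine (nu i D))%R.
  rewrite RintegralZl//; last exact: integrable_indic.
  by rewrite /Rintegral integral_indic// setIT.
have -> : (\int[rho i]_x (expR (th * \1_D x) - 1) = (expR th - 1) * fine (rho i D))%R.
  rewrite (_ : (fun x => _) = fun x => (expR th - 1) * \1_D x)%R.
    rewrite RintegralZl//.
      by rewrite /Rintegral integral_indic// setIT.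
    apply: (bounded_integrable (B := 1%R) (rhooo i)) => // x.
    by rewrite indicE; case: (_ \in _); rewrite ?normr1 ?normr0.
  apply/funext => x; rewrite indicE; case: (_ \in _); first by rewrite !mulr1.
  by rewrite !mulr0 expR0 subrr.
rewrite -(fineK nuDfin) !lee_fin => HH.
have r0 : (0 <= fine (rho i D))%R by exact: fine_ge0.
have rD' : (fine (rho i D) * expR th <= `|C| + 1)%R.
  by rewrite -ler_pdivlMr ?expR_gt0// -lee_fin fineK.
have : (th * fine (nu i D) <= 2 * (`|C| + 1))%R.
  by have := ler_norm C; nra.
by rewrite -ler_pdivlMl// /th invf_div mulrAC -mulrA divff ?mulr1// gt_eqF// mulr_gt0.
Qed.

End unif_ac_entropy.

Section ultra_series.
Variables (R : realType) (U : set_system nat) (UU : UltraFilter U).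

Lemma ultra_series (a : nat -> nat -> R) (a' s : nat -> R) (s' : R) :
  (forall n j, 0 <= a n j) ->
  (forall j, a n j @[n --> U] --> a' j) -> s n @[n --> U] --> s' ->
  (forall n J, \sum_(0 <= j < J) a n j <= s n) ->
  (forall e, 0 < e -> exists J, forall n, s n <= \sum_(0 <= j < J) a n j + e) ->
  (\sum_(0 <= j <oo) (a' j)%:E = s'%:E)%E.
Proof.
move=> a0 aa' ss' as_ sa.
have a'0 j : 0 <= a' j.
  by apply: (ultra_cvg_le _ (cvg_cst 0) (aa' j)) => n.
have part J : \sum_(0 <= j < J) a n j @[n --> U] --> \sum_(0 <= j < J) a' j.
  by apply: ultra_cvg_sum.
apply/eqP; rewrite eq_le; apply/andP; split.
  apply: lime_le; first by apply: is_cvg_nneseries => j _ _; rewrite lee_fin.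
  apply: nearW => J; rewrite sumEFin lee_fin.
  exact: (ultra_cvg_le _ (part J) ss').
apply/lee_addgt0Pr => e e0; have [J HJ] := sa e e0.
apply: (@le_trans _ _ ((\sum_(0 <= j < J) a' j)%:E + e%:E)%E).
  rewrite -EFinD lee_fin; apply: (ultra_cvg_le HJ ss').
  by apply: cvgD => //; exact: cvg_cst.
rewrite leeD2r// -sumEFin; apply: nneseries_lim_ge => j _ _.
by rewrite lee_fin.
Qed.

End ultra_series.

Lemma nneseries_le_tail (R : realType) (u : nat -> \bar R) J (e : \bar R) :
  (forall j, 0 <= u j)%E -> (forall N, \sum_(J <= j < N) u j <= e)%E ->
  (\sum_(0 <= j <oo) u j <= \sum_(0 <= j < J) u j + e)%E.
Proof.
move=> u0 ue; rewrite (nneseries_split _ J)// add0n; apply: leeD2l.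
apply: lime_le; first exact: is_cvg_nneseries.
exact: nearW.
Qed.

Section bounds.
Context d (T : measurableType d) (R : realType) (kmax : nat).
Variable (mu : {finite_measure set T -> \bar R}).
Variables (ft : forall k : 'I_kmax, k.+1.-tuple T -> R) (eta : nat -> R).
Variables (gamma beta c0 Bf : R).
Hypothesis beta_gt0 : 0 < beta.
Hypothesis c0_eta : forall j, c0 <= eta j.
Hypothesis eta_sup : forall K, exists J, forall j, (J <= j)%N -> K * j%:R <= eta j.
Hypothesis mft : forall k : 'I_kmax, measurable_fun setT (@ft k).
Hypothesis ftB : forall (k : 'I_kmax) x, `|@ft k x| <= Bf.
Implicit Type Psi : trajectory_setting kmax mu.

Lemma objective_real_ge : exists L, forall Psi, - L <= objective_real ft gamma beta c0 Psi.
Proof.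
pose w := fine (mu setT).
have w0 : 0 <= w by rewrite /w fine_ge0.
exists (- (w * (1 - \sum_(k < kmax) (kmax%:R * w) ^+ k) - (expR 1)^-1
  - `|gamma| * (Bf * w) + beta * (c0 * w))).
move=> Psi; rewrite opprK /objective_real lerD2r; apply: lerD.
  rewrite lerD2r ler_wpM2l// lerD2l lerN2; apply: ler_sum => k _.
  apply: lerXn2r; rewrite ?nnegrE ?fine_ge0 ?mulr_ge0//.
  rewrite -lee_fin fineK ?relayT_le//; exact: fin_num_measure.
have SB : `|\sum_(k < kmax) \int[ts_nu Psi k]_x ft x| <= Bf * w.
  apply: (le_trans (ler_norm_sum _ _ _)).
  rewrite /w -(sum_nuT Psi) mulr_sumr; apply: ler_sum => k _.
  have ik := ft_integrable mft ftB Psi k.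
  apply: (le_trans (le_normr_Rintegral measurableT ik)).
  rewrite -Rintegral_cst//; apply: le_Rintegral => //.
  - exact: (integrable_norm ik).
  - exact: finite_measure_integrable_cst.
have : `|gamma * \sum_(k < kmax) \int[ts_nu Psi k]_x ft x| <= `|gamma| * (Bf * w).
  by rewrite normrM ler_wpM2l.
by rewrite ler_norml => /andP[].
Qed.

Lemma tail_bound (C tau : R) : 0 < tau -> exists J, forall Psi,
  (\sum_(0 <= j <oo) mu_cost eta beta c0 Psi j <= C%:E)%E ->
  forall A, measurable A ->
  (relay_measure Psi A <= \sum_(0 <= j < J) j%:R%:E * ts_mu Psi j A + tau%:E)%E /\
  (mu A <= \sum_(0 <= j < J) ts_mu Psi j A + tau%:E)%E.
Proof.
move=> tau0; pose K := (`|C| + 1) / (beta * tau).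
have C1 : 0 < `|C| + 1 by rewrite ltr_pwDr.
have K0 : 0 < K by rewrite divr_gt0// mulr_gt0.
have bK : 0 < beta * K by exact: mulr_gt0.
have bK0 : 0 <= (beta * K)^-1 by rewrite invr_ge0 ltW.
have [J0 HJ0] := eta_sup (K + `|c0|).
exists (J0 + 1)%N => Psi HC A mA.
have termle j : (J0 + 1 <= j)%N ->
    (j%:R%:E * ts_mu Psi j A <= ((beta * K)^-1)%:E * mu_cost eta beta c0 Psi j)%E.
  move=> Jj; have j1 : 1 <= j%:R :> R by rewrite ler1n (leq_trans _ Jj)// addn1.
  have etaj : K * j%:R <= eta j - c0.
    have := HJ0 j (leq_trans (leq_addr _ _) Jj).
    by have := ler_norm c0; have := normr_ge0 c0; nra.
  apply: (@le_trans _ _ (((beta * K)^-1)%:E * ((beta * (eta j - c0))%:E * ts_mu Psi j setT)))%E.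
    rewrite muleA -EFinM; apply: lee_pmul => //.
      rewrite lee_fin invfM mulrACA mulVf ?gt_eqF// mul1r ler_pdivlMl//.
    by apply: le_measure; rewrite ?inE.
  rewrite lee_wpmul2l ?lee_fin//.
  by rewrite /mu_cost leeDr// mu_entropy_ge0.
have tailN N : (\sum_((J0 + 1)%N <= j < N) j%:R%:E * ts_mu Psi j A <= tau%:E)%E.
  apply: (@le_trans _ _ (((beta * K)^-1)%:E * \sum_(0 <= j <oo) mu_cost eta beta c0 Psi j))%E.
    apply: (@le_trans _ _ (((beta * K)^-1)%:E *
      \sum_((J0 + 1)%N <= j < N) mu_cost eta beta c0 Psi j))%E.
      rewrite ge0_sume_distrr; last by move=> j _; exact/mu_cost_ge0/c0_eta/ltW.
      rewrite big_nat_cond [leRHS]big_nat_cond.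
      by apply: lee_sum => j /andP[/andP[Jj _] _]; exact: termle.
    rewrite lee_wpmul2l ?lee_fin//.
    have cost0 j : (0 <= mu_cost eta beta c0 Psi j)%E by apply: mu_cost_ge0 => //; exact: ltW.
    apply: (@le_trans _ _ (\sum_(0 <= j < N) mu_cost eta beta c0 Psi j)%E); last first.
      by apply: nneseries_lim_ge.
    have [NJ|JN] := leqP N (J0 + 1).
      by rewrite big_geq// sume_ge0.
    rewrite (big_cat_nat (n := (J0 + 1)%N) (leq0n _) (ltnW JN))/=.
    by rewrite leeDr// sume_ge0.
  apply: (@le_trans _ _ (((beta * K)^-1)%:E * C%:E)%E).
    by apply: lee_wpmul2l; rewrite ?lee_fin; [exact: bK0|exact: HC].
  rewrite -EFinM lee_fin (ler_pdivrMl _ _ bK) /K.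
  have -> : beta * ((`|C| + 1) / (beta * tau)) * tau = `|C| + 1.
    by field; rewrite (gt_eqF tau0) (gt_eqF beta_gt0).
  by have := ler_norm C; lra.
split; first by rewrite relayE; apply: nneseries_le_tail => // j; rewrite mule_ge0.
rewrite -[leLHS](ts_receivers Psi mA); apply: nneseries_le_tail => // N.
apply: le_trans (tailN N); rewrite big_nat_cond [leRHS]big_nat_cond.
apply: lee_sum => j /andP[/andP[Jj _] _]; rewrite lee_pemull// lee_fin ler1n.
by rewrite (leq_trans _ Jj)// addn1.
Qed.

End bounds.


Section entropy_lsc.
Context d (T : measurableType d) (R : realType).
Variables (U : set_system nat) (UU : UltraFilter U).

Lemma entropy_lsc (nu : nat -> {finite_measure set T -> \bar R})
    (nu' : {finite_measure set T -> \bar R})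
    (rho : nat -> {sigma_finite_measure set T -> \bar R})
    (rho' : {sigma_finite_measure set T -> \bar R}) (K C : R) :
  (forall n, nu n setT <= K%:E)%E -> (nu' setT <= K%:E)%E ->
  (forall n, rho n setT <= K%:E)%E -> (rho' setT <= K%:E)%E ->
  (forall n, entropy (nu n) (rho n) <= C%:E)%E ->
  setwise_cvg U nu nu' -> setwise_cvg U rho rho' ->
  exists e : R, fine (entropy (nu n) (rho n)) @[n --> U] --> e /\
    (entropy nu' rho' <= e%:E)%E.
Proof.
move=> nuK nuK' rhoK rhoK' HC cnu crho.
have rhooo n : (rho n setT < +oo)%E by exact: le_lt_trans (rhoK n) (ltry _).
have rhooo' : (rho' setT < +oo)%E by exact: le_lt_trans rhoK' (ltry _).
have Hfin n : (fine (entropy (nu n) (rho n)))%:E = entropy (nu n) (rho n).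
  by rewrite fineK// ge0_fin_numE ?entropy_ge0// (le_lt_trans (HC n))// ltry.
have [|e He] := ultra_cvg (U := U) (a := fun n => fine (entropy (nu n) (rho n))) (K := C).
  by move=> n; rewrite ger0_norm ?fine_ge0 ?entropy_ge0// -lee_fin Hfin.
exists e; split => //; apply: entropy_le_variational => // h B mh hB.
have c1 := setwise_cvg_integral UU nuK nuK' cnu mh hB.
have me : measurable_fun setT (fun x => expR (h x) - 1).
  by apply: measurable_funB; [exact: measurableT_comp|exact: measurable_cst].
have eB x : `|expR (h x) - 1| <= expR B + 1.
  rewrite (le_trans (ler_normB _ _))// normr1 lerD2r ger0_norm ?expR_ge0//.
  by rewrite ler_expR (le_trans (ler_norm _)).
have c2 := setwise_cvg_integral UU rhoK rhoK' crho me eB.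
apply: (ultra_cvg_le _ (cvgB c1 c2) He) => n.
by rewrite -lee_fin Hfin; exact: entropy_ge_variational mh hB.
Qed.

End entropy_lsc.

Section existence.
Context d (T : measurableType d) (R : realType) (kmax : nat).
Variable (mu : {finite_measure set T -> \bar R}).
Variables (ft : forall k : 'I_kmax, k.+1.-tuple T -> R) (eta : nat -> R).
Variables (gamma beta c0 Bf : R).
Hypothesis kmax_gt0 : (0 < kmax)%N.
Hypothesis mu_gt0 : (0 < mu setT)%E.
Hypothesis beta_gt0 : 0 < beta.
Hypothesis c0_eta : forall j, c0 <= eta j.
Hypothesis eta_sup : forall K, exists J, forall j, (J <= j)%N -> K * j%:R <= eta j.
Hypothesis mft : forall k : 'I_kmax, measurable_fun setT (@ft k).
Hypothesis ftB : forall (k : 'I_kmax) x, `|@ft k x| <= Bf.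

Let obj := objective ft eta gamma beta (mu := mu).
Let objE := objectiveE gamma (ltW beta_gt0) c0_eta mft ftB (mu := mu).
Let w := fine (mu setT).

Let infimum_finite : ereal_inf (range obj) \is a fin_num.
Proof.
rewrite fin_numElt; apply/andP; split.
  have [L HL] := objective_real_ge mu gamma beta c0 mft ftB.
  apply: (@lt_le_trans _ _ (- L)%:E); first exact: ltNyr.
  apply: le_ereal_inf_tmp => _ [Psi _ <-]; rewrite /obj objE.
  rewrite -[leLHS]add0e leeD ?lee_fin ?HL// adde_ge0//.
    by rewrite sume_ge0// => k _; exact: nu_entropy_ge0.
  by apply: nneseries_ge0 => j _ _; apply: mu_cost_ge0 => //; exact: ltW.
have [Psi0 HPsi0] := objective_finite_exists gamma kmax_gt0
  (ltW beta_gt0) c0_eta mft ftB mu_gt0.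
by apply: le_lt_trans HPsi0; apply: ereal_inf_lbound; exists Psi0.
Qed.

Let v := fine (ereal_inf (range obj)).

Let minimizing_sequence : exists Psi : nat -> trajectory_setting kmax mu,
  forall n, (obj (Psi n) <= (v + n.+1%:R^-1)%:E)%E.
Proof.
have H n : exists Psi : trajectory_setting kmax mu,
    (obj Psi <= (v + n.+1%:R^-1)%:E)%E.
  have n0 : 0 < n.+1%:R^-1 :> R by rewrite invr_gt0.
  have [_ [Psi _ <-] H] := lb_ereal_inf_adherent n0 infimum_finite.
  by exists Psi; apply: ltW; rewrite EFinD /v fineK.
by have [F HF] := choice H; exists F.
Qed.

Lemma minimizer_exists : exists Psi : trajectory_setting kmax mu,
  is_minimizer ft eta gamma beta Psi.
Proof.
have [Psi HPsi] := minimizing_sequence.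
have [L HL] := objective_real_ge mu gamma beta c0 mft ftB.
pose C := v + 1 + L.
pose Ent n := (\sum_(k < kmax) nu_entropy (Psi n) k)%E.
pose Cost n := (\sum_(0 <= j <oo) mu_cost eta beta c0 (Psi n) j)%E.
have cost0 n j : (0 <= mu_cost eta beta c0 (Psi n) j)%E.
  by apply: mu_cost_ge0 => //; exact: ltW.
have Ent0 n : (0 <= Ent n)%E.
  by rewrite sume_ge0// => k _; exact: nu_entropy_ge0.
have Cost0 n : (0 <= Cost n)%E by exact: nneseries_ge0.
have EntCost n : (Ent n + Cost n <= C%:E)%E.
  have := HPsi n; rewrite /obj objE -leeBrDr// -EFinB => /le_trans; apply.
  rewrite lee_fin /C; have := HL (Psi n).
  have : n.+1%:R^-1 <= 1 :> R by rewrite invf_le1 ?ltr0n// ler1n.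
  by move: (_^-1) (objective_real _ _ _ _ _) => q r; lra.
have EntC n k : (nu_entropy (Psi n) k <= C%:E)%E.
  apply: le_trans (EntCost n); apply: (@le_trans _ _ (Ent n)); last by rewrite leeDl.
  by rewrite /Ent (bigD1 k)//= leeDl// sume_ge0// => i _; exact: nu_entropy_ge0.
have CostC n : (Cost n <= C%:E)%E.
  by apply: le_trans (EntCost n); rewrite leeDr.
have costC n j : (mu_cost eta beta c0 (Psi n) j <= C%:E)%E.
  apply: le_trans (CostC n); rewrite /Cost (nneseriesD1 (n := j))//.
  by rewrite leeDl// nneseries_ge0.
have tail tau : 0 < tau -> exists J, forall n A, measurable A ->
    (relay_measure (Psi n) A <= \sum_(0 <= j < J) j%:R%:E * ts_mu (Psi n) j A + tau%:E)%E /\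
    (mu A <= \sum_(0 <= j < J) ts_mu (Psi n) j A + tau%:E)%E.
  move=> tau0; have [J HJ] := tail_bound kmax mu beta_gt0 c0_eta eta_sup C tau0.
  by exists J => n A mA; exact: HJ (CostC n) A mA.
have [U [UU HU]] := @ultraFilterLemma nat \oo _.
(* the measures mu_j, the relays M and the nu_k are uniformly absolutely continuous *)
have acmu j : unif_ac mu (fun n => ts_mu (Psi n) j).
  move=> e e0; exists e => // n D mD /ltW; exact: le_trans (mu_le _ _ mD).
have acM : unif_ac mu (fun n => relay_measure (Psi n)).
  move=> e e0; have e2 : 0 < e / 2 by rewrite divr_gt0.
  have [J HJ] := tail _ e2.
  have J1 : 0 < J%:R + 1 :> R by rewrite ltr_pwDr.
  exists (e / 2 / (J%:R + 1)); first by rewrite divr_gt0.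
  move=> n D mD muD; apply: (le_trans (proj1 (HJ n D mD))).
  apply: (@le_trans _ _ (J%:R%:E * mu D + (e / 2)%:E)%E).
    rewrite leeD2r//; apply: (@le_trans _ _ (\sum_(0 <= j < J) J%:R%:E * ts_mu (Psi n) j D)%E).
      rewrite big_nat_cond [leRHS]big_nat_cond.
      apply: lee_sum => j /andP[/andP[_ jJ] _].
      by rewrite lee_wpmul2r// lee_fin ler_nat ltnW.
    rewrite -ge0_sume_distrr// lee_wpmul2l ?lee_fin//.
    by rewrite -(ts_receivers (Psi n) mD); exact: nneseries_lim_ge.
  have muDfin : mu D \is a fin_num by exact: fin_num_measure.
  rewrite -(fineK muDfin) in muD *; rewrite -EFinM -EFinD lee_fin.
  move: muD; rewrite lte_fin ltr_pdivlMr// => muD.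
  have := fine_ge0 (measure_ge0 mu D); nra.
have MK n : (relay_measure (Psi n) setT <= (kmax%:R * w)%:E)%E by exact: relayT_le.
have acref k : unif_ac (power_measure mu k.+1)
    (fun n => cons_measure mu (power_measure (relay_measure (Psi n)) k)).
  have Kw0 : 0 <= kmax%:R * w by rewrite mulr_ge0// /w fine_ge0.
  exact: (unif_ac_reference Kw0 MK acM k).
have acnu (k : 'I_kmax) : unif_ac (power_measure mu k.+1) (fun n => ts_nu (Psi n) k).
  apply: (unif_ac_entropy (rho := fun n => reference_measure (Psi n) k) (C := C)).
  - by move=> n; exact: reference_measureT_lty.
  - by move=> n; exact: EntC.
  - exact: acref.
have muT_le j n : (ts_mu (Psi n) j setT <= w%:E)%E.
  by rewrite /w fineK ?fin_num_measure// mu_le.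
have nuT_le' k n : (ts_nu (Psi n) k setT <= w%:E)%E.
  by rewrite /w fineK ?fin_num_measure// nuT_le.
have limmu j : {l : {finite_measure set T -> \bar R} |
    setwise_cvg U (fun n => ts_mu (Psi n) j) l}.
  by apply: cid; apply: setwise_limit_exists (muT_le j) (acmu j);
    rewrite -ge0_fin_numE// fin_num_measure.
have limnu (k : 'I_kmax) : {l : {finite_measure set (k.+1.-tuple T) -> \bar R} |
    setwise_cvg U (fun n => ts_nu (Psi n) k) l}.
  by apply: cid; apply: setwise_limit_exists (nuT_le' k) (acnu k);
    exact: power_measureT_lty.
pose mus j := sval (limmu j).
pose nus k := sval (limnu k).
have cmu j : setwise_cvg U (fun n => ts_mu (Psi n) j) (mus j) by exact: svalP (limmu j).
have cnu k : setwise_cvg U (fun n => ts_nu (Psi n) k) (nus k) by exact: svalP (limnu k).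
have finmu n j A : measurable A -> (fine (ts_mu (Psi n) j A))%:E = ts_mu (Psi n) j A.
  by move=> mA; rewrite fineK// fin_num_measure.
have finmus j A : measurable A -> (fine (mus j A))%:E = mus j A.
  by move=> mA; rewrite fineK// fin_num_measure.
have finM n A : measurable A -> (fine (relay_measure (Psi n) A))%:E = relay_measure (Psi n) A.
  by move=> mA; rewrite fineK// fin_num_measure.
have finnus k l A : measurable A ->
    (fine (marginal l (nus k) A))%:E = marginal l (nus k) A.
  by move=> mA; rewrite fineK// fin_num_measure//; exact: measurable_preimage_tnth.
have finnu n k l A : measurable A ->
    (fine (marginal l (ts_nu (Psi n) k) A))%:E = marginal l (ts_nu (Psi n) k) A.
  by move=> mA; rewrite fineK// fin_num_measure//; exact: measurable_preimage_tnth.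
have finMu A : measurable A -> (fine (mu A))%:E = mu A.
  by move=> mA; rewrite fineK// fin_num_measure.
have src A : measurable A -> \sum_(k < kmax) marginal ord0 (nus k) A = mu A.
  move=> mA; rewrite -(finMu _ mA); under eq_bigr => k _ do rewrite -finnus//.
  rewrite sumEFin; congr EFin.
  have c1 : (fun _ : nat => fine (mu A)) n @[n --> U] -->
      \sum_(k < kmax) fine (marginal ord0 (nus k) A).
    rewrite (_ : (fun _ : nat => fine (mu A)) = fun n =>
      \sum_(k < kmax) fine (marginal ord0 (ts_nu (Psi n) k) A)).
      by apply: ultra_cvg_sum => k _; apply: cnu; exact: measurable_preimage_tnth.
    apply/funext => n; apply: EFin_inj; rewrite -sumEFin finMu//.
    by rewrite -(ts_sources (Psi n) mA); apply: eq_bigr => k _; rewrite finnu.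
  exact: (ultra_cvg_unique c1 (cvg_cst _)).
have partmu n A J : measurable A ->
    (\sum_(0 <= j < J) fine (ts_mu (Psi n) j A))%:E = (\sum_(0 <= j < J) ts_mu (Psi n) j A)%E.
  by move=> mA; rewrite -sumEFin; apply: eq_bigr => j _; rewrite finmu.
have rec A : measurable A -> (\sum_(0 <= j <oo) mus j A = mu A)%E.
  move=> mA; rewrite -(finMu _ mA).
  rewrite (eq_eseriesr (g := fun j => (fine (mus j A))%:E)); last by move=> j _; rewrite finmus.
  apply: (ultra_series UU (a := fun n j => fine (ts_mu (Psi n) j A))
    (s := fun _ => fine (mu A))).
  - by move=> n j; rewrite fine_ge0.
  - by move=> j; exact: cmu.
  - exact: cvg_cst.
  - move=> n J; rewrite -lee_fin partmu// finMu// -(ts_receivers (Psi n) mA).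
    exact: nneseries_lim_ge.
  - move=> e e0; have [J HJ] := tail e e0; exists J => n.
    by rewrite -lee_fin EFinD partmu// finMu//; case: (HJ n A mA).
have rel' A : measurable A -> (\sum_(0 <= j <oo) j%:R%:E * mus j A =
    (\sum_(k < kmax) \sum_(l < k.+1 | (0 < l)%N) fine (marginal l (nus k) A))%:E)%E /\
    fine (relay_measure (Psi n) A) @[n --> U] -->
    \sum_(k < kmax) \sum_(l < k.+1 | (0 < l)%N) fine (marginal l (nus k) A).
  move=> mA.
  have cM : fine (relay_measure (Psi n) A) @[n --> U] -->
      \sum_(k < kmax) \sum_(l < k.+1 | (0 < l)%N) fine (marginal l (nus k) A).
    rewrite (_ : (fun n => _) = fun n => \sum_(k < kmax) \sum_(l < k.+1 | (0 < l)%N)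
        fine (marginal l (ts_nu (Psi n) k) A)).
      apply: ultra_cvg_sum => k _; apply: ultra_cvg_sum => l _.
      by apply: cnu; exact: measurable_preimage_tnth.
    apply/funext => n; apply: EFin_inj; rewrite finM// /relay_measure ts_relays//.
    rewrite -sumEFin; apply: eq_bigr => k _; rewrite -sumEFin; apply: eq_bigr => l _.
    by rewrite finnu.
  split => //.
  rewrite (eq_eseriesr (g := fun j => (j%:R * fine (mus j A))%:E)); last first.
    by move=> j _; rewrite EFinM finmus.
  have partM n J : (\sum_(0 <= j < J) j%:R * fine (ts_mu (Psi n) j A))%:E =
      (\sum_(0 <= j < J) j%:R%:E * ts_mu (Psi n) j A)%E.
    by rewrite -sumEFin; apply: eq_bigr => j _; rewrite EFinM finmu.
  apply: (ultra_series UU (a := fun n j => j%:R * fine (ts_mu (Psi n) j A))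
    (s := fun n => fine (relay_measure (Psi n) A))).
  - by move=> n j; rewrite mulr_ge0// fine_ge0.
  - by move=> j; apply: cvgM; [exact: cvg_cst|exact: cmu].
  - exact: cM.
  - move=> n J; rewrite -lee_fin partM finM// relayE.
    by apply: nneseries_lim_ge => j _ _; rewrite mule_ge0.
  - move=> e e0; have [J HJ] := tail e e0; exists J => n.
    by rewrite -lee_fin EFinD partM finM//; case: (HJ n A mA).
have rel A : measurable A -> first_moment mus A =
    (\sum_(k < kmax) \sum_(l < k.+1 | (0 < l)%N) marginal l (nus k) A)%E.
  move=> mA; rewrite first_momentE (proj1 (rel' A mA)) -sumEFin; apply: eq_bigr => k _.
  by rewrite -sumEFin; apply: eq_bigr => l _; rewrite finnus.
pose Psis := TrajectorySetting src rec rel.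
have cM : setwise_cvg U (fun n => relay_measure (Psi n)) (relay_measure Psis).
  move=> A mA; have [H1 H2] := rel' A mA.
  by rewrite [X in _ --> fine X]relayE/= [X in _ --> fine X]H1.
have MK' : (relay_measure Psis setT <= (kmax%:R * w)%:E)%E by exact: relayT_le.
have Kw0 : 0 <= kmax%:R * w by rewrite mulr_ge0// /w fine_ge0.
have refK (Psi' : trajectory_setting kmax mu) k :
    (reference_measure Psi' k setT <= (w * (kmax%:R * w) ^+ k)%:E)%E.
  rewrite [leLHS](cons_measureT mu (power_measure (relay_measure Psi') k)) EFinM.
  apply: lee_pmul => //; first by rewrite /w fineK// fin_num_measure.
  exact: (power_measureT_le Kw0 k (relayT_le Psi')).
have limE (k : 'I_kmax) : exists e : R, fine (nu_entropy (Psi n) k) @[n --> U] --> e /\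
    (nu_entropy Psis k <= e%:E)%E.
  pose K := Num.max w (w * (kmax%:R * w) ^+ k).
  have wK : (w%:E <= K%:E)%E by rewrite lee_fin le_max lexx.
  have wK' : ((w * (kmax%:R * w) ^+ k)%:E <= K%:E)%E by rewrite lee_fin le_max lexx orbT.
  apply: (entropy_lsc UU (K := K) (C := C)).
  - by move=> n; exact: le_trans (nuT_le' k n) wK.
  - apply: le_trans wK; rewrite /w fineK ?fin_num_measure//; exact: (nuT_le Psis).
  - by move=> n; exact: le_trans (refK _ _) wK'.
  - exact: le_trans (refK _ _) wK'.
  - by move=> n; exact: EntC.
  - exact: cnu.
  - exact: (setwise_cvg_reference UU Kw0 MK MK' acM cM (n := k)).
have limP j : exists e : R, fine (mu_entropy (Psi n) j) @[n --> U] --> e /\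
    (mu_entropy Psis j <= e%:E)%E.
  have c_ge0 := receiver_weight_ge0 mu j.
  pose K := Num.max w (receiver_weight mu j * w).
  have wK : (w%:E <= K%:E)%E by rewrite lee_fin le_max lexx.
  have wK' : (mscale (NngNum c_ge0) mu setT <= K%:E)%E.
    rewrite /mscale/= -finMu// -EFinM lee_fin le_max lexx orbT//.
  apply: (entropy_lsc UU (K := K) (C := C)
    (rho := fun _ => mscale (NngNum (receiver_weight_ge0 mu j)) mu)).
  - by move=> n; exact: le_trans (muT_le j n) wK.
  - apply: le_trans wK; rewrite /w fineK ?fin_num_measure//; exact: (mu_le Psis).
  - by [].
  - by [].
  - move=> n; apply: le_trans (costC n j); rewrite /mu_cost leeDl// mule_ge0//.
    by rewrite lee_fin mulr_ge0 ?(ltW beta_gt0)// subr_ge0.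
  - exact: cmu.
  - by move=> A mA; exact: cvg_cst.
have [eE HE] := choice limE; have [eP HP] := choice limP.
pose q j := eP j + beta * (eta j - c0) * fine (mus j setT).
have cr : objective_real ft gamma beta c0 (Psi n) @[n --> U] -->
    objective_real ft gamma beta c0 Psis.
  apply: cvgD; last exact: cvg_cst.
  apply: cvgD; last first.
    apply: cvgM; first exact: cvg_cst.
    apply: ultra_cvg_sum => k _.
    apply: (setwise_cvg_integral UU (nuT_le' k) _ (cnu k) (@mft k) (@ftB k)).
    rewrite /w fineK ?fin_num_measure//; exact: (nuT_le Psis).
  apply: cvgB; last exact: cvg_cst.
  apply: cvgM; first exact: cvg_cst.
  apply: cvgB; first exact: cvg_cst.
  apply: ultra_cvg_sum => k _.
  have E (x : {finite_measure set T -> \bar R}) :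
      fine (x setT) ^+ k = fine (power_measure x k setT) by rewrite power_measureTE.
  rewrite E; under eq_fun do rewrite E.
  exact: (setwise_cvg_power UU Kw0 MK MK' acM cM measurableT).
have cv : v + n.+1%:R^-1 @[n --> U] --> v.
  rewrite -[X in _ --> X]addr0; apply: cvgD; first exact: cvg_cst.
  have : @harmonic R @ \oo --> 0 by exact: cvg_harmonic.
  by apply: cvg_trans; apply: cvg_app; exact: HU.
have bound J : \sum_(k < kmax) eE k + \sum_(0 <= j < J) q j
    + objective_real ft gamma beta c0 Psis <= v.
  have finE n k : (fine (nu_entropy (Psi n) k))%:E = nu_entropy (Psi n) k.
    by rewrite fineK// ge0_fin_numE ?nu_entropy_ge0// (le_lt_trans (EntC n k))// ltry.
  have finP n j : (fine (mu_entropy (Psi n) j))%:E = mu_entropy (Psi n) j.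
    rewrite fineK// ge0_fin_numE ?mu_entropy_ge0// (le_lt_trans _ (ltry C))//.
    apply: le_trans (costC n j); rewrite /mu_cost leeDl// mule_ge0//.
    by rewrite lee_fin mulr_ge0 ?(ltW beta_gt0)// subr_ge0.
  have lhs : \sum_(k < kmax) fine (nu_entropy (Psi n) k)
      + \sum_(0 <= j < J) (fine (mu_entropy (Psi n) j)
        + beta * (eta j - c0) * fine (ts_mu (Psi n) j setT))
      + objective_real ft gamma beta c0 (Psi n) @[n --> U] -->
      \sum_(k < kmax) eE k + \sum_(0 <= j < J) q j
      + objective_real ft gamma beta c0 Psis.
    apply: cvgD => //; apply: cvgD.
      by apply: ultra_cvg_sum => k _; case: (HE k).
    apply: ultra_cvg_sum => j _; apply: cvgD; first by case: (HP j).
    by apply: cvgM; [exact: cvg_cst|exact: cmu].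
  apply: (ultra_cvg_le _ lhs cv) => n.
  rewrite -lee_fin; apply: le_trans (HPsi n); rewrite /obj objE !EFinD leeD2r//.
  apply: leeD.
    by rewrite -sumEFin; apply: lee_sum => k _; rewrite finE.
  apply: (@le_trans _ _ (\sum_(0 <= j < J) mu_cost eta beta c0 (Psi n) j)%E).
    rewrite -sumEFin; apply: lee_sum => j _.
    by rewrite EFinD finP EFinM finmu.
  exact: nneseries_lim_ge.
exists Psis; apply/eqP; rewrite eq_le; apply/andP; split; last first.
  by apply: ereal_inf_lbound; exists Psis.
rewrite -/obj -[leRHS](fineK infimum_finite) -/v /obj objE.
have costle j : (mu_cost eta beta c0 Psis j <= (q j)%:E)%E.
  rewrite /mu_cost /q EFinD; apply: leeD; first by case: (HP j).
  by rewrite [leRHS]EFinM finmus.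
have cost0' j : (0 <= mu_cost eta beta c0 Psis j)%E.
  by apply: mu_cost_ge0 => //; exact: ltW.
have Entle : (\sum_(k < kmax) nu_entropy Psis k <= (\sum_(k < kmax) eE k)%:E)%E.
  by rewrite -sumEFin; apply: lee_sum => k _; case: (HE k).
have Costle : (\sum_(0 <= j <oo) mu_cost eta beta c0 Psis j <=
    (v - \sum_(k < kmax) eE k - objective_real ft gamma beta c0 Psis)%:E)%E.
  apply: lime_le; first exact: is_cvg_nneseries.
  apply: nearW => J.
  apply: (@le_trans _ _ (\sum_(0 <= j < J) q j)%:E).
    by rewrite -sumEFin; apply: lee_sum => j _.
  by rewrite lee_fin; have := bound J; lra.
apply: (le_trans (leeD2r _ (leeD Entle Costle))).
by rewrite -!EFinD lee_fin; lra.
Qed.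

End existence.


Section entropy_expansion.
Context d (T : measurableType d) (R : realType) (lam : {measure set T -> \bar R}).
Hypothesis lamoo : (lam setT < +oo)%E.

Lemma Rintegral_sum (I : Type) (r : seq I) (P : pred I) (h : I -> T -> R) D :
  measurable D -> (forall i, P i -> lam.-integrable D (EFin \o h i)) ->
  \int[lam]_(x in D) (\sum_(i <- r | P i) h i x) =
  \sum_(i <- r | P i) \int[lam]_(x in D) h i x.
Proof.
move=> mD ih; elim: r => [|i r IHr].
  by under eq_Rintegral do rewrite big_nil; rewrite big_nil Rintegral_cst// mul0r.
rewrite big_cons; under eq_Rintegral do rewrite big_cons.
have [Pi|Pi//] := boolP (P i); rewrite RintegralD ?IHr//; first exact: ih.
have := integrable_sum mD r ih; apply: eq_integrable => // x _.
by rewrite /= sumEFin.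
Qed.

Variables (u h : T -> R) (dl B : R).
Hypotheses (mu : measurable_fun setT u) (u0 : forall x, 0 <= u x).
Hypotheses (iu : lam.-integrable setT (EFin \o (fun x => ent (u x)))).
Hypotheses (mh : measurable_fun setT h) (hB : forall x, `|h x| <= B).
Hypotheses (dl0 : 0 < dl).

Definition good_direction (u h : R) :=
  h = 0 \/ (dl <= u <= dl^-1) \/ (u = 0 /\ 0 <= h).

Hypothesis guh : forall x, good_direction (u x) (h x).

Let B0 : 0 <= `|B|. Proof. by []. Qed.
Let hB' x : `|h x| <= `|B|.
Proof. by rewrite (le_trans (hB x))// ler_norm. Qed.

Lemma ent_sing_integrable :
  lam.-integrable setT (EFin \o (fun x => ent_sing (u x) (h x))).
Proof.
apply: (bounded_integrable (B := `|B|) lamoo).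
  apply: measurable_fun_ifT => //; apply: measurable_fun_eqr => //; exact: measurable_cst.
by move=> x; rewrite /ent_sing; case: ifP => // _; rewrite normr0.
Qed.

Lemma ent_reg_integrable :
  lam.-integrable setT (EFin \o (fun x => ent_reg (u x) (h x))).
Proof.
apply: (bounded_integrable (B := 1 + B ^+ 2 + `|B| * (`|ln dl| + 1)) lamoo).
  apply: measurable_fun_ifT => //.
  - by apply: measurable_fun_eqr => //; exact: measurable_cst.
  - exact: measurable_ent.
  - apply: measurable_funM => //; apply: measurable_funD; last exact: measurable_cst.
    exact: measurableT_comp.
have s1 : 0 <= B ^+ 2 by rewrite sqr_ge0.
have s2 : 0 <= `|B| * (`|ln dl| + 1) by rewrite mulr_ge0// addr_ge0.
move=> x; have := guh x; rewrite /ent_reg; case: eqP => [ux|/eqP ux].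
  move=> [->|[/andP[]|[_ h0]]].
  - by rewrite ent0 normr0; lra.
  - by rewrite ux leNgt dl0.
  have := ent_ge h0; have := kl_le_sqr h0; rewrite /kl -/(ent _) => H1 H2.
  have hb : h x <= `|B| by rewrite -[leLHS](ger0_norm h0).
  have B2 : `|B| ^+ 2 = B ^+ 2 by rewrite real_normK// num_real.
  by rewrite ler_norml; apply/andP; split; nra.
have up : 0 < u x by rewrite lt0r ux u0.
move=> [->|[/andP[du ud]|[]]]; last by move/eqP; rewrite (negbTE ux).
  by rewrite mul0r normr0; lra.
have : `|ln (u x)| <= `|ln dl|.
  have l1 : ln dl <= ln (u x) by rewrite ler_ln ?posrE.
  have l2 : ln (u x) <= - ln dl by rewrite -lnV ?posrE// ler_ln ?posrE ?invr_gt0.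
  rewrite ler_norml; have := ler_norm (- ln dl); have := ler_norm (ln dl).
  by rewrite normrN => *; apply/andP; split; lra.
move=> lnu; apply: (@le_trans _ _ (`|B| * (`|ln dl| + 1))); last by lra.
rewrite normrM ler_pM// (le_trans (ler_normD _ _))// normr1 lerD2r//.
Qed.

Lemma ent_integral_expansion : exists K, forall e, 0 < e -> e * `|B| <= dl ->
  [/\ forall x, 0 <= u x + e * h x,
      lam.-integrable setT (EFin \o (fun x => ent (u x + e * h x))) &
      `|\int[lam]_x ent (u x + e * h x) - \int[lam]_x ent (u x)
        - (e * ln e * \int[lam]_x ent_sing (u x) (h x)
           + e * \int[lam]_x ent_reg (u x) (h x))| <= K * e ^+ 2].
Proof.
exists ((B ^+ 2 / dl) * fine (lam setT)) => e e0 eB.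
have ex x := @ent_expansion R dl (u x) (h x) e dl0 (u0 x) e0.
have ehx x : e * `|h x| <= dl by rewrite (le_trans _ eB)// ler_wpM2l// ltW.
have guh' x : h x = 0 \/ dl <= u x \/ u x = 0 /\ 0 <= h x.
  by case: (guh x) => [->|[/andP[]|]]; [left|right; left|right; right].
pose F x := ent (u x + e * h x) - ent (u x)
  - (e * ln e * ent_sing (u x) (h x) + e * ent_reg (u x) (h x)).
have is_ := ent_sing_integrable; have ir := ent_reg_integrable.
have ise : lam.-integrable setT (EFin \o (fun x => e * ln e * ent_sing (u x) (h x))).
  by have := integrableZl measurableT (e * ln e) is_; apply: eq_integrable.
have ire : lam.-integrable setT (EFin \o (fun x => e * ent_reg (u x) (h x))).
  by have := integrableZl measurableT e ir; apply: eq_integrable.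
have isr := integrableD measurableT ise ire.
have mue : measurable_fun setT (fun x => ent (u x + e * h x)).
  apply: measurable_ent; apply: measurable_funD => //.
  by apply: measurable_funM => //; exact: measurable_cst.
have FB x : `|F x| <= B ^+ 2 / dl * e ^+ 2.
  have [_ /le_trans] := ex x (ehx x) (guh' x); apply.
  rewrite mulrC ler_wpM2r ?sqr_ge0// ler_wpM2r ?invr_ge0 ?(ltW dl0)//.
  by rewrite -(real_normK (num_real (h x))) -(real_normK (num_real B)) lerXn2r ?nnegrE.
have mF : measurable_fun setT F.
  apply: measurable_funB.
    by apply: measurable_funB => //; exact: measurable_ent.
  by have := measurable_int _ isr => /measurable_EFinP.
have iF := bounded_integrable lamoo mF FB.
have iue : lam.-integrable setT (EFin \o (fun x => ent (u x + e * h x))).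
  have := integrableD measurableT (integrableD measurableT iF iu) isr.
  apply: eq_integrable => // x _; rewrite /= -!EFinD; congr EFin.
  by rewrite /F; ring.
split => //; first by move=> x; case: (ex x (ehx x) (guh' x)).
rewrite -RintegralZl// -RintegralZl// -RintegralD// -RintegralB//.
rewrite -RintegralB//; last exact: (integrableB measurableT iue iu).
apply: (le_trans (le_normr_Rintegral measurableT iF)).
rewrite mulrAC -Rintegral_cst//; apply: le_Rintegral => //.
- exact: (integrable_norm iF).
- apply: (bounded_integrable lamoo (B := `|B ^+ 2 / dl * e ^+ 2|)) => //.
Qed.

End entropy_expansion.


Section relay_integral.
Context d (T : measurableType d) (R : realType) (kmax : nat).
Variable (mu : {finite_measure set T -> \bar R}).
Variable Psi : trajectory_setting kmax mu.

Let M : {finite_measure set T -> \bar R} := relay_measure Psi.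

Lemma marginal_le_relay (k : 'I_kmax) (l : 'I_k.+1) A : (0 < l)%N -> measurable A ->
  (marginal l (ts_nu Psi k) A <= M A)%E.
Proof.
move=> l0 mA; rewrite /M /= /relay_measure ts_relays// (bigD1 k)//= (bigD1 l)//= -addeA leeDl//.
rewrite adde_ge0//; apply: sume_ge0 => i _; first exact: (measure_ge0 (ts_nu Psi k)).
by apply: sume_ge0 => j _; exact: (measure_ge0 (ts_nu Psi i)).
Qed.

Lemma relay_integral (h : T -> R) : measurable_fun setT h ->
  M.-integrable setT (EFin \o h) ->
  (forall (k : 'I_kmax) (l : 'I_k.+1), (0 < l)%N ->
    (ts_nu Psi k).-integrable setT (EFin \o (fun t => h (tnth t l)))) /\
  \int[M]_x h x =
    \sum_(k < kmax) \sum_(l < k.+1 | (0 < l)%N) \int[ts_nu Psi k]_t h (tnth t l).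
Proof.
move=> mh ih.
have nuoo (k : 'I_kmax) : (ts_nu Psi k setT < +oo)%E by rewrite -ge0_fin_numE// fin_num_measure.
have mt (k : 'I_kmax) (l : 'I_k.+1) := @measurable_tnth _ T k.+1 l.
pose marg (k : 'I_kmax) (l : 'I_k.+1) := push_finite_measure measurableT (mt k l) (nuoo k).
have margE (k : 'I_kmax) (l : 'I_k.+1) A : marg k l A = marginal l (ts_nu Psi k) A.
  by rewrite /marg /= /push_restr setIT.
have /choice[p Hp] : forall kl : {k : 'I_kmax & 'I_k.+1}, exists p : T -> R,
    [/\ measurable_fun setT p, forall x, 0 <= p x <= 1 &
      (0 < tagged kl)%N -> is_density M (marg (tag kl) (tagged kl)) p].
  move=> [k l]; have [l0|l0] := boolP (0 < l)%N; last first.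
    by exists (cst 0); split=> [|x|]; [exact: measurable_cst|rewrite lexx ler01|by move=> l0'; case/negP: l0].
  have [|p [dp p1]] := @is_density_bounded _ T R M (marg k l) 1 ler01.
    by move=> A mA; rewrite mul1e margE marginal_le_relay.
  by exists p; have [mp p0 _] := dp; split => // x; rewrite p0 p1.
pose pp (k : 'I_kmax) (l : 'I_k.+1) := p (Tagged (fun k : 'I_kmax => 'I_k.+1) l).
have dpp (k : 'I_kmax) (l : 'I_k.+1) : (0 < l)%N -> is_density M (marg k l) (pp k l).
  by move=> l0; case: (Hp (Tagged (fun k : 'I_kmax => 'I_k.+1) l)) => _ _; exact.
have pp1 (k : 'I_kmax) (l : 'I_k.+1) x : 0 <= pp k l x <= 1.
  by have [_ H _] := Hp (Tagged (fun k : 'I_kmax => 'I_k.+1) l); exact: H.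
have mpp (k : 'I_kmax) (l : 'I_k.+1) : measurable_fun setT (pp k l).
  by have [H _ _] := Hp (Tagged (fun k : 'I_kmax => 'I_k.+1) l); exact: H.
have ihp (k : 'I_kmax) (l : 'I_k.+1) :
    M.-integrable setT (EFin \o (fun x => h x * pp k l x)).
  apply: (le_integrable measurableT _ _ ih).
    by apply/measurable_EFinP; apply: measurable_funM => //; exact: mpp.
  move=> x _; rewrite /= lee_fin normrM ler_piMr//.
  by have /andP[p0 p1] := pp1 k l x; rewrite ger0_norm.
have ihm (k : 'I_kmax) (l : 'I_k.+1) : (0 < l)%N ->
    (marg k l).-integrable setT (EFin \o h).
  by move=> l0; apply/(is_density_integrable_fun (dpp k l l0) mh); exact: ihp.
have absE (k : 'I_kmax) (l : 'I_k.+1) (f : T -> \bar R) : measurable_fun setT f ->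
    (forall x, 0 <= f x)%E ->
    (\int[marg k l]_x f x = \int[ts_nu Psi k]_t f (tnth t l))%E.
  move=> mf f0.
  rewrite (eq_measure_integral (pushforward (ts_nu Psi k) (fun t => tnth t l))).
  - exact: mt.
  - by move=> mtl; rewrite ge0_integral_pushforward// => x _; exact: f0.
  - by move=> mtl A mA _; exact: margE.
have inu (k : 'I_kmax) (l : 'I_k.+1) : (0 < l)%N ->
    (ts_nu Psi k).-integrable setT (EFin \o (fun t => h (tnth t l))).
  move=> l0; apply/integrableP; split.
    by apply/measurable_EFinP; apply: measurableT_comp => //; exact: mt.
  rewrite -(absE k l (fun x => `|(h x)%:E|%E))//.
    by case/integrableP: (ihm k l l0).
  by apply: measurableT_comp => //; exact/measurable_EFinP.
have Rnu (k : 'I_kmax) (l : 'I_k.+1) : (0 < l)%N ->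
    \int[ts_nu Psi k]_t h (tnth t l) = \int[M]_x (h x * pp k l x).
  move=> l0; rewrite -(is_density_Rintegral (dpp k l l0) mh (ihm k l l0)).
  congr fine; apply/esym.
  rewrite (eq_measure_integral (pushforward (ts_nu Psi k) (fun t => tnth t l))).
  - exact: mt.
  - by move=> mtl; rewrite integral_pushforward//; [exact/measurable_EFinP|exact: inu].
  - by move=> mtl A mA _; exact: margE.
split => //.
pose s x := \sum_(k < kmax) \sum_(l < k.+1 | (0 < l)%N) pp k l x.
have s0 x : 0 <= s x.
  by apply: sumr_ge0 => k _; apply: sumr_ge0 => l _; case/andP: (pp1 k l x).
have sl (k : 'I_kmax) : measurable_fun setT (fun x => \sum_(l < k.+1 | (0 < l)%N) pp k l x).
  under eq_fun do rewrite big_mkcond/=.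
  apply: measurable_sum => l; case: (0 < l)%N; [exact: mpp|exact: measurable_cst].
have ms : measurable_fun setT s by apply: measurable_sum.
have ds : is_density M M s.
  split => // A mA.
  transitivity (\sum_(k < kmax) \sum_(l < k.+1 | (0 < l)%N) marginal l (ts_nu Psi k) A)%E.
    exact: ts_relays.
  under [RHS]eq_integral do rewrite -sumEFin.
  rewrite ge0_integral_sum//; last 2 first.
  - by move=> k; apply/measurable_EFinP; exact: measurable_funTS.
  - move=> k x _; rewrite lee_fin; apply: sumr_ge0 => l _; by case/andP: (pp1 k l x).
  apply: eq_bigr => k _.
  under [RHS]eq_integral do rewrite big_mkcond -sumEFin.
  rewrite ge0_integral_sum//; last 2 first.
  - move=> l; apply/measurable_EFinP; apply: measurable_funTS.
    case: (0 < l)%N; [exact: mpp|exact: measurable_cst].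
  - by move=> l x _; rewrite lee_fin; case: ifP => // _; case/andP: (pp1 k l x).
  rewrite big_mkcond; apply: eq_bigr => l _; case: ifPn => l0; last by rewrite integral0.
  by rewrite -margE; case: (dpp k l l0) => _ _ ->.
have s1 : {ae M, forall x, s x = 1}.
  apply: (ae_density_eq ds); split => // A mA.
  by rewrite integral_EFin_cst// mul1e.
transitivity (\int[M]_x (\sum_(k < kmax) \sum_(l < k.+1 | (0 < l)%N) (h x * pp k l x))).
  congr fine; apply: ae_eq_integral => //.
  - exact/measurable_EFinP.
  - apply/measurable_EFinP; apply: measurable_sum => k; under eq_fun do rewrite -mulr_sumr.
    exact: measurable_funM.
  - apply: filterS s1 => x sx _; congr EFin; under eq_bigr do rewrite -mulr_sumr.
    by rewrite -mulr_sumr -/(s x) sx mulr1.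
have Moo : (M setT < +oo)%E by rewrite -ge0_fin_numE// fin_num_measure.
have isum (k : 'I_kmax) : M.-integrable setT
    (EFin \o (fun x => \sum_(l < k.+1 | (0 < l)%N) (h x * pp k l x))).
  have := integrable_sum measurableT (index_enum 'I_k.+1) (P := fun l : 'I_k.+1 => (0 < l)%N)
    (fun l _ => ihp k l).
  by apply: eq_integrable => // x _; rewrite /= sumEFin.
rewrite Rintegral_sum//; apply: eq_bigr => k _.
by rewrite Rintegral_sum//; apply: eq_bigr => l l0; rewrite Rnu.
Qed.


End relay_integral.


Lemma measurable_funV d (T : measurableType d) (R : realType) (f : T -> R) :
  measurable_fun setT f -> (forall x, 0 <= f x) -> measurable_fun setT (fun x => (f x)^-1).
Proof.
move=> mf f0; under eq_fun do rewrite -powR_inv1//.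
exact: measurableT_comp (measurable_powR _) mf.
Qed.

Section entropy_formula.
Context d (T : measurableType d) (R : realType) (kmax : nat).
Variable (mu : {finite_measure set T -> \bar R}).
Variable Psi : trajectory_setting kmax mu.
Variable m : T -> R.
Hypothesis dm : is_density mu (relay_measure Psi) m.
Variables (k : 'I_kmax) (n : k.+1.-tuple T -> R).
Hypothesis dn : is_density (power_measure mu k.+1) (ts_nu Psi k) n.

Local Notation lam := (power_measure mu k.+1).

Let P (t : k.+1.-tuple T) := \prod_(l < k.+1 | (0 < l)%N) m (tnth t l).
Let Lm (t : k.+1.-tuple T) := \sum_(l < k.+1 | (0 < l)%N) ln (m (tnth t l)).

Let m0 x : 0 <= m x. Proof. by case: dm. Qed.
Let mm : measurable_fun setT m. Proof. by case: dm. Qed.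
Let n0 t : 0 <= n t. Proof. by case: dn. Qed.
Let mn : measurable_fun setT n. Proof. by case: dn. Qed.
Let mP : measurable_fun setT P.
Proof. exact: measurable_prod_tnth mm. Qed.
Let P0 t : 0 <= P t. Proof. exact: prodr_ge0. Qed.

Let in_ : lam.-integrable setT (EFin \o n).
Proof. exact: is_density_integrable dn. Qed.

Lemma nu_density_eq0 (l : 'I_k.+1) : (0 < l)%N ->
  {ae lam, forall t, m (tnth t l) = 0 -> n t = 0}.
Proof.
move=> l0; pose N := (fun t : k.+1.-tuple T => tnth t l) @^-1` [set x | m x == 0].
have mN0 : measurable [set x | m x == 0].
  by apply: measurable_bool_set; apply: measurable_fun_eqr => //; exact: measurable_cst.
have mN : measurable N by exact: measurable_preimage_tnth.
have nuN : ts_nu Psi k N = 0%E.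
  apply/eqP; rewrite eq_le measure_ge0 andbT.
  apply: (le_trans (marginal_le_relay Psi l0 mN0)).
  case: dm => _ _ H; have E := H _ mN0.
  rewrite le_eqVlt; apply/orP; left; apply/eqP; transitivity
    (\int[mu]_(x in [set x | (m x == 0)%R]) (m x)%:E)%E; first exact: E.
  by apply: integral0_eq => x /= /eqP ->.
have : ae_eq lam N (EFin \o n) (cst 0%E).
  apply/ae_eq_integral_abs => //; first by apply/measurable_EFinP; exact: measurable_funTS.
  rewrite -[RHS]nuN; case: dn => _ _ H; rewrite [RHS](H _ mN).
  by apply: eq_integral => t _; rewrite gee0_abs// lee_fin.
apply: filterS => t H mt; apply: EFin_inj; apply: H.
by rewrite /N/= mt.
Qed.

Let nP0 : {ae lam, forall t, P t = 0 -> n t = 0}.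
Proof.
have : {ae lam, forall t, forall l : 'I_k.+1, (0 < l)%N -> m (tnth t l) = 0 -> n t = 0}.
  apply: filter_forall => l; have [l0|l0] := boolP (0 < l)%N.
    by apply: filterS (nu_density_eq0 l0) => t H _.
  by apply: aeW => t.
apply: filterS => t H /eqP; rewrite /P prodf_seq_eq0 => /hasP[l _ /andP[l0 /eqP ml]].
exact: H l0 ml.
Qed.

Let kernel_eq : {ae lam, forall t,
  kl (n t / P t) * P t = ent (n t) - n t * Lm t - n t + P t}.
Proof.
apply: filterS nP0 => t H; have [Pt|Pt] := eqVneq (P t) 0.
  by rewrite Pt (H Pt) !mul0r mulr0 ent0; ring.
have ln_P : 0 < P t /\ ln (P t) = Lm t.
  apply: (big_ind2 (fun x y => 0 < x /\ ln x = y)).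
  - by rewrite ln1.
  - by move=> x1 x2 y1 y2 [x10 <-] [y10 <-]; rewrite mulr_gt0// lnM.
  - move=> l l0; split => //; rewrite lt0r m0 andbT.
    apply: contra Pt => /eqP ml; rewrite /P (bigD1 l)//= ml mul0r//.
case: ln_P => Pt0 lnP; rewrite -lnP /kl /ent.
have [->|nt] := eqVneq (n t) 0; first by rewrite !mul0r; ring.
have nt0 : 0 < n t by rewrite lt0r nt n0.
rewrite lnM ?posrE ?invr_gt0// lnV ?posrE//; field.
by [].
Qed.

Lemma is_density_nu_reference :
  is_density (reference_measure Psi k) (ts_nu Psi k) (fun t => n t / P t).
Proof.
have nP_ge0 t : 0 <= n t / P t by rewrite divr_ge0.
have mnP : measurable_fun setT (fun t => n t / P t).
  by apply: measurable_funM => //; exact: measurable_funV.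
have mPE : measurable_fun setT (EFin \o P) by exact/measurable_EFinP.
split => [//|//|A mA].
rewrite integral_mkcond.
have E : (\int[reference_measure Psi k]_t ((fun t => (n t / P t)%:E) \_ A) t =
    \int[lam]_t (((fun t => (n t / P t)%:E) \_ A) t * (P t)%:E))%E.
  apply: (integral_reference_density dm).
    apply/measurable_restrict => //; apply: measurable_funTS; exact/measurable_EFinP.
  by move=> t; rewrite patchE; case: ifP => // _; rewrite lee_fin.
rewrite E; case: dn => _ _ H; rewrite (H _ mA) integral_mkcond.
have mr (f : k.+1.-tuple T -> R) : measurable_fun setT f ->
    measurable_fun setT ((fun t => (f t)%:E) \_ A).
  move=> mf; apply/(measurable_restrict _ mA measurableT).
  by apply: measurable_funTS; exact/measurable_EFinP.
apply: ae_eq_integral.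
- exact: measurableT.
- exact: mr mn.
- exact: (emeasurable_funM (mr _ mnP) mPE).
apply: filterS nP0 => t H0 _; rewrite !patchE; case: ifP => _; last exact: (esym (mul0e _)).
rewrite -EFinM; congr EFin; have [Pt|Pt] := eqVneq (P t) 0; last exact: (esym (divfK _ _)).
rewrite (H0 Pt) Pt; exact: (esym (mulr0 _)).
Qed.

Lemma nu_entropy_kl :
  nu_entropy Psi k = (\int[lam]_t (kl (n t / P t) * P t)%:E)%E.
Proof.
rewrite /nu_entropy (entropy_density is_density_nu_reference); last exact: reference_measureT_lty.
have mk : measurable_fun setT (fun t => (kl (n t / P t))%:E).
  by apply/measurable_EFinP/measurable_kl/measurable_funM => //; exact: measurable_funV.
rewrite [LHS](integral_reference_density dm mk); last first.
  by move=> t; rewrite lee_fin kl_ge0// divr_ge0.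
by apply: eq_integral => t _; rewrite EFinM.
Qed.

Hypothesis iem : mu.-integrable setT (EFin \o (fun x => ent (m x))).

Lemma ln_relay_integrable :
  (relay_measure Psi).-integrable setT (EFin \o (fun x => ln (m x))).
Proof.
apply/(is_density_integrable_fun dm); first exact: measurableT_comp.
by apply: eq_integrable iem => // x _; rewrite /= /ent mulrC.
Qed.

Let mlnm : measurable_fun setT (fun x => ln (m x)).
Proof. exact: measurableT_comp. Qed.

Let inu (l : 'I_k.+1) : (0 < l)%N ->
  (ts_nu Psi k).-integrable setT (EFin \o (fun t => ln (m (tnth t l)))).
Proof. by move=> l0; case: (relay_integral mlnm ln_relay_integrable) => H _; exact: H. Qed.

Let iLm : (ts_nu Psi k).-integrable setT (EFin \o Lm).
Proof.
have mt (l : 'I_k.+1) := @measurable_tnth _ T k.+1 l.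
have il (l : 'I_k.+1) : (ts_nu Psi k).-integrable setT
    (EFin \o (fun t => if (0 < l)%N then ln (m (tnth t l)) else 0)).
  have [l0|l0] := boolP (0 < l)%N; first exact: inu.
  exact: finite_measure_integrable_cst.
have := integrable_sum measurableT (index_enum 'I_k.+1) (P := predT) (fun l _ => il l).
by apply: eq_integrable => // t _; rewrite /= sumEFin /Lm [in RHS]big_mkcond.
Qed.

Let mLm : measurable_fun setT Lm.
Proof. by apply/measurable_EFinP; exact: measurable_int iLm. Qed.

Let inLm : lam.-integrable setT (EFin \o (fun t => n t * Lm t)).
Proof.
have := (is_density_integrable_fun dn mLm).1 iLm.
by apply: eq_integrable => // t _; rewrite /= mulrC.
Qed.

Let iP : lam.-integrable setT (EFin \o P).
Proof.
apply/integrableP; split; first exact/measurable_EFinP.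
have [_ _ H] := is_density_reference k dm.
under eq_integral do rewrite gee0_abs ?lee_fin//.
have := reference_measureT_lty Psi k; apply: le_lt_trans.
by rewrite le_eqVlt; apply/orP; left; apply/eqP; exact: (esym (H _ measurableT)).
Qed.

Let iQ : lam.-integrable setT (EFin \o (fun t => n t * Lm t + n t - P t)).
Proof. exact: (integrableB measurableT (integrableD measurableT inLm in_) iP). Qed.

Let mK : measurable_fun setT (fun t => kl (n t / P t) * P t).
Proof.
apply: measurable_funM => //; apply: measurable_kl; apply: measurable_funM => //.
exact: measurable_funV.
Qed.

Let K0 t : 0 <= kl (n t / P t) * P t.
Proof. by rewrite mulr_ge0// kl_ge0// divr_ge0. Qed.

Lemma ent_nu_integrable : (nu_entropy Psi k < +oo)%E ->
  lam.-integrable setT (EFin \o (fun t => ent (n t))).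
Proof.
rewrite nu_entropy_kl => Koo.
have iK : lam.-integrable setT (EFin \o (fun t => kl (n t / P t) * P t)).
  apply/integrableP; split; first exact/measurable_EFinP.
  by under eq_integral do rewrite gee0_abs ?lee_fin//.
have iKQ := integrableD measurableT iK iQ.
have men : measurable_fun setT (fun t => ent (n t)) by exact: measurable_ent.
apply/integrableP; split; first exact/measurable_EFinP.
have /integrableP[mKQ] := iKQ; apply: le_lt_trans.
rewrite le_eqVlt; apply/orP; left; apply/eqP; apply: ae_eq_integral => //.
- by apply: measurableT_comp => //; exact/measurable_EFinP.
- exact: measurableT_comp.
- apply: filterS kernel_eq => t E _.
  change (`|(ent (n t))%:E| =
    `|(kl (n t / P t) * P t + (n t * Lm t + n t - P t))%:E|)%E.
  by rewrite E; congr (`|_%:E|)%E; ring.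
Qed.

Lemma nu_entropy_real : lam.-integrable setT (EFin \o (fun t => ent (n t))) ->
  nu_entropy Psi k = (\int[lam]_t ent (n t)
    - \sum_(l < k.+1 | (0 < l)%N) \int[ts_nu Psi k]_t ln (m (tnth t l))
    - fine (ts_nu Psi k setT)
    + fine (mu setT) * fine (relay_measure Psi setT) ^+ k)%:E.
Proof.
move=> ien; rewrite nu_entropy_kl.
have iF := integrableB measurableT ien iQ.
transitivity (\int[lam]_t (ent (n t) - (n t * Lm t + n t - P t))%:E)%E.
  apply: ae_eq_integral => //.
  - exact/measurable_EFinP.
  - exact: measurable_int iF.
  - by apply: filterS kernel_eq => t E _; rewrite E; congr EFin; ring.
have F1 := integrable_fin_num measurableT iF.
rewrite -[LHS](fineK F1); congr EFin.
transitivity (\int[lam]_t (ent (n t) - (n t * Lm t + n t - P t))) => //.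
rewrite RintegralB// RintegralB//; last exact: (integrableD measurableT inLm in_).
rewrite RintegralD//.
have -> : \int[lam]_t n t = fine (ts_nu Psi k setT).
  by case: dn => _ _ H; rewrite (H _ measurableT).
have -> : \int[lam]_t P t = fine (mu setT) * fine (relay_measure Psi setT) ^+ k.
  have [_ _ H] := is_density_reference k dm.
  transitivity (fine (reference_measure Psi k setT)).
    exact: (congr1 fine (esym (H _ measurableT))).
  transitivity (fine (mu setT * power_measure (relay_measure Psi) k setT)%E).
    exact: (congr1 fine (cons_measureT mu (power_measure (relay_measure Psi) k))).
  rewrite fineM ?fin_num_measure//; last exact: power_measure_finite.
  by congr (_ * _); rewrite power_measureTE.
have -> : \int[lam]_t (n t * Lm t) = \int[ts_nu Psi k]_t Lm t.
  by rewrite (is_density_Rintegral dn mLm iLm); apply: eq_Rintegral => t _; rewrite mulrC.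
by rewrite Rintegral_sum//; ring.
Qed.

End entropy_formula.


Section energy_formula.
Context d (T : measurableType d) (R : realType) (kmax : nat).
Variable (mu : {finite_measure set T -> \bar R}).
Variables (ft : forall k : 'I_kmax, k.+1.-tuple T -> R) (eta : nat -> R).
Variables (gamma beta c0 Bf : R).
Hypothesis mu_gt0 : (0 < mu setT)%E.
Hypothesis mft : forall k, measurable_fun setT (@ft k).
Hypothesis ftB : forall k x, `|@ft k x| <= Bf.
Implicit Type Psi : trajectory_setting kmax mu.
Implicit Types (n : forall k : 'I_kmax, k.+1.-tuple T -> R) (g : nat -> T -> R) (m : T -> R).

Record entropic_density Psi n g m : Prop := EntropicDensity {
  ed_setting : setting_density Psi n g;
  ed_relay : is_density mu (relay_measure Psi) m;
  ed_nu : forall k : 'I_kmax,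
    (power_measure mu k.+1).-integrable setT (EFin \o (fun t => ent (n k t)));
  ed_mu : forall j, mu.-integrable setT (EFin \o (fun x => ent (g j x)));
  ed_m : mu.-integrable setT (EFin \o (fun x => ent (m x)))
}.

Definition receiver_potential j : R := beta * (eta j - c0) - ln (receiver_weight mu j) - 1.

Lemma mu_cost_real Psi n g m j : entropic_density Psi n g m ->
  mu_cost eta beta c0 Psi j = (\int[mu]_x ent (g j x)
    + receiver_potential j * \int[mu]_x g j x
    + receiver_weight mu j * fine (mu setT))%:E.
Proof.
move=> [[_ dg] _ _ ieg _]; have [mg g0 H] := dg j.
have c_gt0 := receiver_weight_gt0 mu_gt0 j; set c := receiver_weight mu j in c_gt0 *.
have ig := is_density_integrable (dg j).
have muoo : (mu setT < +oo)%E by rewrite -ge0_fin_numE// fin_num_measure.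
have muE : (ts_mu Psi j setT = (\int[mu]_x g j x)%:E)%E.
  by rewrite H// /Rintegral fineK// integrable_fin_num.
have ic : mu.-integrable setT (EFin \o (fun=> c)) by exact: finite_measure_integrable_cst.
have icg : mu.-integrable setT (EFin \o (fun x => (- ln c - 1) * g j x)).
  by have := integrableZl measurableT (- ln c - 1) ig; apply: eq_integrable.
have iS := integrableD measurableT (integrableD measurableT (ieg j) icg) ic.
rewrite /mu_cost (mu_entropyE mu_gt0 (dg j)) muE -/c.
have -> : (\int[mu]_x (c * kl (g j x / c))%:E =
    (\int[mu]_x (ent (g j x) + (- ln c - 1) * g j x + c))%:E)%E.
  rewrite /Rintegral fineK; last exact: integrable_fin_num iS.
  apply: eq_integral => x _; congr EFin; rewrite /kl /ent.
  have [->|gx] := eqVneq (g j x) 0; first by rewrite !mul0r; ring.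
  have gx0 : 0 < g j x by rewrite lt0r gx g0.
  rewrite lnM ?posrE ?invr_gt0// lnV ?posrE//; field.
  by rewrite gt_eqF.
rewrite RintegralD//; last exact: (integrableD measurableT (ieg j) icg).
rewrite RintegralD// RintegralZl// Rintegral_cst// -EFinM -EFinD; congr EFin.
by rewrite /receiver_potential -/c; ring.
Qed.

Lemma nu_energy_real Psi n g m : entropic_density Psi n g m ->
  (\sum_(k < kmax) nu_entropy Psi k + (objective_real ft gamma beta c0 Psi)%:E)%E =
  (\sum_(k < kmax) (\int[power_measure mu k.+1]_t ent (n k t) +
       gamma * \int[power_measure mu k.+1]_t (ft t * n k t))
   - \int[mu]_x ent (m x) - (expR 1)^-1 + beta * (c0 * fine (mu setT)))%:E.
Proof.
move=> [[dn _] dm ien _ iem].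
have mm : measurable_fun setT m by case: dm.
have mlnm : measurable_fun setT (fun x => ln (m x)) by exact: measurableT_comp.
have ilnm := ln_relay_integrable dm iem.
have [_ HM] := relay_integral mlnm ilnm.
under eq_bigr => k _ do rewrite (nu_entropy_real dm (dn k) iem (ien k)).
rewrite sumEFin -EFinD; congr EFin; rewrite /objective_real.
have ifn (k : 'I_kmax) := is_density_Rintegral (dn k) (@mft k) (ft_integrable mft ftB Psi k).
under [X in _ + gamma * X + _]eq_bigr => k _ do rewrite (ifn k).
have EM : \int[mu]_x ent (m x) = \int[relay_measure Psi]_x ln (m x).
  rewrite (is_density_Rintegral dm mlnm ilnm).
  by apply: eq_Rintegral => x _; rewrite /ent mulrC.
rewrite EM HM !big_split/= !sumrN sum_nuT -!mulr_sumr; ring.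
Qed.

End energy_formula.


Section entropic_density_exists.
Context d (T : measurableType d) (R : realType) (kmax : nat).
Variable (mu : {finite_measure set T -> \bar R}).
Hypothesis mu_gt0 : (0 < mu setT)%E.
Implicit Type Psi : trajectory_setting kmax mu.
Implicit Types (n : forall k : 'I_kmax, k.+1.-tuple T -> R) (g : nat -> T -> R) (m : T -> R).

Lemma receivers_ae Psi g : (forall j, is_density mu (ts_mu Psi j) (g j)) ->
  {ae mu, forall x, (\sum_(0 <= j <oo) (g j x)%:E = 1)%E}.
Proof.
move=> dg; have g0 j x : (0 <= (g j x)%:E)%E by case: (dg j) => _ H _; rewrite lee_fin.
have mg j : measurable_fun setT (fun x => (g j x)%:E).
  by apply/measurable_EFinP; case: (dg j).
have H : ae_eq mu setT (cst 1%E) (fun x => (\sum_(0 <= j <oo) (g j x)%:E)%E).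
  apply: integral_ae_eq => //.
  - exact: finite_measure_integrable_cst.
  - by apply: ge0_emeasurable_sum => // j x _ _; exact: g0.
  move=> A _ mA; transitivity (mu A); first by rewrite integral_cst// mul1e.
  rewrite -[LHS](ts_receivers Psi mA).
  rewrite integral_nneseries//; last by move=> j; exact: measurable_funTS.
  by apply: eq_eseriesr => j _; case: (dg j) => _ _ ->.
by apply: filterS H => x /(_ I) <-.
Qed.

Lemma relays_ae Psi g m : (forall j, is_density mu (ts_mu Psi j) (g j)) ->
  is_density mu (relay_measure Psi) m ->
  {ae mu, forall x, (\sum_(0 <= j <oo) (j%:R * g j x)%:E = (m x)%:E)%E}.
Proof.
move=> dg dm.
have g0 j x : (0 <= (j%:R * g j x)%:E)%E.
  by case: (dg j) => _ H _; rewrite lee_fin mulr_ge0.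
have mg j : measurable_fun setT (fun x => (j%:R * g j x)%:E).
  by apply/measurable_EFinP/measurable_funM; [exact: measurable_cst|case: (dg j)].
have H : ae_eq mu setT (EFin \o m) (fun x => (\sum_(0 <= j <oo) (j%:R * g j x)%:E)%E).
  apply: integral_ae_eq => //.
  - exact: is_density_integrable dm.
  - by apply: ge0_emeasurable_sum => // j x _ _; exact: g0.
  move=> A _ mA; have [_ _ Hm] := dm; transitivity (relay_measure Psi A); first exact: (esym (Hm _ mA)).
  rewrite integral_nneseries//; last by move=> j; exact: measurable_funTS.
  rewrite relayE; apply: eq_eseriesr => j _; case: (dg j) => mgj gj0 ->//.
  rewrite -ge0_integralZl//; first by apply/measurable_EFinP; exact: measurable_funTS.
  by move=> x _; rewrite lee_fin.
by apply: filterS H => x /(_ I) <-.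
Qed.

(* Young's inequality for kl against the Poisson law with parameter y. *)
Lemma poisson_ln_le (y : R) (b : nat -> R) : 1 <= y -> (forall j, 0 <= b j) ->
  (\sum_(0 <= j <oo) (b j)%:E = 1)%E ->
  (\sum_(0 <= j <oo) (j%:R * b j)%:E = y%:E)%E ->
  ((ent y)%:E <= \sum_(0 <= j <oo)
     (receiver_weight mu j * kl (b j / receiver_weight mu j))%:E
   + (1 + (1 + `|ln (expR 1 * fine (mu setT))|) * y)%:E)%E.
Proof.
move=> y1 b0 sb sjb; set a := expR 1 * fine (mu setT).
have a0 : 0 < a by rewrite mulr_gt0 ?expR_gt0 ?muW_gt0.
have y0 : 0 < y by lra.
have lny0 : 0 <= ln y by exact: ln_ge0.
pose p j := expR (- y) * (y ^+ j / j`!%:R).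
have p0 j : 0 <= p j by rewrite mulr_ge0 ?expR_ge0// divr_ge0// exprn_ge0// ltW.
have sp : (\sum_(0 <= j <oo) (p j)%:E = 1)%E.
  transitivity ((expR (- y))%:E * \sum_(0 <= j <oo) (y ^+ j / j`!%:R)%:E)%E.
    rewrite -nneseriesZl; last by move=> j _; rewrite lee_fin divr_ge0// exprn_ge0// ltW.
    by apply: eq_eseriesr => j _.
  by rewrite nneseries_exp ?(ltW y0)// -EFinM -expRD addNr expR0.
pose K j := receiver_weight mu j * kl (b j / receiver_weight mu j).
have c_gt0 := receiver_weight_gt0 mu_gt0.
have K0 j : 0 <= K j by rewrite mulr_ge0 ?(ltW (c_gt0 j))// kl_ge0// divr_ge0// ltW.
have term j : ln y * (j%:R * b j) <= K j + (p j + (y * b j + `|ln a| * (j%:R * b j))).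
  have := @kl_young R (b j / receiver_weight mu j)
    (j%:R * ln y + j%:R * ln a - y + a^-1) (divr_ge0 (b0 j) (ltW (c_gt0 j))).
  rewrite -(ler_pM2l (c_gt0 j)) -/(K j).
  have -> : expR (j%:R * ln y + j%:R * ln a - y + a^-1) = p j / receiver_weight mu j.
    rewrite /p /receiver_weight -/a !expRD expRN !expRM_natl !lnK ?posrE//.
    rewrite expRN; field; rewrite ?gt_eqF ?expR_gt0 ?exprn_gt0 ?ltr0n ?fact_gt0//.
  have -> : receiver_weight mu j * (b j / receiver_weight mu j *
      (j%:R * ln y + j%:R * ln a - y + a^-1) - (p j / receiver_weight mu j - 1)) =
      b j * (j%:R * ln y + j%:R * ln a - y + a^-1) - p j + receiver_weight mu j.
    field; by rewrite (lt0r_neq0 (c_gt0 j)) (lt0r_neq0 a0).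
  have h1 : 0 <= b j * a^-1 by rewrite mulr_ge0// invr_ge0 ltW.
  have h2 : - (`|ln a| * (j%:R * b j)) <= ln a * (j%:R * b j).
    by rewrite -mulNr ler_wpM2r ?mulr_ge0// lerNnormlW.
  have := c_gt0 j; nra.
rewrite /ent mulrC EFinM -{1}sjb -nneseriesZl; last by move=> j _; rewrite lee_fin mulr_ge0.
apply: (@le_trans _ _ (\sum_(0 <= j <oo)
    ((K j)%:E + ((p j)%:E + (y%:E * (b j)%:E + `|ln a|%:E * (j%:R * b j)%:E))))%E).
  apply: lee_nneseries => [j _ _|j _]; first by rewrite -EFinM lee_fin !mulr_ge0.
  by rewrite -!EFinM -!EFinD lee_fin.
have yb0 j : (0 <= y%:E * (b j)%:E)%E by rewrite -EFinM lee_fin mulr_ge0// ltW.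
have lb0 j : (0 <= `|ln a|%:E * (j%:R * b j)%:E)%E by rewrite -EFinM lee_fin !mulr_ge0.
have pE0 j : (0 <= (p j)%:E)%E by rewrite lee_fin.
have KE0 j : (0 <= (K j)%:E)%E by rewrite lee_fin.
rewrite nneseriesD// => [|j _ _]; last by rewrite !adde_ge0.
rewrite nneseriesD// => [|j _ _]; last by rewrite adde_ge0.
rewrite nneseriesD// nneseriesZl; last by move=> j _; rewrite lee_fin.
rewrite nneseriesZl; last by move=> j _; rewrite lee_fin mulr_ge0.
rewrite sp sb sjb mule1 -!EFinM -!EFinD leeD2l// lee_fin; lra.
Qed.

Variables (ft : forall k : 'I_kmax, k.+1.-tuple T -> R) (eta : nat -> R).
Variables (gamma beta c0 Bf : R).
Hypothesis beta_ge0 : 0 <= beta.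
Hypothesis c0_eta : forall j, c0 <= eta j.
Hypothesis mft : forall k, measurable_fun setT (@ft k).
Hypothesis ftB : forall k x, `|@ft k x| <= Bf.

Lemma entropic_density_exists Psi : (objective ft eta gamma beta Psi < +oo)%E ->
  exists n g m, entropic_density Psi n g m.
Proof.
rewrite (objectiveE gamma beta_ge0 c0_eta mft ftB) => obj.
have nuS0 : (0 <= \sum_(k < kmax) nu_entropy Psi k)%E.
  by apply: sume_ge0 => k _; exact: nu_entropy_ge0.
have cost0 := mu_cost_ge0 beta_ge0 c0_eta Psi.
have muS0 : (0 <= \sum_(0 <= j <oo) mu_cost eta beta c0 Psi j)%E.
  by apply: nneseries_ge0 => j _ _.
have S_oo : (\sum_(k < kmax) nu_entropy Psi k
    + \sum_(0 <= j <oo) mu_cost eta beta c0 Psi j < +oo)%E.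
  by move: obj; rewrite !ltey; apply: contra_neq => ->.
have nu_oo k : (nu_entropy Psi k < +oo)%E.
  apply: le_lt_trans S_oo; rewrite (bigD1 k)//= -addeA leeDl// adde_ge0//.
  by apply: sume_ge0 => i _; exact: nu_entropy_ge0.
have cost_oo : (\sum_(0 <= j <oo) mu_cost eta beta c0 Psi j < +oo)%E.
  by apply: le_lt_trans S_oo; rewrite leeDr.
have ent_le_cost j : (mu_entropy Psi j <= mu_cost eta beta c0 Psi j)%E.
  rewrite leeDl// mule_ge0// lee_fin mulr_ge0// subr_ge0//.
have mu_oo : (\sum_(0 <= j <oo) mu_entropy Psi j < +oo)%E.
  apply: le_lt_trans cost_oo; apply: lee_nneseries => [j _ _|j _]; last exact: ent_le_cost.
  exact: mu_entropy_ge0.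
have /choice[g dg] : forall j, exists gj, is_density mu (ts_mu Psi j) gj.
  move=> j; apply: is_density_exists; apply/null_content_dominatesP => A mA muA.
  by apply/eqP; rewrite eq_le measure_ge0 andbT -muA mu_le.
have [m dm] : exists m : T -> R, is_density mu (relay_measure Psi) m.
  apply: is_density_exists; apply/null_content_dominatesP => A mA muA.
  rewrite [LHS](relayE Psi A) eseries0// => j _ _; case: (dg j) => mg g0 ->//.
  rewrite null_set_integral ?mule0//.
  by apply/measurable_EFinP; exact: measurable_funTS.
have dnex (k : 'I_kmax) : {f | is_density (power_measure mu k.+1) (ts_nu Psi k) f}.
  apply: cid; apply: is_density_exists.
  apply: (null_dominates_trans (entropy_lty_dominates (nu_oo k))).
  exact: is_density_dominates (is_density_reference k dm).
pose n (k : 'I_kmax) := sval (dnex k).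
have dn (k : 'I_kmax) : is_density (power_measure mu k.+1) (ts_nu Psi k) (n k) := svalP (dnex k).
have [mm m0 _] := dm.
have muoo : (mu setT < +oo)%E by rewrite -ge0_fin_numE// fin_num_measure.
pose c j := receiver_weight mu j.
have c_gt0 j : 0 < c j by exact: receiver_weight_gt0.
have mg j : measurable_fun setT (g j) by case: (dg j).
have g0 j x : 0 <= g j x by case: (dg j).
pose K j x := c j * kl (g j x / c j).
have mK j : measurable_fun setT (fun x => (K j x)%:E).
  apply/measurable_EFinP/measurable_funM; first exact: measurable_cst.
  by apply/measurable_kl/measurable_funM => //; exact: measurable_cst.
have K0 j x : (0 <= (K j x)%:E)%E.
  by rewrite lee_fin mulr_ge0 ?(ltW (c_gt0 j))// kl_ge0// divr_ge0// ltW.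
have SK : (\int[mu]_x (\sum_(0 <= j <oo) (K j x)%:E) < +oo)%E.
  rewrite integral_nneseries//; apply: le_lt_trans mu_oo.
  rewrite le_eqVlt; apply/orP; left; apply/eqP; apply: eq_eseriesr => j _.
  by rewrite (mu_entropyE mu_gt0 (dg j)).
have iem : mu.-integrable setT (EFin \o (fun x => ent (m x))).
  pose L := 1 + `|ln (expR 1 * fine (mu setT))|.
  have iL : mu.-integrable setT (EFin \o (fun x => 1 + L * m x)).
    have := integrableD measurableT (finite_measure_integrable_cst mu 1 measurableT)
      (integrableZl measurableT L (is_density_integrable dm)).
    exact: eq_integrable.
  apply/integrableP; split; first exact/measurable_EFinP/measurable_ent.
  have L0 : 0 <= L by rewrite addr_ge0.
  have mS : measurable_fun setT (fun x => \sum_(0 <= j <oo) (K j x)%:E)%E.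
    by apply: ge0_emeasurable_sum => // j x _ _.
  have S0 x : (0 <= \sum_(0 <= j <oo) (K j x)%:E)%E by apply: nneseries_ge0 => j _ _.
  have ml : measurable_fun setT (fun x => (1 + L * m x)%:E) by exact: measurable_int iL.
  have l0 x : (0 <= (1 + L * m x)%:E)%E by rewrite lee_fin addr_ge0// mulr_ge0.
  apply: (@le_lt_trans _ _ (\int[mu]_x (\sum_(0 <= j <oo) (K j x)%:E + (1 + L * m x)%:E))%E).
    apply: ae_ge0_le_integral => //.
    - by apply: measurableT_comp => //; exact/measurable_EFinP/measurable_ent.
    - by move=> x _; rewrite adde_ge0.
    - exact: emeasurable_funD.
    apply: filterS2 (receivers_ae dg) (relays_ae dg dm) => x sg sjg _.
    have [m1|m1] := ltP (m x) 1.
      apply: (@le_trans _ _ 1%E).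
        rewrite /= lee_fin ler_norml ent_ge//= /ent.
        have : ln (m x) <= 0 by rewrite ln_le0// ltW.
        by have := m0 x; nra.
      apply: (@le_trans _ _ (1 + L * m x)%:E); first by rewrite lee_fin lerDl mulr_ge0.
      by rewrite leeDr.
    rewrite /= ger0_norm; last by rewrite mulr_ge0// ln_ge0.
    exact: poisson_ln_le.
  rewrite ge0_integralD// lte_add_pinfty//.
  have /integrableP[_] := iL; apply: le_lt_trans; apply: ge0_le_integral => //.
    by apply: measurableT_comp.
  by move=> x _; rewrite lee_abs.
have ieg j : mu.-integrable setT (EFin \o (fun x => ent (g j x))).
  have iK : mu.-integrable setT (EFin \o K j).
    apply/integrableP; split; first exact: mK.
    under eq_integral do rewrite gee0_abs ?K0//.
    have -> : (\int[mu]_x (K j x)%:E = mu_entropy Psi j)%E by rewrite (mu_entropyE mu_gt0 (dg j)).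
    apply: le_lt_trans mu_oo; rewrite (nneseriesD1 (n := j))//.
      by rewrite leeDl// nneseries_ge0// => i _ _; exact: mu_entropy_ge0.
    by move=> i _; exact: mu_entropy_ge0.
  have ig := integrableZl measurableT (ln (c j) + 1) (is_density_integrable (dg j)).
  have ic : mu.-integrable setT (EFin \o (fun=> c j)) by exact: finite_measure_integrable_cst.
  have := integrableB measurableT (integrableD measurableT iK ig) ic.
  apply: eq_integrable => // x _; rewrite /= -!EFinM -!EFinD; congr EFin.
  rewrite /K /kl /ent; have [->|gx] := eqVneq (g j x) 0; first by rewrite !mul0r; ring.
  have gx0 : 0 < g j x by rewrite lt0r gx g0.
  rewrite lnM ?posrE ?invr_gt0// lnV ?posrE//; field.
  by rewrite gt_eqF.
exists n, g, m; split => //.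
by move=> k; apply: (ent_nu_integrable dm (dn k) iem (nu_oo k)).
Qed.

End entropic_density_exists.


Lemma nneseries_perturb (R : realType) (x : nat -> \bar R) (r : nat -> R) J :
  (forall j, 0 <= x j)%E -> (forall j, 0 <= x j + (r j)%:E)%E ->
  (forall j, (J <= j)%N -> r j = 0) ->
  (\sum_(0 <= j <oo) (x j + (r j)%:E) =
   \sum_(0 <= j <oo) x j + (\sum_(0 <= j < J) r j)%:E)%E.
Proof.
move=> x0 xr0 rJ.
rewrite (nneseries_split _ J)// [in RHS](nneseries_split _ J)// !add0n.
rewrite -sumEFin big_split/= -!addeA; congr (_ + _)%E; rewrite addeC; congr (_ + _)%E.
apply: congr_lim; apply/funext => N; apply: eq_big_nat => j /andP[Jj _].
by rewrite rJ// adde0.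
Qed.

Lemma density_perturb d (T : measurableType d) (R : realType)
    (lam : {measure set T -> \bar R}) (nu : {finite_measure set T -> \bar R}) (f h : T -> R) (B e : R) A :
  (lam setT < +oo)%E -> is_density lam nu f -> measurable_fun setT h ->
  (forall x, `|h x| <= B) -> measurable A ->
  (\int[lam]_(x in A) (f x + e * h x)%:E = nu A + (e * \int[lam]_(x in A) h x)%:E)%E.
Proof.
move=> lamoo df mh hB mA; have [_ _ H] := df.
have ih : lam.-integrable A (EFin \o h).
  by apply: (integrableS measurableT mA (@subsetT _ A)); exact: bounded_integrable hB.
have ieh : lam.-integrable A (EFin \o (fun x => e * h x)).
  by have := integrableZl mA e ih; apply: eq_integrable.
have ifA : lam.-integrable A (EFin \o f).
  by apply: (integrableS measurableT mA (@subsetT _ A)); exact: is_density_integrable df.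
under eq_integral do rewrite EFinD.
rewrite (integralD mA ifA ieh) -H//; congr (_ + _)%E.
by rewrite -RintegralZl// /Rintegral fineK//; exact: integrable_fin_num ieh.
Qed.

Section first_variation.
Context d (T : measurableType d) (R : realType) (kmax : nat).
Variable (mu : {finite_measure set T -> \bar R}).
Variables (ft : forall k : 'I_kmax, k.+1.-tuple T -> R) (eta : nat -> R).
Variables (gamma beta c0 Bf : R).
Hypothesis mu_gt0 : (0 < mu setT)%E.
Hypothesis beta_ge0 : 0 <= beta.
Hypothesis c0_eta : forall j, c0 <= eta j.
Hypothesis mft : forall k, measurable_fun setT (@ft k).
Hypothesis ftB : forall k x, `|@ft k x| <= Bf.

Definition trajectory_energy (n : forall k : 'I_kmax, k.+1.-tuple T -> R) (g : nat -> T -> R)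
    (m : T -> R) (J : nat) : R :=
  \sum_(k < kmax) (\int[power_measure mu k.+1]_t ent (n k t) +
      gamma * \int[power_measure mu k.+1]_t (ft t * n k t))
  - \int[mu]_x ent (m x) - (expR 1)^-1 + beta * (c0 * fine (mu setT))
  + \sum_(0 <= j < J) (\int[mu]_x ent (g j x)
    + receiver_potential mu eta beta c0 j * \int[mu]_x g j x
    + receiver_weight mu j * fine (mu setT)).

Lemma objective_entropic (P : trajectory_setting kmax mu) n g m J :
  entropic_density P n g m -> objective ft eta gamma beta P =
  ((trajectory_energy n g m J)%:E + \sum_(J <= j <oo) mu_cost eta beta c0 P j)%E.
Proof.
move=> edP; rewrite (objectiveE gamma beta_ge0 c0_eta mft ftB) addeAC.
have E1 := nu_energy_real gamma beta c0 mft ftB edP.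
rewrite [X in (X + _)%E = _]E1 (nneseries_split _ J); last by move=> j _; exact: mu_cost_ge0.
rewrite add0n addeA /trajectory_energy [in RHS]EFinD -sumEFin; congr (_ + _ + _)%E.
by apply: eq_bigr => j _; rewrite (mu_cost_real eta beta c0 mu_gt0 j edP).
Qed.

Variables (Psi : trajectory_setting kmax mu).
Variables (n : forall k : 'I_kmax, k.+1.-tuple T -> R) (g : nat -> T -> R) (m : T -> R).
Arguments n : clear implicits.
Hypothesis ed : entropic_density Psi n g m.
Hypothesis minPsi : is_minimizer ft eta gamma beta Psi.
Hypothesis Psi_oo : (objective ft eta gamma beta Psi < +oo)%E.

Variables (h : forall k : 'I_kmax, k.+1.-tuple T -> R) (u : nat -> T -> R) (v : T -> R).
Variables (J : nat) (dl B : R).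
Arguments h : clear implicits.
Hypothesis dl0 : 0 < dl.
Hypothesis mh : forall k : 'I_kmax, measurable_fun setT (h k).
Hypothesis mu_ : forall j, measurable_fun setT (u j).
Hypothesis mv : measurable_fun setT v.
Hypothesis hB : forall (k : 'I_kmax) t, `|h k t| <= B.
Hypothesis uB : forall j x, `|u j x| <= B.
Hypothesis vB : forall x, `|v x| <= B.
Hypothesis gh : forall (k : 'I_kmax) t, good_direction dl (n k t) (h k t).
Hypothesis gu : forall j x, good_direction dl (g j x) (u j x).
Hypothesis gv : forall x, good_direction dl (m x) (v x).
Hypothesis uJ : forall j x, (J <= j)%N -> u j x = 0.
Hypothesis sum_u : forall x, \sum_(0 <= j < J) u j x = 0.
Hypothesis sum_ju : forall x, \sum_(0 <= j < J) j%:R * u j x = v x.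
Hypothesis sum_h0 : forall A, measurable A -> \sum_(k < kmax)
  \int[power_measure mu k.+1]_(t in (fun t => tnth t ord0) @^-1` A) h k t = 0.
Hypothesis sum_hl : forall A, measurable A ->
  \sum_(k < kmax) \sum_(l < k.+1 | (0 < l)%N)
    \int[power_measure mu k.+1]_(t in (fun t => tnth t l) @^-1` A) h k t =
  \int[mu]_(x in A) v x.

Arguments mh : clear implicits.
Arguments mu_ : clear implicits.
Arguments hB : clear implicits.
Arguments uB : clear implicits.
Arguments gh : clear implicits.
Arguments gu : clear implicits.

Let muoo : (mu setT < +oo)%E. Proof. by rewrite -ge0_fin_numE// fin_num_measure. Qed.
Let lamoo (k : 'I_kmax) : (power_measure mu k.+1 setT < +oo)%E := power_measureT_lty mu k.+1.
Let dn (k : 'I_kmax) : is_density (power_measure mu k.+1) (ts_nu Psi k) (n k) :=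
  (ed_setting ed).1 k.
Let dg j : is_density mu (ts_mu Psi j) (g j) := (ed_setting ed).2 j.
Let dm : is_density mu (relay_measure Psi) m := ed_relay ed.
Let mn (k : 'I_kmax) : measurable_fun setT (n k). Proof. by case: (dn k). Qed.
Let mg j : measurable_fun setT (g j). Proof. by case: (dg j). Qed.
Let mm : measurable_fun setT m. Proof. by case: dm. Qed.

Section perturbed.
Variable e : R.
Let n' (k : 'I_kmax) t := n k t + e * h k t.
Arguments n' : clear implicits.
Let g' j x := g j x + e * u j x.
Let m' x := m x + e * v x.
Hypothesis n'0 : forall (k : 'I_kmax) t, 0 <= n' k t.
Hypothesis g'0 : forall j x, 0 <= g' j x.
Hypothesis m'0 : forall x, 0 <= m' x.
Hypothesis ien' : forall k : 'I_kmax,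
  (power_measure mu k.+1).-integrable setT (EFin \o (fun t => ent (n' k t))).
Hypothesis ieg' : forall j, mu.-integrable setT (EFin \o (fun x => ent (g' j x))).
Hypothesis iem' : mu.-integrable setT (EFin \o (fun x => ent (m' x))).

Let mn' (k : 'I_kmax) : measurable_fun setT (n' k).
Proof.
apply: measurable_funD; first exact: (@mn k).
by apply: measurable_funM; [exact: measurable_cst|exact: mh].
Qed.

Let mg' j : measurable_fun setT (g' j).
Proof.
apply: measurable_funD; first exact: (@mg j).
by apply: measurable_funM; [exact: measurable_cst|exact: mu_].
Qed.

Let mm' : measurable_fun setT m'.
Proof. by apply: measurable_funD => //; apply: measurable_funM => //; exact: measurable_cst. Qed.

Let iu_ j A : measurable A -> mu.-integrable A (EFin \o u j).
Proof.
move=> mA; apply: (integrableS measurableT mA (@subsetT _ A)).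
exact: (bounded_integrable muoo (mu_ j) (uB j)).
Qed.

Let int_n' (k : 'I_kmax) (A : set (k.+1.-tuple T)) : measurable A ->
  (\int[power_measure mu k.+1]_(t in A) (n' k t)%:E =
   ts_nu Psi k A + (e * \int[power_measure mu k.+1]_(t in A) h k t)%:E)%E.
Proof. by move=> mA; have := density_perturb e (lamoo k) (dn k) (mh k) (hB k) mA. Qed.

Let int_g' j A : measurable A -> (\int[mu]_(x in A) (g' j x)%:E =
   ts_mu Psi j A + (e * \int[mu]_(x in A) u j x)%:E)%E.
Proof. by move=> mA; exact: (density_perturb e muoo (dg j) (mu_ j) (uB j) mA). Qed.

Let perturbed_receivers A : measurable A ->
  (\sum_(0 <= j <oo) \int[mu]_(x in A) (g' j x)%:E = mu A)%E.
Proof.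
move=> mA; under eq_eseriesr do rewrite int_g'//.
rewrite (@nneseries_perturb _ _ _ J).
- rewrite (ts_receivers Psi mA) -mulr_sumr -Rintegral_sum//; last by move=> j _; exact: iu_.
  under eq_Rintegral do rewrite sum_u.
  by rewrite Rintegral_cst// mul0r mulr0 adde0.
- by move=> j; exact: measure_ge0.
- by move=> j; rewrite -int_g'//; apply: integral_ge0 => x _; rewrite lee_fin g'0.
- move=> j Jj; under eq_Rintegral do rewrite uJ//.
  by rewrite Rintegral_cst// mul0r mulr0.
Qed.

Let perturbed_first_moment A : measurable A ->
  (\sum_(0 <= j <oo) j%:R%:E * \int[mu]_(x in A) (g' j x)%:E =
   relay_measure Psi A + (e * \int[mu]_(x in A) v x)%:E)%E.
Proof.
move=> mA.
have E j : (j%:R%:E * \int[mu]_(x in A) (g' j x)%:E = j%:R%:E * ts_mu Psi j A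
    + (e * \int[mu]_(x in A) (j%:R * u j x))%:E)%E.
  have fin : ts_mu Psi j A \is a fin_num by exact: fin_num_measure.
  rewrite int_g'// RintegralZl//; last exact: iu_.
  rewrite -(fineK fin) -EFinD -!EFinM -EFinD; congr EFin; ring.
under eq_eseriesr do rewrite E.
rewrite (@nneseries_perturb _ _ _ J).
- rewrite [in RHS]relayE; congr (_ + _%:E)%E.
  rewrite -mulr_sumr -Rintegral_sum//.
    by congr (_ * _); apply: eq_Rintegral => x _; rewrite sum_ju.
  move=> j _; have := integrableZl mA j%:R (iu_ j mA); exact: eq_integrable.
- by move=> j; rewrite mule_ge0// lee_fin.
- move=> j; rewrite -E mule_ge0 ?lee_fin//.
  by apply: integral_ge0 => x _; rewrite lee_fin g'0.
- move=> j Jj; under eq_Rintegral do rewrite uJ// mulr0.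
  by rewrite Rintegral_cst// mul0r mulr0.
Qed.

Lemma perturbed_setting : exists Psi' : trajectory_setting kmax mu,
  entropic_density Psi' n' g' m'.
Proof.
have [||||||||| Psi' [dn' dg']] := @setting_of_densities _ T R kmax mu n' g'.
- move=> k; exact: (@mn' k).
- exact: n'0.
- move=> k; have ih := bounded_integrable (lamoo k) (mh k) (hB k).
  have := integrableD measurableT (is_density_integrable (dn k)) (integrableZl measurableT e ih).
  exact: eq_integrable.
- move=> j; exact: (@mg' j).
- exact: g'0.
- move=> j.
  have := integrableD measurableT (is_density_integrable (dg j))
    (integrableZl measurableT e (iu_ j measurableT)).
  exact: eq_integrable.
- move=> A mA.
  transitivity (\sum_(k < kmax) (marginal ord0 (ts_nu Psi k) A +
    (e * \int[power_measure mu k.+1]_(t in (fun t => tnth t ord0) @^-1` A) h k t)%:E))%E.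
    by apply: eq_bigr => k _; rewrite int_n'//; exact: measurable_preimage_tnth.
  by rewrite big_split/= ts_sources// sumEFin -mulr_sumr sum_h0// mulr0 adde0.
- exact: perturbed_receivers.
- move=> A mA; rewrite perturbed_first_moment// -sum_hl//.
  rewrite [X in (X + _)%E](ts_relays Psi mA) mulr_sumr -sumEFin -big_split/=.
  apply: eq_bigr => k _; rewrite mulr_sumr -sumEFin -big_split/=.
  by apply: eq_bigr => l l0; rewrite int_n'//; exact: measurable_preimage_tnth.
exists Psi'; split => //; split => // A mA.
transitivity (relay_measure Psi A + (e * \int[mu]_(x in A) v x)%:E)%E.
  rewrite -perturbed_first_moment// [LHS]relayE; apply: eq_eseriesr => j _.
  by case: (dg' j) => _ _ ->.
exact: (esym (density_perturb e muoo dm mv vB mA)).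
Qed.

End perturbed.

Local Notation lam k := (power_measure mu (nat_of_ord k).+1).

Lemma first_variation :
  let b := \sum_(k < kmax) \int[lam k]_t ent_sing (n k t) (h k t)
    + \sum_(0 <= j < J) \int[mu]_x ent_sing (g j x) (u j x)
    - \int[mu]_x ent_sing (m x) (v x) in
  let a := \sum_(k < kmax) (\int[lam k]_t ent_reg (n k t) (h k t)
      + gamma * \int[lam k]_t (ft t * h k t))
    + \sum_(0 <= j < J) (\int[mu]_x ent_reg (g j x) (u j x)
      + receiver_potential mu eta beta c0 j * \int[mu]_x u j x)
    - \int[mu]_x ent_reg (m x) (v x) in
  b <= 0 /\ (b = 0 -> 0 <= a).
Proof.
move=> b a.
have /choice[Kn HKn] : forall k : 'I_kmax, exists K, forall e, 0 < e -> e * `|B| <= dl ->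
    [/\ forall t, 0 <= n k t + e * h k t,
      (lam k).-integrable setT (EFin \o (fun t => ent (n k t + e * h k t))) &
      `|\int[lam k]_t ent (n k t + e * h k t) - \int[lam k]_t ent (n k t)
        - (e * ln e * \int[lam k]_t ent_sing (n k t) (h k t)
           + e * \int[lam k]_t ent_reg (n k t) (h k t))| <= K * e ^+ 2].
  move=> k; have [mnk nk0 _] := dn k.
  exact: (ent_integral_expansion (lamoo k) mnk nk0 (ed_nu ed k) (mh k) (hB k) dl0 (gh k)).
have /choice[Kg HKg] : forall j, exists K, forall e, 0 < e -> e * `|B| <= dl ->
    [/\ forall x, 0 <= g j x + e * u j x,
      mu.-integrable setT (EFin \o (fun x => ent (g j x + e * u j x))) &
      `|\int[mu]_x ent (g j x + e * u j x) - \int[mu]_x ent (g j x)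
        - (e * ln e * \int[mu]_x ent_sing (g j x) (u j x)
           + e * \int[mu]_x ent_reg (g j x) (u j x))| <= K * e ^+ 2].
  move=> j; have [mgj gj0 _] := dg j.
  exact: (ent_integral_expansion muoo mgj gj0 (ed_mu ed j) (mu_ j) (uB j) dl0 (gu j)).
have [Km HKm] : exists K, forall e, 0 < e -> e * `|B| <= dl ->
    [/\ forall x, 0 <= m x + e * v x,
      mu.-integrable setT (EFin \o (fun x => ent (m x + e * v x))) &
      `|\int[mu]_x ent (m x + e * v x) - \int[mu]_x ent (m x)
        - (e * ln e * \int[mu]_x ent_sing (m x) (v x)
           + e * \int[mu]_x ent_reg (m x) (v x))| <= K * e ^+ 2].
  have [_ m0 _] := dm.
  exact: (ent_integral_expansion muoo mm m0 (ed_m ed) mv vB dl0 gv).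
pose K := \sum_(k < kmax) Kn k + \sum_(0 <= j < J) Kg j + Km.
have B1 : 0 < `|B| + 1 by rewrite ltr_wpDl.
apply: (@small_parameter _ b a K (dl / (`|B| + 1))); first by rewrite divr_gt0.
move=> e e0 ele.
have eB : e * `|B| <= dl.
  rewrite (le_trans (ler_wpM2r (normr_ge0 B) ele))// mulrAC ler_pdivrMr//.
  by rewrite ler_wpM2l ?(ltW dl0)// lerDl.
have En k := HKn k e e0 eB; have Eg j := HKg j e e0 eB; have Em := HKm e e0 eB.
have [Psi' ed'] : exists Psi' : trajectory_setting kmax mu, entropic_density Psi'
    (fun k t => n k t + e * h k t) (fun j x => g j x + e * u j x) (fun x => m x + e * v x).
  apply: perturbed_setting.
  - by move=> k t; case: (En k).
  - by move=> j x; case: (Eg j).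
  - by move=> x; case: Em.
  - by move=> k; case: (En k).
  - by move=> j; case: (Eg j).
  - by case: Em.
have := ereal_inf_lbound (imageT (objective ft eta gamma beta) Psi').
rewrite -minPsi => leP.
pose tail := (\sum_(J <= j <oo) mu_cost eta beta c0 Psi j)%E.
have tail' : (\sum_(J <= j <oo) mu_cost eta beta c0 Psi' j)%E = tail.
  apply: congr_lim; apply/funext => N; apply: eq_big_nat => j /andP[Jj _].
  rewrite (mu_cost_real _ _ _ mu_gt0 _ ed) (mu_cost_real _ _ _ mu_gt0 _ ed').
  have E x : g j x + e * u j x = g j x by rewrite uJ// mulr0 addr0.
  by congr ((_ + _ * _ + _)%:E); apply: eq_Rintegral => x _; rewrite E.
have tail_ge0 : (0 <= tail)%E.
  by apply: nneseries_ge0 => j _ _; exact: mu_cost_ge0.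
move: leP Psi_oo; rewrite (objective_entropic J ed) (objective_entropic J ed') tail' -/tail.
move=> leP Soo.
have tail_fin : tail \is a fin_num.
  rewrite ge0_fin_numE// ltey; apply/eqP => tailoo; move: Soo.
  by rewrite tailoo addey.
move: leP; rewrite leeD2rE// lee_fin.
have Ek (k : 'I_kmax) : \int[lam k]_t (ft t * (n k t + e * h k t)) =
    \int[lam k]_t (ft t * n k t) + e * \int[lam k]_t (ft t * h k t).
  have ifh : (lam k).-integrable setT (EFin \o (fun t => ft t * h k t)).
    apply: (bounded_integrable (B := Bf * B) (lamoo k)).
      exact: (measurable_funM (@mft k) (mh k)).
    by move=> t; rewrite normrM ler_pM.
  have ifn : (lam k).-integrable setT (EFin \o (fun t => ft t * n k t)).
    exact: ((is_density_integrable_fun (dn k) (@mft k)).1 (ft_integrable mft ftB Psi k)).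
  rewrite -RintegralZl// -RintegralD//; last first.
    by have := integrableZl measurableT e ifh; apply: eq_integrable.
  by apply: eq_Rintegral => t _; ring.
have Ej j : \int[mu]_x (g j x + e * u j x) = \int[mu]_x g j x + e * \int[mu]_x u j x.
  have iu := bounded_integrable muoo (mu_ j) (uB j).
  rewrite RintegralD//; first by rewrite RintegralZl.
    exact: is_density_integrable (dg j).
  by have := integrableZl measurableT e iu; apply: eq_integrable.
rewrite -subr_ge0 => /le_trans; apply.
pose sN k := \int[lam k]_t ent_sing (n k t) (h k t).
pose rN k := \int[lam k]_t ent_reg (n k t) (h k t).
pose FN k := \int[lam k]_t (ft t * h k t).
pose sG j := \int[mu]_x ent_sing (g j x) (u j x).
pose rG j := \int[mu]_x ent_reg (g j x) (u j x).
pose UG j := receiver_potential mu eta beta c0 j * \int[mu]_x u j x.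
have -> : e * ln e * b + e * a + K * e ^+ 2 =
    \sum_(k < kmax) (e * ln e * sN k + e * rN k + Kn k * e ^+ 2 + e * (gamma * FN k))
    + \sum_(0 <= j < J) (e * ln e * sG j + e * rG j + Kg j * e ^+ 2 + e * UG j)
    - (e * ln e * \int[mu]_x ent_sing (m x) (v x) + e * \int[mu]_x ent_reg (m x) (v x))
    + Km * e ^+ 2.
  rewrite /a /b /K !big_split/= -!mulr_sumr -!mulr_suml; ring.
have H1 : \sum_(k < kmax) (\int[lam k]_t ent (n k t + e * h k t) +
        gamma * \int[lam k]_t (ft t * (n k t + e * h k t)))
    - \sum_(k < kmax) (\int[lam k]_t ent (n k t) + gamma * \int[lam k]_t (ft t * n k t))
    <= \sum_(k < kmax) (e * ln e * sN k + e * rN k + Kn k * e ^+ 2 + e * (gamma * FN k)).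
  rewrite -sumrB; apply: ler_sum => k _; rewrite Ek -/(FN k).
  have [_ _] := En k; rewrite ler_norml => /andP[_]; rewrite -/(sN k) -/(rN k); nra.
have H2 : \sum_(0 <= j < J) (\int[mu]_x ent (g j x + e * u j x)
        + receiver_potential mu eta beta c0 j * \int[mu]_x (g j x + e * u j x)
        + receiver_weight mu j * fine (mu setT))
    - \sum_(0 <= j < J) (\int[mu]_x ent (g j x)
        + receiver_potential mu eta beta c0 j * \int[mu]_x g j x
        + receiver_weight mu j * fine (mu setT))
    <= \sum_(0 <= j < J) (e * ln e * sG j + e * rG j + Kg j * e ^+ 2 + e * UG j).
  rewrite -sumrB; apply: ler_sum => j _; rewrite Ej /UG.
  have [_ _] := Eg j; rewrite ler_norml => /andP[_]; rewrite -/(sG j) -/(rG j).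
  by set X := \int[mu]_x u j x; set Y := \int[mu]_x g j x; nra.
have [_ _] := Em; rewrite ler_norml => /andP[H3 _].
rewrite /trajectory_energy; move: H1 H2 H3.
set S1 := \sum_(k < kmax) _; set S2 := \sum_(k < kmax) _; set S3 := \sum_(k < kmax) _.
set S4 := \sum_(0 <= j < J) _; set S5 := \sum_(0 <= j < J) _; set S6 := \sum_(0 <= j < J) _.
lra.
Qed.

End first_variation.


Section ent_direction.
Variable R : realType.
Implicit Types u h dl x : R.

Lemma ent_singE u h : u != 0 \/ h = 0 -> ent_sing u h = 0.
Proof. by rewrite /ent_sing => -[/negbTE ->|->] //; case: ifP. Qed.

Lemma ent_regE u h : u != 0 \/ h = 0 -> ent_reg u h = h * (ln u + 1).
Proof. by rewrite /ent_reg => -[/negbTE ->|->] //; rewrite mul0r ent0; case: ifP. Qed.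

Lemma ent_singr0 u : ent_sing u 0 = 0.
Proof. by rewrite ent_singE//; right. Qed.

Lemma ent_regr0 u : ent_reg u 0 = 0.
Proof. by rewrite ent_regE ?mul0r//; right. Qed.

Definition in_range dl x := dl <= x <= dl^-1.

Lemma in_range_neq0 dl x : 0 < dl -> in_range dl x -> x != 0.
Proof. by move=> dl0 /andP[dlx _]; rewrite gt_eqF// (lt_le_trans dl0). Qed.

Lemma in_range_near x : 0 < x -> \forall N \near \oo, in_range N.+1%:R^-1 x.
Proof.
move=> x0; near=> N; rewrite /in_range invrK; apply/andP; split.
  rewrite invf_ple ?posrE//; apply: (@le_trans _ _ N%:R); last by rewrite ler_nat.
  by near: N; exact: nbhs_infty_ger.
apply: (@le_trans _ _ N%:R); last by rewrite ler_nat.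
by near: N; exact: nbhs_infty_ger.
Unshelve. all: by end_near. Qed.

Lemma in_range_near0 x : 0 <= x -> \forall N \near \oo, (x == 0) || in_range N.+1%:R^-1 x.
Proof.
rewrite le_eqVlt => /predU1P[<-|x0]; first by apply: nearW => N; rewrite eqxx.
by apply: filterS (in_range_near x0) => N ->; rewrite orbT.
Qed.

Lemma ln_in_range dl x : 0 < dl -> in_range dl x -> `|ln x| <= `|ln dl|.
Proof.
move=> dl0 /andP[dlx xdl]; have x0 := lt_le_trans dl0 dlx.
have l1 : ln dl <= ln x by rewrite ler_ln ?posrE.
have l2 : ln x <= - ln dl by rewrite -lnV ?posrE// ler_ln ?posrE ?invr_gt0.
rewrite ler_norml; have := ler_norm (- ln dl); have := ler_norm (ln dl).
by rewrite normrN => *; apply/andP; split; lra.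
Qed.

End ent_direction.

Lemma measurable_in_range d (T : measurableType d) (R : realType) (dl : R) (f : T -> R) :
  measurable_fun setT f -> measurable [set x | in_range dl (f x)].
Proof.
move=> mf; apply: measurable_bool_set; apply: measurable_and.
  by apply: measurable_fun_ler => //; exact: measurable_cst.
by apply: measurable_fun_ler => //; exact: measurable_cst.
Qed.

Lemma measurable_eq0 d (T : measurableType d) (R : realType) (f : T -> R) :
  measurable_fun setT f -> measurable [set x | f x == 0].
Proof.
move=> mf; apply: measurable_bool_set.
by apply: measurable_fun_eqr => //; exact: measurable_cst.
Qed.

Lemma Rintegral_indicE d (T : measurableType d) (R : realType)
    (lam : {measure set T -> \bar R}) (A : set T) (f : T -> R) :
  \int[lam]_(x in A) f x = \int[lam]_x (\1_A x * f x).
Proof.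
rewrite /Rintegral integral_mkcond; congr fine; apply: eq_integral => x _.
by rewrite patchE indicE; case: ifP; rewrite ?mul1r ?mul0r.
Qed.

(* Both signs of a variation supported in [E] are allowed, so its first-order
   coefficient [L] must vanish. *)
Lemma ae_eq0_both_signs d (T : measurableType d) (R : realType)
    (lam : {measure set T -> \bar R}) (E : set T) (L : T -> R) (B : R) :
  (lam setT < +oo)%E -> measurable E -> measurable_fun setT L ->
  (forall x, E x -> `|L x| <= B) ->
  (forall D s, measurable D -> D `<=` E -> s = 1 \/ s = -1 ->
     0 <= s * \int[lam]_x (\1_D x * L x)) ->
  {ae lam, forall x, E x -> L x = 0}.
Proof.
move=> lamoo mE mL LB H.
have mDL D : measurable D -> measurable_fun setT (fun x => \1_D x * L x).
  by move=> mD; apply: measurable_funM.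
have bDL D x : D `<=` E -> `|\1_D x * L x| <= `|B|.
  move=> DE; rewrite indicE; have [|_] := boolP (x \in D); last by rewrite mul0r normr0.
  by rewrite mul1r inE => /DE /LB /le_trans; apply; exact: ler_norm.
have i0 : ae_eq lam setT (fun x => (\1_E x * L x)%:E) (cst 0%E).
  apply: integral_ae_eq => //.
  - by apply: (bounded_integrable lamoo (mDL _ mE)) => x; exact: bDL.
  move=> A _ mA; rewrite integral0 integral_mkcond.
  have mAE : measurable (A `&` E) by exact: measurableI.
  have AE : A `&` E `<=` E by apply: subIsetr.
  have iAE := bounded_integrable lamoo (mDL _ mAE) (fun x => bDL _ x AE).
  have -> : ((fun x => (\1_E x * L x)%:E) \_ A) = (fun x => (\1_(A `&` E) x * L x)%:E).
    apply/funext => x; rewrite patchE indicI/= [\1_A x]indicE.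
    by case: ifP => _; rewrite ?mul1r// !mul0r.
  rewrite -(fineK (integrable_fin_num measurableT iAE)); congr EFin.
  have h1 := H _ 1 mAE AE (or_introl erefl); have h2 := H _ (-1) mAE AE (or_intror erefl).
  by rewrite /Rintegral in h1 h2; lra.
apply: filterS i0 => x /(_ I) [H0] Ex.
by move: H0; rewrite indicE mem_set// mul1r.
Qed.

Lemma ae_eq0_Rintegral_le0 d (T : measurableType d) (R : realType)
    (lam : {measure set T -> \bar R}) (F : T -> R) :
  lam.-integrable setT (EFin \o F) -> (forall x, 0 <= F x) ->
  \int[lam]_x F x <= 0 -> {ae lam, forall x, F x = 0}.
Proof.
move=> iF F0 Fle; have mF := measurable_int _ iF.
have : ae_eq lam setT (EFin \o F) (cst 0%E).
  apply/(ae_eq_integral_abs lam measurableT mF).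
  under eq_integral do rewrite gee0_abs ?lee_fin//.
  rewrite -(fineK (integrable_fin_num measurableT iF)); congr EFin.
  by apply/eqP; rewrite eq_le Fle/= Rintegral_ge0.
by apply: filterS => x /(_ I) [].
Qed.


Section receiver_exchange.
Context d (T : measurableType d) (R : realType) (kmax : nat).
Variable (mu : {finite_measure set T -> \bar R}).
Variables (ft : forall k : 'I_kmax, k.+1.-tuple T -> R) (eta : nat -> R).
Variables (gamma beta c0 Bf : R).
Hypothesis mu_gt0 : (0 < mu setT)%E.
Hypothesis beta_ge0 : 0 <= beta.
Hypothesis c0_eta : forall j, c0 <= eta j.
Hypothesis mft : forall k, measurable_fun setT (@ft k).
Hypothesis ftB : forall k x, `|@ft k x| <= Bf.
Variables (Psi : trajectory_setting kmax mu).
Variables (n : forall k : 'I_kmax, k.+1.-tuple T -> R) (g : nat -> T -> R) (m : T -> R).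
Arguments n : clear implicits.
Hypothesis ed : entropic_density Psi n g m.
Hypothesis minPsi : is_minimizer ft eta gamma beta Psi.
Hypothesis Psi_oo : (objective ft eta gamma beta Psi < +oo)%E.

Let muoo : (mu setT < +oo)%E. Proof. by rewrite -ge0_fin_numE// fin_num_measure. Qed.
Let dg j : is_density mu (ts_mu Psi j) (g j) := (ed_setting ed).2 j.
Let mg j : measurable_fun setT (g j). Proof. by case: (dg j). Qed.
Let g0 j x : 0 <= g j x. Proof. by case: (dg j). Qed.
Let kap j := receiver_potential mu eta beta c0 j.

Lemma three_term_exchange i (phi : T -> R) (dl B : R) : 0 < dl ->
  measurable_fun setT phi -> (forall x, `|phi x| <= B) ->
  (forall x, good_direction dl (g i x) (phi x)) ->
  (forall x, good_direction dl (g i.+1 x) (- 2 * phi x)) ->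
  (forall x, good_direction dl (g i.+2 x) (phi x)) ->
  let b := \int[mu]_x ent_sing (g i x) (phi x) + \int[mu]_x ent_sing (g i.+1 x) (- 2 * phi x)
    + \int[mu]_x ent_sing (g i.+2 x) (phi x) in
  let a := \int[mu]_x ent_reg (g i x) (phi x) + \int[mu]_x ent_reg (g i.+1 x) (- 2 * phi x)
    + \int[mu]_x ent_reg (g i.+2 x) (phi x)
    + (kap i - 2 * kap i.+1 + kap i.+2) * \int[mu]_x phi x in
  b <= 0 /\ (b = 0 -> 0 <= a).
Proof.
move=> dl0 mphi phiB gi gi1 gi2 b a.
pose c (j : nat) : R := if j == i then 1 else if j == i.+1 then -2 else if j == i.+2 then 1 else 0.
have ci : c i = 1 by rewrite /c eqxx.
have ci1 : c i.+1 = -2 by rewrite /c eqn_leq ltnn/= eqxx.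
have ci2 : c i.+2 = 1.
  have e1 : (i.+2 == i) = false by apply/negbTE; lia.
  have e2 : (i.+2 == i.+1) = false by apply/negbTE; lia.
  by rewrite /c e1 e2 eqxx.
have cE j : j != i -> j != i.+1 -> j != i.+2 -> c j = 0.
  by rewrite /c => /negbTE -> /negbTE -> /negbTE ->.
pose u j x := c j * phi x.
have sumE (F : nat -> R) : (forall j, (j < i)%N -> F j = 0) ->
    \sum_(0 <= j < i.+3) F j = F i + F i.+1 + F i.+2.
  move=> Fi; rewrite !big_nat_recr//=; congr (_ + _ + _).
  by rewrite big_nat big1 ?add0r// => j /andP[_ ji]; exact: Fi.
have cl j : (j < i)%N -> c j = 0.
  by move=> ji; apply: cE; lia.
have phi0 x : 0 <= `|phi x| by [].
have nh0 (h : R) : good_direction dl h 0 by left.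
have [||||||||||||||H1 H2] := @first_variation _ T R kmax mu ft eta gamma beta c0 Bf mu_gt0 beta_ge0
  c0_eta mft ftB Psi n g m ed minPsi Psi_oo (fun k => cst 0) u (cst 0) i.+3 dl (2 * B) dl0.
- by move=> k; exact: measurable_cst.
- by move=> j; apply: measurable_funM => //; exact: measurable_cst.
- exact: measurable_cst.
- by move=> k t; rewrite normr0 (le_trans (phi0 point))// (le_trans (phiB _))//; have := le_trans (phi0 point) (phiB point); lra.
- move=> j x; rewrite /u normrM; have B0 := le_trans (phi0 x) (phiB x).
  apply: ler_pM => //; rewrite /c; case: ifP => _; first by rewrite normr1; lra.
  case: ifP => _; first by rewrite normrN ger0_norm.
  by case: ifP => _; rewrite ?normr1 ?normr0; lra.
- by move=> x; rewrite normr0; have := le_trans (phi0 x) (phiB x); lra.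
- by move=> k t; left.
- move=> j x; rewrite /u.
  have [->|ji] := eqVneq j i; first by rewrite ci mul1r.
  have [->|ji1] := eqVneq j i.+1; first by rewrite ci1.
  have [->|ji2] := eqVneq j i.+2; first by rewrite ci2 mul1r.
  by rewrite cE// mul0r; left.
- by move=> x; left.
- move=> j x ij; rewrite /u cE ?mul0r//; lia.
- move=> x; rewrite sumE; last by move=> j /cl cj; rewrite /u cj mul0r.
  by rewrite /u ci ci1 ci2; ring.
- move=> x; rewrite sumE; last by move=> j /cl cj; rewrite /u cj mul0r mulr0.
  by rewrite /u ci ci1 ci2 -!natr1 /cst; ring.
- by move=> A mA; rewrite big1// => k _; rewrite Rintegral_cst ?mul0r//; exact: measurable_preimage_tnth.
- move=> A mA; rewrite Rintegral_cst// mul0r big1// => k _; rewrite big1// => l _.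
  by rewrite Rintegral_cst ?mul0r//; exact: measurable_preimage_tnth.
have S1 : \sum_(k < kmax) \int[power_measure mu k.+1]_t ent_sing (n k t) (cst 0 t) = 0.
  rewrite big1// => k _; under eq_Rintegral do rewrite ent_singr0.
  by rewrite Rintegral_cst// mul0r.
have S2 : \sum_(k < kmax) (\int[power_measure mu k.+1]_t ent_reg (n k t) (cst 0 t) +
    gamma * \int[power_measure mu k.+1]_t (ft t * cst 0 t)) = 0.
  rewrite big1// => k _; under eq_Rintegral do rewrite ent_regr0.
  under [X in _ + _ * X]eq_Rintegral do rewrite mulr0.
  by rewrite Rintegral_cst// mul0r mulr0 addr0.
have S3 : \int[mu]_x ent_sing (m x) (cst 0 x) = 0.
  under eq_Rintegral do rewrite ent_singr0.
  by rewrite Rintegral_cst// mul0r.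
have S4 : \int[mu]_x ent_reg (m x) (cst 0 x) = 0.
  under eq_Rintegral do rewrite ent_regr0.
  by rewrite Rintegral_cst// mul0r.
have iphi : mu.-integrable setT (EFin \o phi) := bounded_integrable muoo mphi phiB.
have Eb : \sum_(0 <= j < i.+3) \int[mu]_x ent_sing (g j x) (u j x) = b.
  rewrite sumE /b /u.
    by rewrite ci ci1 ci2; congr (_ + _ + _); apply: eq_Rintegral => x _; rewrite mul1r.
  move=> j /cl cj; under eq_Rintegral do rewrite cj mul0r ent_singr0.
  by rewrite Rintegral_cst// mul0r.
have Ea : \sum_(0 <= j < i.+3) (\int[mu]_x ent_reg (g j x) (u j x)
    + receiver_potential mu eta beta c0 j * \int[mu]_x u j x) = a.
  rewrite sumE /a /u; last first.
    move=> j /cl cj; under eq_Rintegral do rewrite cj mul0r ent_regr0.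
    under [X in _ + _ * X]eq_Rintegral do rewrite cj mul0r.
    by rewrite Rintegral_cst// mul0r mulr0 addr0.
  rewrite !RintegralZl// ci ci1 ci2 -/(kap i) -/(kap i.+1) -/(kap i.+2).
  have -> : \int[mu]_x ent_reg (g i x) (1 * phi x) = \int[mu]_x ent_reg (g i x) (phi x).
    by apply: eq_Rintegral => x _; rewrite mul1r.
  have -> : \int[mu]_x ent_reg (g i.+2 x) (1 * phi x) = \int[mu]_x ent_reg (g i.+2 x) (phi x).
    by apply: eq_Rintegral => x _; rewrite mul1r.
  by ring.
move: H1 H2; rewrite S1 S2 S3 S4 Eb Ea !subr0 !add0r => H1 H2; exact: (conj H1 H2).
Qed.

Let del N : R := N.+1%:R^-1.
Let del0 N : 0 < del N. Proof. by rewrite invr_gt0. Qed.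

Let range0 j N := [set x | (g j x == 0) || in_range (del N) (g j x)].

Let mrange0 j N : measurable (range0 j N).
Proof.
apply: measurable_bool_set; apply: measurable_or.
  by apply: measurable_fun_eqr => //; exact: measurable_cst.
by apply: measurable_and; apply: measurable_fun_ler => //; exact: measurable_cst.
Qed.

Lemma receiver_neighbors_gt0 i :
  {ae mu, forall x, 0 < g i.+1 x -> 0 < g i x /\ 0 < g i.+2 x}.
Proof.
pose D N := [set x | in_range (del N) (g i.+1 x)] `&` (range0 i N `&` range0 i.+2 N).
pose F N x := ent_sing (g i x) (\1_(D N) x) + ent_sing (g i.+2 x) (\1_(D N) x).
have mD N : measurable (D N).
  by apply: measurableI; [exact: measurable_in_range|exact: measurableI].
have DE N x : \1_(D N) x = 0 :> R \/ (D N x /\ \1_(D N) x = 1 :> R).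
  by rewrite indicE; case: (boolP (x \in D N)); rewrite ?inE; [right|left].
have i1 N x : 0 <= \1_(D N) x :> R by [].
have ind1 N x : `|\1_(D N) x| <= 1 :> R.
  by case: (DE N x) => [->|[_ ->]]; rewrite ?normr0 ?normr1.
have g02 N j : j = i \/ j = i.+2 -> forall x, good_direction (del N) (g j x) (\1_(D N) x).
  move=> ij x; case: (DE N x) => [->|[[_ [Dx Dx2]] ->]]; first by left.
  right; have /orP[/eqP|] : (g j x == 0) || in_range (del N) (g j x) by case: ij => ->.
    by right.
  by left.
have g1 N x : good_direction (del N) (g i.+1 x) (- 2 * \1_(D N) x).
  case: (DE N x) => [->|[[Dx _] _]]; first by left; rewrite mulr0.
  by right; left.
have mI N : measurable_fun setT (\1_(D N) : T -> R) by [].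
have isg N j := ent_sing_integrable muoo (mg j) (mI N) (ind1 N).
have F0 N : {ae mu, forall x, F N x = 0}.
  have ii := isg N i.
  have ii2 := isg N i.+2.
  have iF : mu.-integrable setT (EFin \o F N) by exact: (integrableD measurableT ii ii2).
  apply: ae_eq0_Rintegral_le0 => //.
    by move=> x; rewrite /F /ent_sing addr_ge0//; case: ifP.
  have [+ _] := three_term_exchange (del0 N) (mI N) (ind1 N)
    (g02 N i (or_introl erefl)) (g1 N) (g02 N i.+2 (or_intror erefl)).
  rewrite RintegralD//; set X := \int[mu]_x _; set Y := \int[mu]_x _; set Z := \int[mu]_x _.
  suff -> : Y = 0 by rewrite addr0.
  rewrite /Y; under eq_Rintegral => x _.
    rewrite ent_singE; first over.
    case: (DE N x) => [->|[[Dx _] _]]; first by right; rewrite mulr0.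
    by left; exact: in_range_neq0 (del0 N) Dx.
  by rewrite Rintegral_cst// mul0r.
apply: filterS (ae_foralln F0) => x Fx gi1.
have : \forall N \near \oo, D N x.
  near=> N; split; first by near: N; exact: in_range_near.
  by split; [near: N; exact: in_range_near0|near: N; exact: in_range_near0].
move=> /filter_ex[N DNx]; have := Fx N.
rewrite /F indicE mem_set// /ent_sing !lt0r !g0 !andbT.
by do 2?case: eqP => //=; lra.
Unshelve. all: by end_near. Qed.

Lemma receiver_three_terms i : {ae mu, forall x,
  0 < g i x -> 0 < g i.+1 x -> 0 < g i.+2 x ->
  ln (g i x) - 2 * ln (g i.+1 x) + ln (g i.+2 x) + (kap i - 2 * kap i.+1 + kap i.+2) = 0}.
Proof.
pose K := kap i - 2 * kap i.+1 + kap i.+2.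
pose L x := ln (g i x) - 2 * ln (g i.+1 x) + ln (g i.+2 x) + K.
pose E N := [set x | in_range (del N) (g i x)] `&` ([set x | in_range (del N) (g i.+1 x)] `&`
  [set x | in_range (del N) (g i.+2 x)]).
have mE N : measurable (E N) by do 2?apply: measurableI; exact: measurable_in_range.
have mln j : measurable_fun setT (fun x => ln (g j x)) by exact: measurableT_comp.
have mL : measurable_fun setT L.
  apply: measurable_funD; last exact: measurable_cst.
  apply: measurable_funD => //; apply: measurable_funB => //.
  by apply: measurable_funM => //; exact: measurable_cst.
have LB N x : E N x -> `|L x| <= 4 * `|ln (del N)| + `|K|.
  case=> /(ln_in_range (del0 N)) + [/(ln_in_range (del0 N)) + /(ln_in_range (del0 N))].
  have := ler_norm K; have := ler_norm (- K); rewrite normrN.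
  by rewrite !ler_norml => h1 h2 /andP[h3 h4] /andP[h5 h6] /andP[h7 h8]; apply/andP; split; rewrite /L; lra.
have H N : {ae mu, forall x, E N x -> L x = 0}.
  apply: (ae_eq0_both_signs muoo (mE N) mL (LB N)) => D s mD DE s1.
  pose phi x := s * \1_D x : R.
  have mphi : measurable_fun setT phi by apply: measurable_funM => //; exact: measurable_cst.
  have phiB x : `|phi x| <= 1.
    have s1' : `|s| = 1 by case: s1 => ->; rewrite ?normrN normr1.
    by rewrite normrM s1' mul1r indicE; case: (_ \in _); rewrite ?normr1 ?normr0.
  have phiE x : phi x = 0 \/ E N x.
    rewrite /phi indicE; have [|_] := boolP (x \in D); last by left; rewrite mulr0.
    by rewrite inE => /DE; right.
  have gphi j (c : R) : j = i \/ j = i.+1 \/ j = i.+2 -> forall x,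
      (in_range (del N) (g j x)) \/ c * phi x = 0.
    move=> ij x; case: (phiE x) => [->|[E1 [E2 E3]]]; first by right; rewrite mulr0.
    by left; case: ij => [->|[->|->]].
  have gg j c (ij : j = i \/ j = i.+1 \/ j = i.+2) x :
      good_direction (del N) (g j x) (c * phi x).
    by case: (gphi j c ij x) => [|->]; [right; left|left].
  have ss j c (ij : j = i \/ j = i.+1 \/ j = i.+2) x : ent_sing (g j x) (c * phi x) = 0.
    by rewrite ent_singE//; case: (gphi j c ij x) => [/(in_range_neq0 (del0 N))|]; [left|right].
  have rr j c (ij : j = i \/ j = i.+1 \/ j = i.+2) x :
      ent_reg (g j x) (c * phi x) = c * phi x * (ln (g j x) + 1).
    by rewrite ent_regE//; case: (gphi j c ij x) => [/(in_range_neq0 (del0 N))|]; [left|right].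
  have ir j c (ij : j = i \/ j = i.+1 \/ j = i.+2) :
      mu.-integrable setT (EFin \o (fun x => ent_reg (g j x) (c * phi x))).
    apply: (ent_reg_integrable muoo (mg j) (g0 j) (B := `|c|) _ _ (del0 N) (gg j c ij)).
      by apply: measurable_funM => //; exact: measurable_cst.
    by move=> x; rewrite normrM ler_piMr.
  have i_ := or_introl erefl : i = i \/ i = i.+1 \/ i = i.+2.
  have i1_ := or_intror (or_introl erefl) : i.+1 = i \/ i.+1 = i.+1 \/ i.+1 = i.+2.
  have i2_ := or_intror (or_intror erefl) : i.+2 = i \/ i.+2 = i.+1 \/ i.+2 = i.+2.
  have gone j (ij : j = i \/ j = i.+1 \/ j = i.+2) x : good_direction (del N) (g j x) (phi x) by have := gg j 1 ij x; rewrite mul1r.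
  have sone j (ij : j = i \/ j = i.+1 \/ j = i.+2) x : ent_sing (g j x) (phi x) = 0 by have := ss j 1 ij x; rewrite mul1r.
  have rone j (ij : j = i \/ j = i.+1 \/ j = i.+2) : (fun x => ent_reg (g j x) (phi x)) = (fun x => ent_reg (g j x) (1 * phi x)).
    by apply/funext => x; rewrite mul1r.
  have [_] := three_term_exchange (del0 N) mphi phiB (gone i i_) (gg i.+1 _ i1_) (gone i.+2 i2_).
  have iphi : mu.-integrable setT (EFin \o phi) := bounded_integrable muoo mphi phiB.
  set b := (X in (X = 0 -> _) -> _); have -> : b = 0.
    rewrite /b; under eq_Rintegral do rewrite (sone i i_).
    under [X in _ + X + _]eq_Rintegral do rewrite (ss i.+1 _ i1_).
    under [X in _ + X]eq_Rintegral do rewrite (sone i.+2 i2_).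
    by rewrite Rintegral_cst// mul0r !addr0.
  move=> /(_ erefl); rewrite -/K !(rone _ i_) !(rone _ i2_).
  have iKphi : mu.-integrable setT (EFin \o (fun x => K * phi x)).
    by have := integrableZl measurableT K iphi; apply: eq_integrable.
  rewrite -RintegralZl//.
  have j1 := integrableD measurableT (ir i 1 i_) (ir i.+1 (-2) i1_).
  have j2 := integrableD measurableT j1 (ir i.+2 1 i2_).
  rewrite -(RintegralD measurableT (ir i 1 i_) (ir i.+1 (-2) i1_)).
  rewrite -(RintegralD measurableT j1 (ir i.+2 1 i2_)).
  rewrite -(RintegralD measurableT j2 iKphi).
  rewrite -RintegralZl//; last first.
    apply: (bounded_integrable (B := 4 * `|ln (del N)| + `|K|) muoo) => [|x].
      exact: measurable_funM.
    rewrite indicE; have [|_] := boolP (x \in D).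
      by rewrite inE => /DE /LB; rewrite mul1r.
    by rewrite mul0r normr0 addr_ge0// mulr_ge0.
  congr (_ <= _); apply: eq_Rintegral => x _.
  rewrite (rr i 1 i_) (rr i.+1 (-2) i1_) (rr i.+2 1 i2_) /L /phi; ring.
apply: filterS (ae_foralln H) => x Lx gi gi1 gi2.
have : \forall N \near \oo, E N x.
  by near=> N; do 2?split => /=; near: N; exact: in_range_near.
by move=> /filter_ex[N ENx]; exact: Lx ENx.
Unshelve. all: by end_near. Qed.

End receiver_exchange.


Lemma one_tupleE (T : Type) (t : 1.-tuple T) : t = [tuple tnth t ord0].
Proof. by apply/eq_from_tnth => i; rewrite (ord1 i) (tnth_nth (tnth t ord0)). Qed.

Section cylinder.
Context d (T : measurableType d) (R : realType) (mu : {finite_measure set T -> \bar R}).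

Lemma ae_tnth n (l : 'I_n) (P : T -> Prop) : {ae mu, forall x, P x} ->
  {ae power_measure mu n, forall t, P (tnth t l)}.
Proof.
move=> [N [mN muN PN]]; exists ((fun t => tnth t l) @^-1` N); split.
- exact: measurable_preimage_tnth.
- transitivity (mu N * mu setT ^+ n.-1)%E; first exact: power_measure_cylinder.
  by rewrite [X in (X * _)%E]muN mul0e.
- by move=> t /= Pt; apply: PN.
Qed.

Lemma Rintegral_power_measure1 (F : T -> R) (B : R) : measurable_fun setT F ->
  (forall x, `|F x| <= B) ->
  \int[power_measure mu 1]_t F (tnth t ord0) = \int[mu]_x F x.
Proof.
move=> mF FB; have mt l := @measurable_tnth _ T 1 l.
have lamoo : (power_measure mu 1 setT < +oo)%E := power_measureT_lty mu 1.
have mFt : measurable_fun setT (fun t : 1.-tuple T => F (tnth t ord0)) by exact: measurableT_comp.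
congr fine; apply/esym.
rewrite (eq_measure_integral (pushforward (power_measure mu 1) (fun t => tnth t ord0))).
- rewrite integral_pushforward//; first exact/measurable_EFinP.
  exact: (bounded_integrable lamoo mFt (fun t => FB (tnth t ord0))).
- move=> A mA _; apply/esym.
  by rewrite [LHS](@power_measure_cylinder _ _ _ mu 1 ord0 A mA) mule1.
Qed.

End cylinder.

Section trajectory_exchange.
Context d (T : measurableType d) (R : realType) (kmax : nat).
Variable (mu : {finite_measure set T -> \bar R}).
Variables (ft : forall k : 'I_kmax, k.+1.-tuple T -> R) (eta : nat -> R).
Arguments ft : clear implicits.
Variables (gamma beta c0 Bf : R).
Hypothesis mu_gt0 : (0 < mu setT)%E.
Hypothesis beta_ge0 : 0 <= beta.
Hypothesis c0_eta : forall j, c0 <= eta j.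
Hypothesis mft : forall k, measurable_fun setT (ft k).
Hypothesis ftB : forall k x, `|ft k x| <= Bf.
Arguments mft : clear implicits.
Arguments ftB : clear implicits.
Variables (Psi : trajectory_setting kmax mu).
Variables (n : forall k : 'I_kmax, k.+1.-tuple T -> R) (g : nat -> T -> R) (m : T -> R).
Arguments n : clear implicits.
Hypothesis ed : entropic_density Psi n g m.
Hypothesis minPsi : is_minimizer ft eta gamma beta Psi.
Hypothesis Psi_oo : (objective ft eta gamma beta Psi < +oo)%E.
Hypothesis kmax_gt0 : (0 < kmax)%N.

Let muoo : (mu setT < +oo)%E. Proof. by rewrite -ge0_fin_numE// fin_num_measure. Qed.
Let lamoo (k : 'I_kmax) : (power_measure mu k.+1 setT < +oo)%E := power_measureT_lty mu k.+1.
Let dn (k : 'I_kmax) : is_density (power_measure mu k.+1) (ts_nu Psi k) (n k) :=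
  (ed_setting ed).1 k.
Let dg j : is_density mu (ts_mu Psi j) (g j) := (ed_setting ed).2 j.
Let dm : is_density mu (relay_measure Psi) m := ed_relay ed.
Let mn (k : 'I_kmax) : measurable_fun setT (n k). Proof. by case: (dn k). Qed.
Let mg j : measurable_fun setT (g j). Proof. by case: (dg j). Qed.
Let mm : measurable_fun setT m. Proof. by case: dm. Qed.
Let kap j := receiver_potential mu eta beta c0 j.

Let k0 : 'I_kmax := Ordinal kmax_gt0.
Definition source_density (x : T) : R := n k0 [tuple x].
Definition source_cost (x : T) : R := ft k0 [tuple x].
Local Notation n0 := source_density.
Local Notation f0 := source_cost.

Let mtuple1 : measurable_fun setT (fun x : T => [tuple x]).
Proof.
apply/measurable_fun_tnthP => i; rewrite (ord1 i) (_ : _ \o _ = id)//.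
Qed.

Lemma measurable_source_density : measurable_fun setT n0.
Proof. exact: (measurableT_comp (@mn k0) mtuple1). Qed.

Lemma measurable_source_cost : measurable_fun setT f0.
Proof. exact: (measurableT_comp (mft k0) mtuple1). Qed.

Definition source_potential x := ln (n0 x) + 1 + gamma * f0 x.

Definition relay_potential x := (ln (g 1 x) + kap 1) - (ln (g 0 x) + kap 0) - (ln (m x) + 1).

Definition trajectory_potential (k : 'I_kmax) (t : k.+1.-tuple T) :=
  ln (n k t) + 1 + gamma * ft k t - source_potential (tnth t ord0)
  + \sum_(l < k.+1 | (0 < l)%N) relay_potential (tnth t l).

Lemma measurable_source_potential : measurable_fun setT source_potential.
Proof.
apply: measurable_funD.
  by apply: measurable_funD => //; apply: measurableT_comp => //; exact: measurable_source_density.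
by apply: measurable_funM => //; exact: measurable_source_cost.
Qed.

Lemma measurable_relay_potential : measurable_fun setT relay_potential.
Proof.
have mln (f : T -> R) c : measurable_fun setT f -> measurable_fun setT (fun x => ln (f x) + c).
  by move=> mf; apply: measurable_funD => //; exact: measurableT_comp.
by apply: measurable_funB; [apply: measurable_funB; exact: mln|exact: mln].
Qed.

Section one_exchange.
Variables (k : 'I_kmax) (D : set (k.+1.-tuple T)) (G0 G1 : set T) (s dl : R).
Hypothesis k_gt0 : (0 < k)%N.
Hypothesis dl0 : 0 < dl.
Hypothesis s1 : s = 1 \/ s = -1.
Hypothesis mD : measurable D.
Hypothesis mG0 : measurable G0.
Hypothesis mG1 : measurable G1.
Hypothesis DG0 : forall t, D t -> G0 (tnth t ord0).
Hypothesis DG1 : forall t (l : 'I_k.+1), D t -> (0 < l)%N -> G1 (tnth t l).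
Hypothesis nD : forall t, D t -> in_range dl (n k t) \/ (n k t = 0 /\ 0 <= s).
Hypothesis nG0 : forall x, G0 x -> in_range dl (n0 x) \/ (n0 x = 0 /\ s <= 0).
Hypothesis gG1 : forall x, G1 x -> in_range dl (g 0 x).
Hypothesis gmG1 : forall x, G1 x ->
  (in_range dl (g 1 x) /\ in_range dl (m x)) \/ [/\ g 1 x = 0, m x = 0 & 0 <= s].

Let w : R := fine (mu setT) ^+ k.
Let w0 : 0 <= w. Proof. by rewrite exprn_ge0// fine_ge0. Qed.
Let s_norm : `|s| = 1. Proof. by case: s1 => ->; rewrite ?normrN normr1. Qed.

Let marginals : exists p : 'I_k.+1 -> T -> R, forall l, [/\ measurable_fun setT (p l),
    forall x, 0 <= p l x <= w,
    forall x, ~ (if (0 < l)%N then G1 else G0) x -> p l x = 0,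
    forall A, measurable A -> power_measure mu k.+1 ((fun t => tnth t l) @^-1` A `&` D) =
      (\int[mu]_(x in A) (p l x)%:E)%E &
    forall (h : T -> R) (B : R), measurable_fun setT h ->
      (forall x, (if (0 < l)%N then G1 else G0) x -> `|h x| <= B) ->
      [/\ (power_measure mu k.+1).-integrable setT (EFin \o (fun t => \1_D t * h (tnth t l))),
          mu.-integrable setT (EFin \o (fun x => p l x * h x)) &
          \int[power_measure mu k.+1]_t (\1_D t * h (tnth t l)) =
          \int[mu]_x (p l x * h x)]].
Proof.
have mG (l : 'I_k.+1) : measurable (if (0 < l)%N then G1 else G0) by case: ifP.
have DG (l : 'I_k.+1) t : D t -> (if (0 < l)%N then G1 else G0) (tnth t l).
  move=> Dt; case: ifPn => l0; first exact: DG1.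
  suff -> : l = ord0 by exact: DG0.
  by apply/val_inj; move: l0; rewrite -eqn0Ngt => /eqP.
exists (fun l => projT1 (cid (marginal_density mu mD (mG l) (DG l)))) => l.
exact: projT2 (cid (marginal_density mu mD (mG l) (DG l))).
Qed.

Definition exchange_integrand t : R :=
  \1_D t * ((n k t == 0)%:R - (n0 (tnth t ord0) == 0)%:R).

Lemma trajectory_exchange :
  s * \int[power_measure mu k.+1]_t exchange_integrand t <= 0 /\
  (\int[power_measure mu k.+1]_t exchange_integrand t = 0 ->
    (forall x, G0 x -> n0 x != 0) -> (forall t, D t -> n k t != 0) ->
    (forall x, G1 x -> g 1 x != 0 /\ m x != 0) ->
    0 <= s * \int[power_measure mu k.+1]_t (\1_D t * trajectory_potential t)).
Proof.
have [p Hp] := marginals.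
have mp l : measurable_fun setT (p l) by case: (Hp l).
have p0 l x : 0 <= p l x by case: (Hp l) => _ /(_ x)/andP[].
have pw l x : p l x <= w by case: (Hp l) => _ /(_ x)/andP[].
have pG1 (l : 'I_k.+1) x : (0 < l)%N -> ~ G1 x -> p l x = 0.
  by move=> l0; case: (Hp l) => _ _ H _ _; move: H; rewrite l0; exact.
have pG0 x : ~ G0 x -> p ord0 x = 0 by case: (Hp ord0) => _ _ H _ _; exact: H.
have pI (l : 'I_k.+1) := let: And5 _ _ _ _ H := Hp l in H.
pose v x := s * \sum_(l < k.+1 | (0 < l)%N) p l x.
have mv : measurable_fun setT v.
  apply: measurable_funM; first exact: measurable_cst.
  under eq_fun do rewrite big_mkcond/=.
  by apply: measurable_sum => l; case: (0 < l)%N; [exact: mp|exact: measurable_cst].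
have vG1 x : v x = 0 \/ G1 x.
  have [G|G] := pselect (G1 x); first by right.
  by left; rewrite /v big1 ?mulr0// => l l0; exact: pG1.
have v_ge0 x : 0 <= s -> 0 <= v x.
  by move=> s0; rewrite mulr_ge0//; apply: sumr_ge0.
have vB x : `|v x| <= 1 + k.+1%:R * w.
  rewrite normrM s_norm mul1r ger0_norm; last exact: sumr_ge0.
  apply: (@le_trans _ _ (\sum_(l < k.+1) w)).
    by rewrite big_mkcond; apply: ler_sum => l _; case: ifP.
  by rewrite sumr_const card_ord -[leLHS]mulr_natl lerDr.
pose Dk (k' : 'I_kmax) : set (k'.+1.-tuple T) :=
  [set t | exists2 t' : k.+1.-tuple T, D t' & val t' = val t].
have DkE : Dk k = D.
  by apply/seteqP; split => t /= => [[t' Dt' /val_inj <-]//|Dt]; exists t.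
pose h (k' : 'I_kmax) (t : k'.+1.-tuple T) : R :=
  if k' == k then s * \1_(Dk k') t else
  if k' == k0 then - s * p ord0 (tnth t ord0) else 0.
have kk0 : (k0 == k) = false by apply/negbTE; rewrite -val_eqE/= eq_sym -lt0n.
have hk t : h k t = s * \1_D t by rewrite /h eqxx DkE.
have hk0 t : h k0 t = - s * p ord0 (tnth t ord0) by rewrite /h kk0 eqxx.
have hE (k' : 'I_kmax) t : k' != k -> k' != k0 -> h k' t = 0.
  by rewrite /h => /negbTE -> /negbTE ->.
have sum2 (F : 'I_kmax -> R) : (forall k', k' != k -> k' != k0 -> F k' = 0) ->
    \sum_(k' < kmax) F k' = F k + F k0.
  move=> F0; rewrite (bigD1 k)//= (bigD1 k0)/= ?kk0// big1 ?addr0// => k' /andP[? ?].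
  exact: F0.
pose u (j : nat) x : R := if j == 0%N then - v x else if j == 1%N then v x else 0.
have sumu (F : nat -> R) : \sum_(0 <= j < 2) F j = F 0%N + F 1%N.
  by rewrite !big_nat_recr//= big_nil add0r.
have n0E t : n k0 t = n0 (tnth t ord0) by rewrite /n0 -one_tupleE.
have f0E t : ft k0 t = f0 (tnth t ord0) by rewrite /f0 -one_tupleE.
have n_ge0 (k' : 'I_kmax) t : 0 <= n k' t by case: (dn k').
have B0 : 0 <= k.+1%:R * w by rewrite mulr_ge0.
have w_le : w <= k.+1%:R * w by rewrite ler_peMl// ler1n.
have Iw (S : Type) (E : set S) (x : S) : `|\1_E x| <= 1 :> R.
  by rewrite indicE; case: (_ \in _); rewrite ?normr1 ?normr0.
have mI : measurable_fun setT (\1_D : _ -> R) by [].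
have mpt (l : 'I_k.+1) : measurable_fun setT (fun t : 1.-tuple T => p l (tnth t ord0)).
  by apply: measurableT_comp => //; exact: measurable_tnth.
have mh (k' : 'I_kmax) : measurable_fun setT (h k').
  have [->|kk] := eqVneq k' k.
    rewrite (_ : h k = fun t => s * \1_D t); last by apply/funext.
    by apply: measurable_funM => //; exact: measurable_cst.
  have [->|kk'] := eqVneq k' k0.
    rewrite (_ : h k0 = fun t => - s * p ord0 (tnth t ord0)); last by apply/funext.
    by apply: measurable_funM; [exact: measurable_cst|exact: mpt].
  rewrite (_ : h k' = cst 0); last by apply/funext => t; exact: hE.
  exact: measurable_cst.
have hB (k' : 'I_kmax) t : `|h k' t| <= 1 + k.+1%:R * w.
  have [kk|kk] := eqVneq k' k.
    by subst k'; rewrite hk normrM s_norm mul1r (le_trans (Iw _ _ _))// lerDl.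
  have [kk'|kk'] := eqVneq k' k0; last by rewrite hE// normr0 addr_ge0.
  subst k'; rewrite hk0 normrM normrN s_norm mul1r ger0_norm//.
  by rewrite (le_trans (pw _ _))// (le_trans w_le)// lerDr.
have mu_ j : measurable_fun setT (u j).
  case: j => [|[|j]]; [exact: measurable_funN mv|exact: mv|exact: measurable_cst].
have uB j x : `|u j x| <= 1 + k.+1%:R * w.
  rewrite /u; case: ifP => _; first by rewrite normrN.
  by case: ifP => _ //; rewrite normr0 addr_ge0.
have gh (k' : 'I_kmax) t : good_direction dl (n k' t) (h k' t).
  have [kk|kk] := eqVneq k' k.
    subst k'; rewrite hk indicE; have [|_] := boolP (t \in D); last by left; rewrite mulr0.
    by rewrite inE mulr1 => /nD H; right; case: H => [|[-> ?]]; [left|right].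
  have [kk'|kk'] := eqVneq k' k0; last by left; rewrite hE.
  subst k'; rewrite hk0 n0E; have [G|G] := pselect (G0 (tnth t ord0)); last first.
    by left; rewrite pG0// mulr0.
  right; case: (nG0 G) => [|[-> s0]]; [by left|right].
  by split => //; rewrite mulr_ge0 ?oppr_ge0.
have gu j x : good_direction dl (g j x) (u j x).
  rewrite /u; case: ifP => [/eqP ->|_].
    by case: (vG1 x) => [->|/gG1]; [left; rewrite oppr0|right; left].
  case: ifP => [/eqP ->|_]; last by left.
  by case: (vG1 x) => [->|/gmG1 [[? _]|[-> _ /v_ge0]]]; [left|right; left|right; right].
have gv x : good_direction dl (m x) (v x).
  by case: (vG1 x) => [->|/gmG1 [[_ ?]|[_ -> /v_ge0]]]; [left|right; left|right; right].
have imarg (l : 'I_k.+1) A : measurable A ->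
    \int[power_measure mu k.+1]_(t in (fun t => tnth t l) @^-1` A) (\1_D t) =
    \int[mu]_(x in A) p l x.
  move=> mA; case: (Hp l) => _ _ _ H _; rewrite /Rintegral -(H A mA); congr fine.
  by rewrite integral_indic//; [rewrite setIC|exact: measurable_preimage_tnth].
have ip (l : 'I_k.+1) A : measurable A -> mu.-integrable A (EFin \o p l).
  move=> mA; apply: (integrableS measurableT mA (@subsetT _ A)).
  by apply: (bounded_integrable muoo (mp l) (B := w)) => x; rewrite ger0_norm.
have iD A : measurable A -> (power_measure mu k.+1).-integrable A (EFin \o \1_D).
  move=> mA; apply: (integrableS measurableT mA (@subsetT _ A)).
  by apply: (bounded_integrable (lamoo k) (B := 1)).
have hk_int A : measurable A -> \int[power_measure mu k.+1]_(t in A) h k t =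
    s * \int[power_measure mu k.+1]_(t in A) \1_D t.
  move=> mA; rewrite -RintegralZl//; last exact: iD.
  by apply: eq_Rintegral => t _; rewrite hk.
have hk0_int A : measurable A ->
    \int[power_measure mu k0.+1]_(t in (fun t => tnth t ord0) @^-1` A) h k0 t =
    - s * \int[mu]_(x in A) p ord0 x.
  move=> mA; rewrite Rintegral_indicE -RintegralZl//; last exact: ip.
  under eq_Rintegral do rewrite hk0.
  rewrite [RHS]Rintegral_indicE.
  apply: (@Rintegral_power_measure1 _ T R mu (fun x => \1_A x * (- s * p ord0 x)) w).
    by apply: measurable_funM => //; apply: measurable_funM => //; exact: measurable_cst.
  move=> x; rewrite !normrM normrN s_norm mul1r (ger0_norm (p0 _ _)).
  by rewrite (le_trans _ (pw ord0 x))// ler_piMl.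
have [|||||H1 H2] := first_variation mu_gt0 beta_ge0 c0_eta mft ftB ed minPsi Psi_oo dl0
  mh mu_ mv hB uB vB gh gu gv (J := 2).
- by move=> [|[|j]] x.
- by move=> x; rewrite sumu /u/=; ring.
- by move=> x; rewrite sumu /u/=; ring.
- move=> A mA; rewrite sum2; last first.
    move=> k' kk kk'; under eq_Rintegral do rewrite hE//.
    by rewrite Rintegral_cst ?mul0r//; exact: measurable_preimage_tnth.
  rewrite hk_int; last exact: measurable_preimage_tnth.
  by rewrite imarg// [X in _ + X](hk0_int A mA); ring.
- move=> A mA; rewrite sum2; last first.
    move=> k' kk kk'; rewrite big1// => l l0; under eq_Rintegral do rewrite hE//.
    by rewrite Rintegral_cst ?mul0r//; exact: measurable_preimage_tnth.
  rewrite [X in _ + X]big1 ?addr0; last by move=> [[]].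
  rewrite RintegralZl//; last first.
    have := integrable_sum mA (index_enum 'I_k.+1) (P := fun l : 'I_k.+1 => (0 < l)%N)
      (fun l _ => ip l A mA).
    by apply: eq_integrable => // x _; rewrite /= sumEFin.
  rewrite Rintegral_sum//; last by move=> l _; exact: ip.
  rewrite mulr_sumr; apply: eq_bigr => l l0.
  by rewrite hk_int ?imarg//; exact: measurable_preimage_tnth.
have mn0 := measurable_source_density.
have mz0 : measurable_fun setT (fun x => (n0 x == 0)%:R : R).
  rewrite (_ : (fun x => _) = \1_[set x | n0 x == 0]); last first.
    by apply/funext => x; rewrite indicE mem_setE.
  by apply: measurable_indic; exact: measurable_eq0.
have mzk : measurable_fun setT (fun t => (n k t == 0)%:R : R).
  rewrite (_ : (fun t => _) = \1_[set t | n k t == 0]); last first.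
    by apply/funext => t; rewrite indicE mem_setE.
  by apply: measurable_indic; exact: (measurable_eq0 (@mn k)).
have natB (b : bool) : `|b%:R| <= 1 :> R by rewrite normr_nat lern1 leq_b1.
have [iz0 _ Ez0] := pI ord0 _ 1 mz0 (fun x _ => natB (n0 x == 0)).
have izk : (power_measure mu k.+1).-integrable setT (EFin \o (fun t => \1_D t * (n k t == 0)%:R)).
  apply: (bounded_integrable (lamoo k) (B := 1)); first exact: measurable_funM.
  by move=> t; rewrite normrM mulr_ile1.
have Eb : \sum_(k' < kmax) \int[power_measure mu k'.+1]_t ent_sing (n k' t) (h k' t)
    + \sum_(0 <= j < 2) \int[mu]_x ent_sing (g j x) (u j x) - \int[mu]_x ent_sing (m x) (v x) =
    s * \int[power_measure mu k.+1]_t exchange_integrand t.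
  rewrite sum2; last first.
    move=> k' kk kk'; under eq_Rintegral do rewrite hE// ent_singr0.
    by rewrite Rintegral_cst// mul0r.
  have -> : \int[power_measure mu k.+1]_t ent_sing (n k t) (h k t) =
      s * \int[power_measure mu k.+1]_t (\1_D t * (n k t == 0)%:R).
    rewrite -RintegralZl//; apply: eq_Rintegral => t _; rewrite hk /ent_sing.
    by case: ifP => _; rewrite ?mulr1// !mulr0.
  have Es0 : \int[power_measure mu k0.+1]_t ent_sing (n k0 t) (h k0 t) =
      - s * \int[mu]_x (p ord0 x * (n0 x == 0)%:R).
    rewrite -RintegralZl//; last by case: (pI ord0 _ 1 mz0 (fun x _ => natB (n0 x == 0))).
    transitivity (\int[power_measure mu 1]_t
        (- s * (p ord0 (tnth t ord0) * (n0 (tnth t ord0) == 0)%:R))).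
      apply: eq_Rintegral => t _; rewrite hk0 n0E /ent_sing.
      by case: ifP => _; rewrite ?mulr1// !mulr0.
    apply: (@Rintegral_power_measure1 _ T R mu
      (fun x => - s * (p ord0 x * (n0 x == 0)%:R)) w).
      apply: measurable_funM; first exact: measurable_cst.
      exact: measurable_funM (mp ord0) mz0.
    move=> x; rewrite !normrM normrN s_norm mul1r (ger0_norm (p0 _ _)).
    by rewrite (le_trans _ (pw ord0 x))// ler_piMr.
  rewrite [X in _ + X + _ - _ = _]Es0 -Ez0 sumu.
  have -> : \int[mu]_x ent_sing (g 0 x) (u 0%N x) = 0.
    under eq_Rintegral => x _.
      rewrite ent_singE; first over.
      rewrite /u/=; case: (vG1 x) => [->|/gG1 /(in_range_neq0 dl0)]; last by left.
      by right; rewrite oppr0.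
    by rewrite Rintegral_cst// mul0r.
  have -> : \int[mu]_x ent_sing (g 1 x) (u 1%N x) = \int[mu]_x ent_sing (m x) (v x).
    apply: eq_Rintegral => x _; rewrite /u/=.
    case: (vG1 x) => [->|/gmG1 [[/(in_range_neq0 dl0) g1 /(in_range_neq0 dl0) m1]|[g1 m1 _]]].
    - by rewrite !ent_singr0.
    - by rewrite !ent_singE//; left.
    - by rewrite g1 m1.
  have -> : \int[power_measure mu k.+1]_t exchange_integrand t =
      \int[power_measure mu k.+1]_t (\1_D t * (n k t == 0)%:R) -
      \int[power_measure mu k.+1]_t (\1_D t * (n0 (tnth t ord0) == 0)%:R).
    by rewrite -RintegralB//; apply: eq_Rintegral => t _; rewrite -mulrBr.
  by ring.
move: H1 H2; rewrite Eb => H1 H2; split; first exact: H1.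
move=> q0 n0_neq0 nk_neq0 gm_neq0.
have := H2 (etrans (f_equal _ q0) (mulr0 s)).
rewrite sum2; last first.
  move=> k' kk kk'; under eq_Rintegral do rewrite hE// ent_regr0.
  under [X in _ + _ * X]eq_Rintegral do rewrite hE// mulr0.
  by rewrite Rintegral_cst// mul0r mulr0 addr0.
have ln1B x : in_range dl x -> `|ln x + 1| <= `|ln dl| + 1.
  by move=> /(ln_in_range dl0) H; rewrite (le_trans (ler_normD _ _))// normr1 lerD2r.
have mln1 dS (S : measurableType dS) (f : S -> R) : measurable_fun setT f ->
    measurable_fun setT (fun x => ln (f x) + 1).
  by move=> mf; apply: measurable_funD => //; exact: measurableT_comp.
have D_range t : D t -> in_range dl (n k t).
  by move=> Dt; case: (nD Dt) => // -[n00]; have := nk_neq0 t Dt; rewrite n00 eqxx.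
have G0_range x : G0 x -> in_range dl (n0 x).
  by move=> G0x; case: (nG0 G0x) => // -[n00]; have := n0_neq0 x G0x; rewrite n00 eqxx.
have G1_range x : G1 x -> in_range dl (g 1 x) /\ in_range dl (m x).
  move=> G1x; case: (gmG1 G1x) => // -[g10].
  by case: (gm_neq0 x G1x); rewrite g10 eqxx.
have DB (F : k.+1.-tuple T -> R) (C : R) : measurable_fun setT F -> (forall t, D t -> `|F t| <= C) ->
    (power_measure mu k.+1).-integrable setT (EFin \o (fun t => \1_D t * F t)).
  move=> mF FC; apply: (bounded_integrable (lamoo k) (B := `|C|)).
    exact: measurable_funM.
  move=> t; rewrite indicE; have [|_] := boolP (t \in D); last by rewrite mul0r normr0.
  by rewrite inE mul1r => /FC H; rewrite (le_trans H)// ler_norm.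
have i1 := DB (fun t => ln (n k t) + 1) _ (mln1 _ _ _ (@mn k)) (fun t Dt => ln1B _ (D_range t Dt)).
have i2 := DB (ft k) Bf (mft k) (fun t _ => ftB k t).
have [i3 _ E3] := pI ord0 _ _ (mln1 _ _ _ mn0) (fun x G => ln1B _ (G0_range x G)).
have mf0 := measurable_source_cost.
have f0B x : `|f0 x| <= Bf by exact: ftB.
have [i4 _ E4] := pI ord0 _ _ mf0 (fun x _ => f0B x).
have p_abs x : `|- s * p ord0 x| <= w by rewrite normrM normrN s_norm mul1r ger0_norm.
have mps : measurable_fun setT (fun x => - s * p ord0 x).
  by apply: measurable_funM => //; exact: measurable_cst.
have -> : \int[power_measure mu k.+1]_t ent_reg (n k t) (h k t) =
    s * \int[power_measure mu k.+1]_t (\1_D t * (ln (n k t) + 1)).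
  rewrite -RintegralZl//; apply: eq_Rintegral => t _; rewrite hk ent_regE ?mulrA//.
  rewrite indicE; have [|_] := boolP (t \in D); last by right; rewrite mulr0.
  by rewrite inE => /D_range /(in_range_neq0 dl0); left.
have -> : \int[power_measure mu k.+1]_t (ft k t * h k t) =
    s * \int[power_measure mu k.+1]_t (\1_D t * ft k t).
  by rewrite -RintegralZl//; apply: eq_Rintegral => t _; rewrite hk; ring.
have F3 : \int[power_measure mu k0.+1]_t ent_reg (n k0 t) (h k0 t) =
    - s * \int[mu]_x (p ord0 x * (ln (n0 x) + 1)).
  rewrite -RintegralZl//; last by case: (pI ord0 _ _ (mln1 _ _ _ mn0) (fun x G => ln1B _ (G0_range x G))).
  transitivity (\int[power_measure mu 1]_t
      (- s * (p ord0 (tnth t ord0) * (ln (n0 (tnth t ord0)) + 1)))).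
    apply: eq_Rintegral => t _; rewrite hk0 n0E ent_regE ?mulrA//.
    have [/G0_range/(in_range_neq0 dl0)|/pG0 ->] := pselect (G0 (tnth t ord0)); first by left.
    by right; rewrite mulr0.
  apply: (@Rintegral_power_measure1 _ T R mu
    (fun x => - s * (p ord0 x * (ln (n0 x) + 1))) (w * (`|ln dl| + 1))).
    apply: measurable_funM; first exact: measurable_cst.
    exact: measurable_funM (mp ord0) (mln1 _ _ _ mn0).
  move=> x; rewrite mulrA normrM; have [/G0_range H|/pG0 ->] := pselect (G0 x).
    by apply: ler_pM => //; exact: ln1B.
  by rewrite mulr0 normr0 mul0r mulr_ge0// addr_ge0.
have F4 : \int[power_measure mu k0.+1]_t (ft k0 t * h k0 t) =
    - s * \int[mu]_x (p ord0 x * f0 x).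
  rewrite -RintegralZl//; last by case: (pI ord0 _ _ mf0 (fun x _ => f0B x)).
  transitivity (\int[power_measure mu 1]_t
      (- s * (p ord0 (tnth t ord0) * f0 (tnth t ord0)))).
    by apply: eq_Rintegral => t _; rewrite hk0 f0E; ring.
  apply: (@Rintegral_power_measure1 _ T R mu (fun x => - s * (p ord0 x * f0 x)) (w * Bf)).
    apply: measurable_funM; first exact: measurable_cst.
    exact: measurable_funM (mp ord0) mf0.
  by move=> x; rewrite mulrA normrM ler_pM.
rewrite [X in _ + (X + _) + _ - _]F3 [X in _ + (_ + _ * X) + _ - _]F4 -E3 -E4 sumu.
have vI (psi : T -> R) C : measurable_fun setT psi -> (forall x, G1 x -> `|psi x| <= C) ->
    [/\ mu.-integrable setT (EFin \o (fun x => v x * psi x)),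
      forall l : 'I_k.+1, (0 < l)%N -> (power_measure mu k.+1).-integrable setT
        (EFin \o (fun t => \1_D t * psi (tnth t l))) &
      \int[mu]_x (v x * psi x) = s * \sum_(l < k.+1 | (0 < l)%N)
        \int[power_measure mu k.+1]_t (\1_D t * psi (tnth t l))].
  move=> mpsi psiC.
  have psiC' (l : 'I_k.+1) : (0 < l)%N ->
      forall x, (if (0 < l)%N then G1 else G0) x -> `|psi x| <= C by move=> ->.
  have il (l : 'I_k.+1) (l0 : (0 < l)%N) := pI l psi C mpsi (psiC' l l0).
  have isum : mu.-integrable setT
      (EFin \o (fun x => \sum_(l < k.+1 | (0 < l)%N) p l x * psi x)).
    have := integrable_sum measurableT (index_enum 'I_k.+1) (P := fun l : 'I_k.+1 => (0 < l)%N)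
      (h := fun l => EFin \o (fun x => p l x * psi x))
      (fun l l0 => let: And3 _ H _ := il l l0 in H).
    by apply: eq_integrable => // x _; rewrite /= sumEFin.
  have vpsi x : v x * psi x = s * \sum_(l < k.+1 | (0 < l)%N) p l x * psi x.
    by rewrite /v -mulrA mulr_suml.
  split.
  - have := integrableZl measurableT s isum; apply: eq_integrable => // x _.
    by rewrite /= vpsi.
  - by move=> l l0; case: (il l l0).
  - under eq_Rintegral do rewrite vpsi.
    rewrite RintegralZl// Rintegral_sum//; last by move=> l l0; case: (il l l0).
    by congr (_ * _); apply: eq_bigr => l l0; case: (il l l0).
have [w1 _ _] := vI _ _ (mln1 _ _ _ (@mg 1%N)) (fun x G => ln1B _ (G1_range x G).1).
have [w0' _ _] := vI _ _ (mln1 _ _ _ (@mg 0%N)) (fun x G => ln1B _ (gG1 G)).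
have [wm _ _] := vI _ _ (mln1 _ _ _ mm) (fun x G => ln1B _ (G1_range x G).2).
have iv : mu.-integrable setT (EFin \o v) := bounded_integrable muoo mv vB.
have reg (f : T -> R) (G : forall x, G1 x -> in_range dl (f x)) x :
    ent_reg (f x) (v x) = v x * (ln (f x) + 1).
  by rewrite ent_regE//; case: (vG1 x) => [|/G /(in_range_neq0 dl0)]; [right|left].
have rpB x : G1 x -> `|relay_potential x| <= 3 * `|ln dl| + (`|kap 1| + `|kap 0| + 1).
  move=> G1x; have := ln_in_range dl0 (gG1 G1x); have [r1 rm] := G1_range x G1x.
  have := ln_in_range dl0 r1; have := ln_in_range dl0 rm.
  have := ler_norm (kap 1%N); have := ler_norm (- kap 1%N); have := ler_norm (kap 0%N).
  have := ler_norm (- kap 0%N); rewrite !normrN !ler_norml /relay_potential -/(kap 1) -/(kap 0).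
  move=> ? ? ? ? /andP[? ?] /andP[? ?] /andP[? ?]; apply/andP; split; lra.
have [_ irp Erp] := vI _ _ measurable_relay_potential rpB.
have -> : \int[mu]_x ent_reg (g 0 x) (u 0%N x) = - \int[mu]_x (v x * (ln (g 0 x) + 1)).
  rewrite -[RHS]mulN1r -RintegralZl//; apply: eq_Rintegral => x _; rewrite /u/= ent_regE.
    by rewrite mulN1r mulNr.
  by case: (vG1 x) => [->|/gG1 /(in_range_neq0 dl0)]; [right; rewrite oppr0|left].
have -> : \int[mu]_x u 0%N x = - \int[mu]_x v x.
  by rewrite -[RHS]mulN1r -RintegralZl//; apply: eq_Rintegral => x _; rewrite mulN1r.
have -> : \int[mu]_x ent_reg (g 1 x) (u 1%N x) = \int[mu]_x (v x * (ln (g 1 x) + 1)).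
  by apply: eq_Rintegral => x _; rewrite /u/= (reg (g 1) (fun x G => (G1_range x G).1)).
have -> : \int[mu]_x ent_reg (m x) (v x) = \int[mu]_x (v x * (ln (m x) + 1)).
  by apply: eq_Rintegral => x _; rewrite (reg m (fun x G => (G1_range x G).2)).
rewrite -/(kap 0) -/(kap 1) (_ : \int[mu]_x u 1%N x = \int[mu]_x v x)//.
have Ev : \int[mu]_x (v x * relay_potential x) = \int[mu]_x (v x * (ln (g 1 x) + 1))
    - \int[mu]_x (v x * (ln (g 0 x) + 1)) - \int[mu]_x (v x * (ln (m x) + 1))
    + (kap 1 - kap 0) * \int[mu]_x v x.
  have iz := integrableZl measurableT (kap 1 - kap 0) iv.
  have j1 := integrableB measurableT w1 w0'.
  have j2 := integrableB measurableT j1 wm.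
  rewrite -(RintegralB measurableT w1 w0') -(RintegralB measurableT j1 wm).
  rewrite -RintegralZl// -(RintegralD measurableT j2 iz).
  by apply: eq_Rintegral => x _; rewrite /relay_potential -/(kap 1) -/(kap 0); ring.
have Et : \int[power_measure mu k.+1]_t (\1_D t * trajectory_potential t) =
    \int[power_measure mu k.+1]_t (\1_D t * (ln (n k t) + 1)) +
    gamma * \int[power_measure mu k.+1]_t (\1_D t * ft k t) -
    (\int[power_measure mu k.+1]_t (\1_D t * (ln (n0 (tnth t ord0)) + 1)) +
     gamma * \int[power_measure mu k.+1]_t (\1_D t * f0 (tnth t ord0))) +
    \sum_(l < k.+1 | (0 < l)%N)
      \int[power_measure mu k.+1]_t (\1_D t * relay_potential (tnth t l)).
  have z2 := integrableZl measurableT gamma i2.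
  have z4 := integrableZl measurableT gamma i4.
  have j1 := integrableD measurableT i1 z2.
  have j2 := integrableD measurableT i3 z4.
  have j3 := integrableB measurableT j1 j2.
  have j4 := integrable_sum measurableT (index_enum 'I_k.+1) (P := fun l : 'I_k.+1 => (0 < l)%N) irp.
  rewrite -!RintegralZl// -Rintegral_sum//.
  rewrite -(RintegralD measurableT i1 z2) -(RintegralD measurableT i3 z4).
  rewrite -(RintegralB measurableT j1 j2) -RintegralD//; last first.
    by apply: eq_integrable j4 => // t _; rewrite /= sumEFin.
  apply: eq_Rintegral => t _.
  by rewrite /trajectory_potential /source_potential -mulr_sumr; ring.
rewrite Et !mulrDr -Erp Ev; congr (_ <= _); ring.
Qed.
End one_exchange.

End trajectory_exchange.


Lemma nneseries_term_le (R : realType) (x : nat -> \bar R) j : (forall i, 0 <= x i)%E ->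
  (x j <= \sum_(0 <= i <oo) x i)%E.
Proof.
by move=> x0; rewrite (nneseriesD1 (n := j))//; apply: leeDl; apply: nneseries_ge0.
Qed.

Lemma dominates_ae d (T : measurableType d) (R : realType) (nu mu : {measure set T -> \bar R})
    (P : T -> Prop) : nu `<< mu -> {ae mu, forall x, P x} -> {ae nu, forall x, P x}.
Proof.
move=> /null_content_dominatesP numu [N [mN muN PN]]; exists N; split => //.
exact: numu.
Qed.

Section positivity.
Context d (T : measurableType d) (R : realType) (kmax : nat).
Variable (mu : {finite_measure set T -> \bar R}).
Variables (ft : forall k : 'I_kmax, k.+1.-tuple T -> R) (eta : nat -> R).
Arguments ft : clear implicits.
Variables (gamma beta c0 Bf : R).
Hypothesis mu_gt0 : (0 < mu setT)%E.
Hypothesis beta_ge0 : 0 <= beta.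
Hypothesis c0_eta : forall j, c0 <= eta j.
Hypothesis mft : forall k, measurable_fun setT (ft k).
Hypothesis ftB : forall k x, `|ft k x| <= Bf.
Arguments mft : clear implicits.
Arguments ftB : clear implicits.
Variables (Psi : trajectory_setting kmax mu).
Variables (n : forall k : 'I_kmax, k.+1.-tuple T -> R) (g : nat -> T -> R) (m : T -> R).
Arguments n : clear implicits.
Hypothesis ed : entropic_density Psi n g m.
Hypothesis minPsi : is_minimizer ft eta gamma beta Psi.
Hypothesis Psi_oo : (objective ft eta gamma beta Psi < +oo)%E.
Hypothesis kmax_gt1 : (1 < kmax)%N.

Let kmax_gt0 : (0 < kmax)%N := ltnW kmax_gt1.
Let muoo : (mu setT < +oo)%E. Proof. by rewrite -ge0_fin_numE// fin_num_measure. Qed.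
Let lamoo (k : 'I_kmax) : (power_measure mu k.+1 setT < +oo)%E := power_measureT_lty mu k.+1.
Let dn (k : 'I_kmax) : is_density (power_measure mu k.+1) (ts_nu Psi k) (n k) :=
  (ed_setting ed).1 k.
Let dg j : is_density mu (ts_mu Psi j) (g j) := (ed_setting ed).2 j.
Let dm : is_density mu (relay_measure Psi) m := ed_relay ed.
Let mn (k : 'I_kmax) : measurable_fun setT (n k). Proof. by case: (dn k). Qed.
Let mg j : measurable_fun setT (g j). Proof. by case: (dg j). Qed.
Let mm : measurable_fun setT m. Proof. by case: dm. Qed.
Let n_ge0 (k : 'I_kmax) t : 0 <= n k t. Proof. by case: (dn k). Qed.
Let g_ge0 j x : 0 <= g j x. Proof. by case: (dg j). Qed.
Let m_ge0 x : 0 <= m x. Proof. by case: dm. Qed.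
Local Notation lam k := (power_measure mu (nat_of_ord k).+1).
Local Notation n0 := (source_density n kmax_gt0).
Let mn0 : measurable_fun setT n0 := measurable_source_density ed kmax_gt0.
Let del N : R := N.+1%:R^-1.
Let del0 N : 0 < del N. Proof. by rewrite invr_gt0. Qed.

Lemma receivers_pos : {ae mu, forall x,
  (0 < m x -> forall j, 0 < g j x) /\ (m x = 0 -> g 1 x = 0 /\ 0 < g 0 x)}.
Proof.
have H := ae_foralln (receiver_neighbors_gt0 mu_gt0 beta_ge0 c0_eta mft ftB ed minPsi Psi_oo).
apply: filterS3 H (receivers_ae dg) (relays_ae dg dm) => x nb s1 sm.
have jg0 j : (0 <= (j%:R * g j x)%:E)%E by rewrite lee_fin mulr_ge0.
split=> [mx j|mx].
  have [i gi] : exists i, 0 < g i.+1 x.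
    apply: contrapT => /forallNP H'; have : (\sum_(0 <= j <oo) (j%:R * g j x)%:E = 0)%E.
      apply: eseries0 => -[|i] _ _; first by rewrite mul0r.
      have /negP := H' i; rewrite -leNgt => gi.
      by rewrite (_ : g i.+1 x = 0) ?mulr0//; apply/eqP; rewrite eq_le gi g_ge0.
    by rewrite sm => -[] mx0; rewrite mx0 ltxx in mx.
  have up N : 0 < g (i.+1 + N)%N x.
    elim: N => [|N IH]; first by rewrite addn0.
    by move: IH; rewrite addSn addnS => /nb[].
  have down N : forall j, (j <= N.+1)%N -> 0 < g N.+1 x -> 0 < g j x.
    elim: N => [|N IH] j'.
      by case: j' => [_ /nb[]|[|]//].
    rewrite leq_eqVlt => /predU1P[->//|jN] gN; apply: IH => //.
    by case: (nb _ gN).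
  have [ji|ij] := leqP j i.+1; first exact: down ji gi.
  by rewrite -(subnKC (ltnW ij)).
have gj j : g j.+1 x = 0.
  have := nneseries_term_le j.+1 jg0; rewrite sm mx lee_fin => H'.
  apply/eqP; rewrite eq_le g_ge0 andbT; move: H'.
  by rewrite pmulr_rle0// ltr0n.
split; first exact: gj.
rewrite lt0r g_ge0 andbT; apply/eqP => g00.
have : (\sum_(0 <= j <oo) (g j x)%:E = 0)%E by apply: eseries0 => -[|i] _ _; rewrite ?g00 ?gj.
by rewrite s1 => -[] /eqP; rewrite oner_eq0.
Qed.

Lemma measurable_forall_tnth k (G : set T) : measurable G ->
  measurable [set t : k.+1.-tuple T | forall l : 'I_k.+1, (0 < l)%N -> G (tnth t l)].
Proof.
move=> mG; rewrite (_ : [set t | _] = \bigcap_(l in [set l : 'I_k.+1 | (0 < l)%N])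
  ((fun t : k.+1.-tuple T => tnth t l) @^-1` G)); last by [].
by apply: fin_bigcap_measurable => // l _; exact: measurable_preimage_tnth.
Qed.

Lemma exchange_null (k : 'I_kmax) (Q : set (k.+1.-tuple T)) (G0 G1 : set T) (s : R) N :
  (0 < k)%N -> measurable Q -> measurable G0 -> measurable G1 ->
  [/\ s = 1, (forall t, Q t -> n k t = 0) & (forall x, G0 x -> in_range (del N) (n0 x))] \/
  [/\ s = -1, (forall t, Q t -> in_range (del N) (n k t)) & (forall x, G0 x -> n0 x = 0)] ->
  (forall x, G1 x -> in_range (del N) (g 0 x)) ->
  (forall x, G1 x -> (in_range (del N) (g 1 x) /\ in_range (del N) (m x)) \/
    [/\ g 1 x = 0, m x = 0 & 0 <= s]) ->
  {ae lam k, forall t, ~ [/\ Q t, G0 (tnth t ord0) &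
    forall l : 'I_k.+1, (0 < l)%N -> G1 (tnth t l)]}.
Proof.
move=> k_gt0 mQ mG0 mG1 HQ gG1 gmG1.
pose D := Q `&` [set t | G0 (tnth t ord0)] `&`
  [set t : k.+1.-tuple T | forall l : 'I_k.+1, (0 < l)%N -> G1 (tnth t l)].
have mD : measurable D.
  apply: measurableI; last exact: measurable_forall_tnth.
  by apply: measurableI => //; exact: (measurable_preimage_tnth ord0 mG0).
have s1 : s = 1 \/ s = -1 by case: HQ => -[-> _ _]; [left|right].
have [||||Hq _] := trajectory_exchange mu_gt0 beta_ge0 c0_eta mft ftB ed minPsi Psi_oo
  (kmax_gt0 := kmax_gt0) k_gt0 (del0 N) s1 mD mG0 mG1 _ _ _ _ gG1 gmG1.
- by move=> t [[]].
- by move=> t l [_]; exact.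
- by move=> t [[Qt _] _]; case: HQ => -[-> H1 _]; [right; rewrite H1|left; exact: H1].
- move=> x G0x; case: HQ => -[-> _ H2]; first by left; exact: H2.
  by right; rewrite H2//; split => //; lra.
have e1 t : exchange_integrand n kmax_gt0 D t = s * \1_D t.
  rewrite /exchange_integrand indicE.
  have [|_] := boolP (t \in D); last by rewrite mul0r mulr0.
  rewrite inE => -[[Qt G0t] _]; case: HQ => -[-> H1 H2].
    by rewrite (H1 _ Qt) eqxx (negbTE (in_range_neq0 (del0 N) (H2 _ G0t))) subr0.
  by rewrite (H2 _ G0t) eqxx (negbTE (in_range_neq0 (del0 N) (H1 _ Qt))) sub0r mul1r mulr1.
have iD : (lam k).-integrable setT (EFin \o \1_D).
  apply: (bounded_integrable (lamoo k) (B := 1)) => // t.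
  by rewrite indicE; case: (_ \in _); rewrite ?normr1 ?normr0.
have : {ae lam k, forall t, (\1_D t : R) = 0}.
  apply: ae_eq0_Rintegral_le0 => //.
  move: Hq; under eq_Rintegral do rewrite e1.
  by rewrite RintegralZl// mulrA; case: s1 => ->; rewrite ?mulrNN !mul1r.
apply: filterS => t; rewrite indicE => Dt [Qt G0t G1t].
by move: Dt; rewrite mem_set ?oner_eq0//; apply/eqP; rewrite oner_eq0.
Qed.

Let reg N := [set x | in_range (del N) (g 0 x)] `&`
  ([set x | in_range (del N) (g 1 x)] `&` [set x | in_range (del N) (m x)]).

Let mreg N : measurable (reg N).
Proof. by do 2?apply: measurableI; exact: measurable_in_range. Qed.

Let reg0 N x : reg N x -> in_range (del N) (g 0 x). Proof. by case. Qed.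

Let reg1 (s : R) N x : reg N x -> (in_range (del N) (g 1 x) /\ in_range (del N) (m x)) \/
  [/\ g 1 x = 0, m x = 0 & 0 <= s].
Proof. by move=> [_ [? ?]]; left. Qed.

Let reg_near x : 0 < g 0 x -> 0 < g 1 x -> 0 < m x -> \forall N \near \oo, reg N x.
Proof.
move=> g0x g1x mx; near=> N; split; first by near: N; exact: in_range_near.
by split; near: N; exact: in_range_near.
Unshelve. all: by end_near. Qed.

Let reg_near_all k (t : k.+1.-tuple T) :
  (forall l : 'I_k.+1, (0 < l)%N -> [/\ 0 < g 0 (tnth t l), 0 < g 1 (tnth t l) & 0 < m (tnth t l)]) ->
  \forall N \near \oo, forall l : 'I_k.+1, (0 < l)%N -> reg N (tnth t l).
Proof.
move=> H; apply: filter_forall => l; have [l0|l0] := boolP (0 < l)%N.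
  by have [h1 h2 h3] := H l l0; apply: filterS (reg_near h1 h2 h3) => N HN _.
by apply: nearW => N.
Qed.

Lemma source_pos : {ae mu, forall x, 0 < n0 x}.
Proof.
pose Z := [set x | n0 x == 0].
have mZ : measurable Z by exact: measurable_eq0.
have nuZ (k : 'I_kmax) : {ae lam k, forall t, n0 (tnth t ord0) = 0 -> n k t = 0}.
  have [k_gt0|] := ltnP 0%N k; last first.
    rewrite leqn0 => /eqP kz; have -> : k = Ordinal kmax_gt0 by apply/val_inj.
    by apply: aeW => t; rewrite /source_density -one_tupleE.
  have H N : {ae lam k, forall t, ~ [/\ in_range (del N) (n k t), n0 (tnth t ord0) == 0 &
      forall l : 'I_k.+1, (0 < l)%N -> reg N (tnth t l)]}.
    apply: (@exchange_null k [set t | in_range (del N) (n k t)] Z (reg N) (-1) N) => //.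
    - exact: (measurable_in_range _ (@mn k)).
    - by right; split => // x /eqP.
    - exact: reg0.
    - exact: reg1.
  have e1 : {ae lam k, forall t, forall l : 'I_k.+1,
      (0 < m (tnth t l) -> forall j, 0 < g j (tnth t l)) /\
      ((0 < l)%N -> m (tnth t l) = 0 -> n k t = 0)}.
    apply: filter_forall => l; apply: filterI.
      by apply: filterS (ae_tnth l receivers_pos) => t [].
    have [l0|l0] := boolP (0 < l)%N; last by apply: aeW.
    by apply: filterS (nu_density_eq0 dm (dn k) l0) => t Ht _.
  apply: filterS2 (ae_foralln H) e1 => t Ht et nt; apply: contrapT => nkt.
  have nk0 : 0 < n k t by rewrite lt0r n_ge0 andbT; apply/eqP.
  have m_pos (l : 'I_k.+1) : (0 < l)%N -> 0 < m (tnth t l).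
    by move=> l0; rewrite lt0r m_ge0 andbT; apply/eqP => ml; apply: nkt; exact: (et l).2 l0 ml.
  have H1 : \forall N \near \oo, forall l : 'I_k.+1, (0 < l)%N -> reg N (tnth t l).
    apply: reg_near_all => l l0; have ml := m_pos l l0.
    by split => //; exact: (et l).1.
  have [N [h1 h2]] := filter_ex (filterI (in_range_near nk0) H1).
  by apply: (Ht N); split => //; apply/eqP.
have muZ : mu Z = 0%E.
  transitivity (\sum_(k < kmax) marginal ord0 (ts_nu Psi k) Z)%E; first exact: (esym (ts_sources Psi mZ)).
  rewrite big1// => k _; have mZt := measurable_preimage_tnth (ord0 : 'I_k.+1) mZ.
  have [_ _ Hn] := dn k; rewrite /marginal /pushforward (Hn _ mZt).
  transitivity (\int[lam k]_(t in (fun t => tnth t ord0) @^-1` Z) (cst 0 t))%E; last exact: integral0.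
  apply: ae_eq_integral => //.
    by apply/measurable_EFinP; apply: measurable_funTS; exact: (@mn k).
  by apply: filterS (nuZ k) => t Ht /eqP Zt; rewrite Ht.
exists Z; split => // x /= nx.
by apply: contrapT => nx0; apply: nx; rewrite lt0r n_ge0 andbT; apply/negP.
Qed.

Lemma relay_pos : {ae mu, forall x, 0 < n0 x} -> {ae mu, forall x, 0 < m x}.
Proof.
move=> spos.
pose k1 : 'I_kmax := Ordinal kmax_gt1.
pose zero := [set x | m x == 0] `&` [set x | g 1 x == 0].
have H N : {ae lam k1, forall t, ~ [/\ n k1 t == 0, in_range (del N) (n0 (tnth t ord0)) &
    forall l : 'I_2, (0 < l)%N -> (in_range (del N) (g 0 (tnth t l)) /\ zero (tnth t l))]}.
  apply: (@exchange_null k1 [set t | n k1 t == 0] [set x | in_range (del N) (n0 x)]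
    ([set x | in_range (del N) (g 0 x)] `&` zero) 1 N) => //.
  - exact: (measurable_eq0 (@mn k1)).
  - exact: measurable_in_range.
  - by apply: measurableI; [exact: measurable_in_range|apply: measurableI; exact: measurable_eq0].
  - by left; split => // t /eqP.
  - by move=> x [].
  - by move=> x [_ [/eqP ? /eqP ?]]; right.
have m1 : {ae lam k1, forall t, m (tnth t ord_max) <> 0}.
  have e1 : {ae lam k1, forall t, m (tnth t ord_max) = 0 ->
      g 1 (tnth t ord_max) = 0 /\ 0 < g 0 (tnth t ord_max)}.
    by apply: filterS (ae_tnth (@ord_max 1) receivers_pos) => t [_].
  have e2 : {ae lam k1, forall t, 0 < n0 (tnth t ord0)} := ae_tnth (@ord0 1) spos.
  have e3 : {ae lam k1, forall t, m (tnth t ord_max) = 0 -> n k1 t = 0}.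
    exact: (nu_density_eq0 dm (dn k1) (l := ord_max) isT).
  apply: filterS2 (ae_foralln H) (filterI e1 (filterI e2 e3)) => t Ht [rt [st nt]] mt.
  have [g1t g0t] := rt mt.
  have : \forall N \near \oo, in_range (del N) (n0 (tnth t ord0)) /\
      in_range (del N) (g 0 (tnth t ord_max)).
    by near=> N; split; near: N; exact: in_range_near.
  move=> /filter_ex[N [h1 h2]]; apply: (Ht N); split => //; first by apply/eqP; exact: nt.
  move=> l l0; have -> : l = ord_max by apply/val_inj => /=; case: l l0 => [[|[|]]].
  by split => //; split; apply/eqP.
have mZ : measurable [set x | m x == 0] by exact: measurable_eq0.
have muZ : mu [set x | m x == 0] = 0%E.
  have [N [mN lamN PN]] := m1.
  have : lam k1 ((fun t => tnth t ord_max) @^-1` [set x | m x == 0]) = 0%E.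
    apply: (subset_measure0 _ mN _ lamN); first exact: (measurable_preimage_tnth ord_max mZ).
    by move=> t /= /eqP mt; apply: PN => /=; exact.
  rewrite [X in X = _ -> _](@power_measure_cylinder _ _ _ mu 2 ord_max _ mZ).
  move/eqP; rewrite mule_eq0 => /orP[/eqP //|]; rewrite expe_eq0 => /andP[_ /eqP muT].
  by move: mu_gt0; rewrite muT ltxx.
exists [set x | m x == 0]; split => // x /= mx.
by apply: contrapT => mx0; apply: mx; rewrite lt0r m_ge0 andbT; apply/negP.
Unshelve. all: by end_near. Qed.

Lemma receivers_all_pos : {ae mu, forall x, forall j, 0 < g j x}.
Proof.
by apply: filterS2 receivers_pos (relay_pos source_pos) => x [+ _] mx; exact.
Qed.

Let regular_ae (k : 'I_kmax) : {ae lam k, forall t,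
  0 < n0 (tnth t ord0) /\ \forall N \near \oo, forall l : 'I_k.+1, (0 < l)%N -> reg N (tnth t l)}.
Proof.
have e0 : {ae lam k, forall t, forall l : 'I_k.+1,
    (forall j, 0 < g j (tnth t l)) /\ 0 < m (tnth t l)}.
  apply: filter_forall => l.
  exact: filterI (ae_tnth l receivers_all_pos) (ae_tnth l (relay_pos source_pos)).
apply: filterS2 (ae_tnth (ord0 : 'I_k.+1) source_pos) e0 => t nt et; split => //.
by apply: reg_near_all => l _; have [gt mt] := et l.
Qed.

Lemma trajectory_pos (k : 'I_kmax) : (0 < k)%N -> {ae lam k, forall t, 0 < n k t}.
Proof.
move=> k_gt0.
have H N : {ae lam k, forall t, ~ [/\ n k t == 0, in_range (del N) (n0 (tnth t ord0)) &
    forall l : 'I_k.+1, (0 < l)%N -> reg N (tnth t l)]}.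
  apply: (@exchange_null k [set t | n k t == 0] [set x | in_range (del N) (n0 x)] (reg N) 1 N) => //.
  - exact: (measurable_eq0 (@mn k)).
  - exact: measurable_in_range.
  - by left; split => // t /eqP.
  - exact: reg0.
  - exact: reg1.
apply: filterS2 (ae_foralln H) (regular_ae k) => t Ht [nt rt].
rewrite lt0r n_ge0 andbT; apply/negP => nk0.
have [N [h1 h2]] := filter_ex (filterI (in_range_near nt) rt).
exact: (Ht N).
Qed.

Local Notation tpot := (trajectory_potential mu ft eta gamma beta c0 n g m kmax_gt0).
Local Notation rpot := (relay_potential mu eta beta c0 g m).
Local Notation spot := (source_potential ft gamma n kmax_gt0).

Lemma trajectory_stationary (k : 'I_kmax) : (0 < k)%N -> {ae lam k, forall t, tpot t = 0}.
Proof.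
move=> k_gt0.
pose E N := [set t | in_range (del N) (n k t)] `&`
  [set t | in_range (del N) (n0 (tnth t ord0))] `&`
  [set t : k.+1.-tuple T | forall l : 'I_k.+1, (0 < l)%N -> reg N (tnth t l)].
have mE N : measurable (E N).
  apply: measurableI; last exact: measurable_forall_tnth.
  apply: measurableI; first exact: (measurable_in_range _ (@mn k)).
  exact: (measurable_preimage_tnth (ord0 : 'I_k.+1) (measurable_in_range _ mn0)).
have mrp := measurable_relay_potential eta beta c0 ed.
have msp := measurable_source_potential gamma mft ed kmax_gt0.
have mpot : measurable_fun setT (fun t : k.+1.-tuple T => tpot t).
  apply: measurable_funD.
    apply: measurable_funB; last first.
      by apply: measurableT_comp => //; exact: measurable_tnth.
    apply: measurable_funD.
      by apply: measurable_funD => //; apply: measurableT_comp => //; exact: (@mn k).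
    by apply: measurable_funM => //; exact: (mft k).
  under eq_fun do rewrite big_mkcond/=.
  apply: measurable_sum => l; case: (0 < l)%N; last exact: measurable_cst.
  by apply: measurableT_comp => //; exact: measurable_tnth.
pose K := receiver_potential mu eta beta c0.
pose CR N := `|ln (del N)| + `|K 1%N| + (`|ln (del N)| + `|K 0%N|) + (`|ln (del N)| + 1).
pose CS N := `|ln (del N)| + 1 + `|gamma| * Bf.
have nD (x y X Y : R) : `|x| <= X -> `|y| <= Y -> `|x + y| <= X + Y.
  by move=> ? ?; rewrite (le_trans (ler_normD _ _))// lerD.
have nB (x y X Y : R) : `|x| <= X -> `|y| <= Y -> `|x - y| <= X + Y.
  by move=> ? ?; rewrite (le_trans (ler_normB _ _))// lerD.
have n1 : `|1 : R| <= 1 by rewrite normr1.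
have rB N x : reg N x -> `|rpot x| <= CR N.
  move=> [/(ln_in_range (del0 N)) r0 [/(ln_in_range (del0 N)) r1 /(ln_in_range (del0 N)) rm]].
  by apply: (nB _ _ _ _ (nB _ _ _ _ (nD _ _ _ _ r1 _) (nD _ _ _ _ r0 _)) (nD _ _ _ _ rm n1)).
have EB N t : E N t -> `|tpot t| <= CS N + CS N + \sum_(l < k.+1) CR N.
  move=> [[/(ln_in_range (del0 N)) r1 /(ln_in_range (del0 N)) r2] r3].
  have CR0 : 0 <= CR N by rewrite !addr_ge0.
  have gB (x : R) : `|x| <= Bf -> `|gamma * x| <= `|gamma| * Bf.
    by move=> xB; rewrite normrM ler_wpM2l.
  apply: (nD _ _ _ _ (nB _ _ _ _ (nD _ _ _ _ (nD _ _ _ _ r1 n1) (gB _ (ftB k t)))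
    (nD _ _ _ _ (nD _ _ _ _ r2 n1) (gB _ (ftB _ _))))).
  rewrite (le_trans (ler_norm_sum _ _ _))// big_mkcond; apply: ler_sum => l _.
  by case: ifP => // l0; exact: rB (r3 l l0).
have H N : {ae lam k, forall t, E N t -> tpot t = 0}.
  apply: (ae_eq0_both_signs (lamoo k) (mE N) mpot (EB N)) => D s mD DE s1.
  have [||||_] := trajectory_exchange mu_gt0 beta_ge0 c0_eta mft ftB ed minPsi Psi_oo
    (kmax_gt0 := kmax_gt0) (G0 := [set x | in_range (del N) (n0 x)]) (G1 := reg N)
    k_gt0 (del0 N) s1 mD (measurable_in_range _ mn0) (mreg N) _ _ _ _ (@reg0 N) (@reg1 s N).
  - by move=> t /DE[[]].
  - by move=> t l /DE[_]; exact.
  - by move=> t /DE[[]]; left.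
  - by move=> x; left.
  apply.
  - have z t : exchange_integrand n kmax_gt0 D t = 0.
      rewrite /exchange_integrand indicE; have [|_] := boolP (t \in D); last by rewrite mul0r.
      rewrite inE => /DE[[r1 r2] _].
      rewrite (negbTE (in_range_neq0 (del0 N) r1)) (negbTE (in_range_neq0 (del0 N) r2)).
      by rewrite subrr mulr0.
    by under eq_Rintegral do rewrite z; rewrite Rintegral_cst// mul0r.
  - by move=> x; exact: in_range_neq0.
  - by move=> t /DE[[r1 _] _]; exact: in_range_neq0 r1.
  - by move=> x [_ [r1 r2]]; split; [exact: in_range_neq0 r1|exact: in_range_neq0 r2].
apply: filterS3 (ae_foralln H) (regular_ae k) (trajectory_pos k_gt0) => t Ht [nt rt] nkt.
have [N [h1 [h2 h3]]] := filter_ex (filterI (in_range_near nkt) (filterI (in_range_near nt) rt)).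
by apply: (Ht N); split.
Qed.

Let w := fine (mu setT).
Let w_gt0 : 0 < w := muW_gt0 mu_gt0.

Let lc x := ln (g 0 x) - ln (g 1 x) + beta * (eta 0%N - eta 1%N) - ln w.

Let receiver_potentialE j : receiver_potential mu eta beta c0 j =
  beta * (eta j - c0) + (expR 1 * w)^-1 + j%:R * (1 + ln w) + ln j`!%:R - 1.
Proof.
rewrite /receiver_potential /receiver_weight -/w.
have e0 : 0 < expR 1 * w by rewrite mulr_gt0 ?expR_gt0.
have f_gt0 : 0 < j`!%:R :> R by rewrite ltr0n fact_gt0.
rewrite lnM ?posrE ?mulr_gt0 ?invr_gt0 ?exprn_gt0 ?expR_gt0//.
rewrite lnM ?posrE ?invr_gt0 ?exprn_gt0 ?expR_gt0//.
rewrite expRK !lnV ?posrE ?exprn_gt0// lnXn// lnM ?posrE ?expR_gt0// expRK.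
rewrite -[(1 + ln w) *+ j]mulr_natl; ring.
Qed.

Let fact1_ : (1%N)`! = 1%N. Proof. by []. Qed.

Let receivers_gibbs : {ae mu, forall x, forall j, g j x =
  g 0 x * expR (beta * eta 0%N) * (((expR (lc x) * w) ^+ j)^-1 * j`!%:R^-1) * expR (- beta * eta j)}.
Proof.
have H := ae_foralln (receiver_three_terms mu_gt0 beta_ge0 c0_eta mft ftB ed minPsi Psi_oo).
apply: filterS2 receivers_all_pos H => x gx Hx j.
pose a i := ln (g i x) + receiver_potential mu eta beta c0 i.
have aE i : a i = a 0%N + i%:R * (a 1%N - a 0%N).
  have step : forall i, a i = a 0%N + i%:R * (a 1%N - a 0%N) /\
      a i.+1 = a 0%N + i.+1%:R * (a 1%N - a 0%N).
    elim=> [|i' [IH1 IH2]]; first by split; ring.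
    split => //; have := Hx i' (gx _) (gx _) (gx _).
    rewrite -natr1 in IH2 *; rewrite -!natr1; move: IH1 IH2; rewrite /a/=; lra.
  by case: (step i).
have lnw : expR (ln w) = w by rewrite lnK ?posrE.
have lng : ln (g j x) = ln (g 0 x) + beta * eta 0%N - j%:R * (lc x + ln w) - ln j`!%:R - beta * eta j.
  have := aE j; rewrite /a !receiver_potentialE /lc fact0 ?fact1_ !ln1; lra.
move: (lc x) lng => L lng; rewrite -[LHS](lnK (gx j)) lng !expRD !expRN lnK ?posrE// lnK ?posrE ?ltr0n ?fact_gt0//.
rewrite (mulNr beta) expRN expRM_natl expRD lnw; ring.
Qed.

Let trajectories_gibbs (k : 'I_kmax) : {ae lam k, forall t,
  n k t / (\prod_(l < k.+1 | (0 < l)%N) m (tnth t l)) =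
  n0 (tnth t ord0) * expR (gamma * source_cost ft kmax_gt0 (tnth t ord0)) *
    (\prod_(l < k.+1 | (0 < l)%N) expR (lc (tnth t l))) * expR (- gamma * ft k t)}.
Proof.
have [k_gt0|] := ltnP 0%N k; last first.
  rewrite leqn0 => /eqP kz; have -> : k = Ordinal kmax_gt0 by apply/val_inj.
  apply: aeW => t; rewrite !big1; last 2 first.
  - by case=> [[]].
  - by case=> [[]].
  rewrite /source_density /source_cost -one_tupleE divr1 mulr1 -mulrA -expRD.
  by rewrite mulNr subrr expR0 mulr1.
have e0 : {ae lam k, forall t, forall l : 'I_k.+1, 0 < m (tnth t l)}.
  by apply: filter_forall => l; exact: (ae_tnth l (relay_pos source_pos)).
apply: filterS3 (trajectory_stationary k_gt0) (trajectory_pos k_gt0)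
  (filterI e0 (ae_tnth (ord0 : 'I_k.+1) source_pos)) => t st nt [mt n0t].
have P_gt0 : 0 < \prod_(l < k.+1 | (0 < l)%N) m (tnth t l) by apply: prodr_gt0.
apply: (canLR (mulfK _)); first by rewrite gt_eqF.
have -> : \prod_(l < k.+1 | (0 < l)%N) m (tnth t l) =
    expR (\sum_(l < k.+1 | (0 < l)%N) ln (m (tnth t l))).
  by rewrite expR_sum; apply: eq_bigr => l _; rewrite lnK ?posrE.
rewrite -expR_sum -{1}(lnK n0t) -[LHS](lnK nt) -!expRD; congr expR.
move: st; rewrite /trajectory_potential /source_potential.
have -> : \sum_(l < k.+1 | (0 < l)%N) rpot (tnth t l) =
    - (\sum_(l < k.+1 | (0 < l)%N) lc (tnth t l))
    - (\sum_(l < k.+1 | (0 < l)%N) ln (m (tnth t l))).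
  rewrite -!sumrN -big_split/=; apply: eq_bigr => l _.
  rewrite /relay_potential !receiver_potentialE /lc fact0 ?fact1_ !ln1; ring.
lra.
Qed.

Theorem gibbs_of_minimizer : exists A B C : T -> R,
  [/\ measurable_fun setT A /\ (forall x, 0 <= A x),
      measurable_fun setT B /\ (forall x, 0 <= B x),
      measurable_fun setT C /\ (forall x, 0 <= C x) &
      gibbs_form ft eta gamma beta A B C Psi].
Proof.
pose A x := n0 x * expR (gamma * source_cost ft kmax_gt0 x).
pose B x := g 0 x * expR (beta * eta 0%N).
pose C x := expR (lc x).
have mlc : measurable_fun setT lc.
  apply: measurable_funB; last exact: measurable_cst.
  apply: measurable_funD; last exact: measurable_cst.
  by apply: measurable_funB; apply: measurableT_comp => //; exact: mg.
have mA : measurable_fun setT A.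
  apply: measurable_funM => //; apply: measurableT_comp => //; apply: measurable_funM => //.
  exact: (measurable_source_cost mft kmax_gt0).
have mB : measurable_fun setT B by apply: measurable_funM; [exact: mg|exact: measurable_cst].
have mC : measurable_fun setT C by exact: measurableT_comp.
have A0 x : 0 <= A x by rewrite mulr_ge0 ?expR_ge0// n_ge0.
have B0 x : 0 <= B x by rewrite mulr_ge0 ?expR_ge0// g_ge0.
have C0 x : 0 < C x by exact: expR_gt0.
exists A, B, C; split; [by []|by []|by split => // x; exact: ltW|].
split=> [k D mD|j D mD].
  pose r (t : k.+1.-tuple T) := A (tnth t ord0) * (\prod_(l < k.+1 | (0 < l)%N) C (tnth t l)) *
    expR (- gamma * ft k t).
  have mr : measurable_fun setT r.
    apply: measurable_funM.
      apply: measurable_funM; last exact: measurable_prod_tnth mC.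
      by apply: measurableT_comp => //; exact: measurable_tnth.
    by apply: measurableT_comp => //; apply: measurable_funM => //; exact: (mft k).
  have r0 t : 0 <= r t.
    by rewrite mulr_ge0 ?expR_ge0// mulr_ge0// prodr_ge0// => l _; exact: ltW.
  have aer := dominates_ae (is_density_dominates (is_density_reference k dm)) (trajectories_gibbs k).
  have [_ _ H] := is_density_ae (is_density_nu_reference dm (dn k)) mr r0 aer.
  exact: H.
have [_ _ ->//] := dg j.
have cw x : 0 < C x * w by rewrite mulr_gt0.
pose r x := B x * (((C x * w) ^+ j)^-1 * j`!%:R^-1) * expR (- beta * eta j).
transitivity (\int[mu]_(x in D) (r x)%:E)%E; last first.
  apply: eq_integral => x _; rewrite /r -/w.
  have -> : (((C x * w)%:E ^+ j)^-1 = (((C x * w) ^+ j)^-1)%:E)%E.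
    by rewrite -EFin_expe inver gt_eqF ?exprn_gt0.
  by rewrite -!EFinM.
apply: ae_eq_integral => //.
- by apply/measurable_EFinP; apply: measurable_funTS; exact: mg.
- apply/measurable_EFinP; apply: measurable_funTS.
  apply: measurable_funM; last exact: measurable_cst.
  apply: measurable_funM => //; apply: measurable_funM; last exact: measurable_cst.
  apply: measurable_funV; last by move=> x; rewrite exprn_ge0// ltW.
  by apply: measurable_funX; apply: measurable_funM => //; exact: measurable_cst.
by apply: filterS receivers_gibbs => x Hx _; rewrite (Hx j).
Qed.

End positivity.


Section subspace_compact.
Context (X : topologicalType) (W : set X).

Lemma compact_set_type : compact W -> compact [set: set_type W].
Proof.
move=> Wco F PF _.
have FW : (set_val @ F) W.
  by apply: (@filterE _ F _ (fun x => W (set_val x))) => -[x Wx]; exact: set_mem Wx.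
have [p [Wp clp]] := Wco (set_val @ F) _ FW.
exists (exist _ p (mem_set Wp)); split => // A B FA [_ [[Q oQ <-] Qp] QB].
have FA' : (set_val @ F) (set_val @` A).
  exact: (@filterS _ F _ A (fun x => (set_val @` A) (set_val x)) (@preimage_image _ _ set_val A) FA).
have [_ [[a Aa <-] Qa]] := clp _ _ FA' (open_nbhs_nbhs (conj oQ Qp)).
by exists a; split => //; exact: QB.
Qed.

End subspace_compact.

Section product_of_borel.
Context (X : ptopologicalType) (k : nat).
Hypothesis Xco : compact [set: X].
Local Notation P := {ptws 'I_k -> X}.

Let path (x : k.-tuple (borel X)) : P := tnth x.
Let tset (V : set P) : set (k.-tuple (borel X)) := path @^-1` V.

Lemma ptws_measurable_base (U : set P) y : open U -> U y ->
  exists V : set P, [/\ open V, V y, V `<=` U & measurable (tset V)].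
Proof.
move=> oU Uy; have : nbhs y U by exact: open_nbhs_nbhs.
move=> [] _ [] [] Q QfinP <- [] V QV Vy QU.
exists V; split => //.
- by exists [set V]; [move=> _ ->; exact: QfinP|rewrite bigcup_set1].
- by move=> z Vz; apply: QU; exists V.
have [L Lsub <-] := QfinP _ QV.
rewrite /tset preimage_bigcap; apply: fin_bigcap_measurable; first exact: finite_fset.
move=> M /Lsub /set_mem [i _ [G oG <-]].
rewrite (_ : _ @^-1` _ = (fun x : k.-tuple (borel X) => tnth x i) @^-1` G)//.
rewrite -[X in measurable X]setTI; apply: measurable_tnth => //.
exact: sub_sigma_algebra.
Qed.

Lemma compact_ptws : compact [set: P].
Proof.
have := @tychonoff 'I_k (fun=> X) (fun=> setT) (fun=> Xco).
by rewrite (_ : [set f | _] = setT)//; apply/seteqP; split.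
Qed.

Variables (R : realType) (F : P -> R).
Hypothesis cF : continuous F.

Lemma continuous_ptws_bounded : exists B, forall y, `|F y| <= B.
Proof.
have : compact (F @` setT).
  by apply: continuous_compact; [exact: continuous_subspaceT|exact: compact_ptws].
move=> /compact_bounded [M [_ HM]]; exists (M + 1) => y.
by apply: HM; [rewrite ltrDl|exists y].
Qed.

Lemma continuous_ptws_measurable :
  measurable_fun setT (fun x : k.-tuple (borel X) => F (tnth x)).
Proof.
apply: (measurability _ (RGenInftyO.measurableE R)) => // _ [_ [a ->] <-].
rewrite setTI; pose U := F @^-1` `]-oo, a[.
have oU : open U by apply: open_comp => // y _; exact: cF.
have HV N : exists V : set P, [/\ V `<=` U, measurable (tset V) &
    [set y | F y <= a - N.+1%:R^-1] `<=` V].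
  have Kco : compact [set y | F y <= a - N.+1%:R^-1].
    apply: (subclosed_compact _ compact_ptws) => //.
    by apply: (@closed_comp _ _ F [set z | z <= a - N.+1%:R^-1]) => // y _; exact: cF.
  pose P' : ptopologicalType := HB.pack P (isPointed.Build P (fun=> point)).
  have Kcov' : @cover_compact P' [set y | F y <= a - N.+1%:R^-1].
    by rewrite -(@compact_cover P').
  move: Kcov' => /(_ _ [set V : set P | [/\ open V, V `<=` U & measurable (tset V)]] id).
  case=> [V []//|y Ky|D DV Kcov].
    have Uy : U y.
      rewrite /U/= in_itv/=; apply: (le_lt_trans Ky).
      by rewrite ltrBlDr ltrDl invr_gt0.
    by have [V [oV Vy VU mV]] := ptws_measurable_base oU Uy; exists V.
  eexists; split; last exact: Kcov.
    by move=> y [V /DV /set_mem [_ VU _]]; exact: VU.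
  rewrite /tset preimage_bigcup; apply: fin_bigcup_measurable; first exact: finite_fset.
  by move=> V /DV /set_mem [].
have /choice[V HV'] := HV.
rewrite (_ : _ @^-1` _ = \bigcup_N tset (V N)).
  by apply: bigcup_measurable => N _; case: (HV' N).
apply/seteqP; split => x.
  rewrite /= in_itv/= => xa.
  have [N HN] := ltr_add_invr xa.
  by exists N => //; have [_ _] := HV' N; apply; rewrite /= lerBrDr ltW.
by move=> [N _ VNx]; have [VU _ _] := HV' N; exact: (VU _ VNx).
Qed.

End product_of_borel.

Theorem proposition1p3 (R : realType) (d : nat) (hd : (0 < d)%N)
    (W : set 'rV[R]_d) (W_compact : compact W) (W0 : W 0)
    (mu : fmeasure R (subspace0 W0))
    (mu_ac : lebesgue_ac mu) (mu_gt0 : (0 < mu setT)%E)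
    (kmax : nat) (hkmax : (1 < kmax)%N)
    (f : forall k : 'I_kmax, fmeasure R (subspace0 W0)
      * {ptws 'I_k.+1 -> subspace0 W0} -> R)
    (f_continuous : forall k, continuous (f k))
    (f_bounded_below : forall k, exists c : R, forall p, c <= f k p)
    (eta : nat -> R)
    (eta_bounded_below : exists c : R, forall m, c <= eta m)
    (eta_superlinear : (fun m : nat => eta m / m%:R) @ \oo --> +oo)
    (gamma beta : R) (gamma_gt0 : 0 < gamma) (beta_gt0 : 0 < beta) :
  let ft (k : 'I_kmax) (x : k.+1.-tuple (borel (subspace0 W0))) : R :=
    f k (mu, tnth x) in
  (exists Psi : trajectory_setting kmax mu,
     is_minimizer ft eta gamma beta Psi) /\
  (forall Psi : trajectory_setting kmax mu,
     is_minimizer ft eta gamma beta Psi ->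
     exists A B C : borel (subspace0 W0) -> R,
       [/\ measurable_fun setT A /\ (forall x, 0 <= A x),
           measurable_fun setT B /\ (forall x, 0 <= B x),
           measurable_fun setT C /\ (forall x, 0 <= C x) &
           gibbs_form ft eta gamma beta A B C Psi]).
Proof.
move=> ft; pose T := borel (subspace0 W0).
have Xco : compact [set: subspace0 W0] by exact: compact_set_type W_compact.
have cF (k : 'I_kmax) : continuous (fun y : {ptws 'I_k.+1 -> subspace0 W0} => f k (mu, y)).
  move=> y U /(f_continuous k (mu, y))[[P Q] [Pmu Qy] PQU].
  apply: (@filterS _ (nbhs y) _ Q) Qy => z Qz; apply: PQU; split => //.
  exact: nbhs_singleton Pmu.
have /choice[B HB] := fun k => continuous_ptws_bounded Xco (cF k).
pose Bf := \sum_(k < kmax) `|B k|.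
have ftB (k : 'I_kmax) (x : k.+1.-tuple T) : `|ft k x| <= Bf.
  rewrite (le_trans (HB k _))// (le_trans (ler_norm _))// /Bf (bigD1 k)//= lerDl.
  exact: sumr_ge0.
have mft (k : 'I_kmax) : measurable_fun setT (ft k).
  exact: (continuous_ptws_measurable Xco (cF k)).
have [c0 c0_eta] := eta_bounded_below.
have eta_sup K : exists J, forall j, (J <= j)%N -> K * j%:R <= eta j.
  have /cvgryPge/(_ K)[J _ HJ] := eta_superlinear.
  exists J.+1 => j Jj; have j0 : 0 < j%:R :> R by rewrite ltr0n (leq_ltn_trans _ Jj).
  by rewrite -ler_pdivlMr//; exact: HJ (ltnW Jj).
have kmax_gt0 := ltnW hkmax; have beta_ge0 := ltW beta_gt0.
split; first exact: (minimizer_exists gamma kmax_gt0 mu_gt0 beta_gt0 c0_eta eta_sup mft ftB).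
move=> Psi minPsi.
have Psi_oo : (objective ft eta gamma beta Psi < +oo)%E.
  have [Psi0 HPsi0] := objective_finite_exists gamma kmax_gt0 beta_ge0 c0_eta mft ftB mu_gt0.
  by rewrite minPsi (le_lt_trans _ HPsi0)//; apply: ereal_inf_lbound; exists Psi0.
have [n [g [m ed]]] := entropic_density_exists mu_gt0 beta_ge0 c0_eta mft ftB Psi_oo.
exact: (gibbs_of_minimizer mu_gt0 beta_ge0 c0_eta mft ftB ed minPsi Psi_oo hkmax).
Qed.
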